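(* Let $U\subseteq\mathbf{R}^d$ be open, $u\in\mathcal{D}'(U)$, $\tau>0$, $\sigma>1$, and let $\Omega\subseteq U$ be an open set whose closure is contained in $U$. Let $\{u_N\}_{N\in\mathbf{N}}$ be a bounded sequence in $\mathcal{E}'(U)$ such that $u_N=u$ on $\Omega$ for every $N$ and, for some constants $A,h>0$, $$|\widehat u_N(\xi)|\le A\,\frac{h^N N!^{\tau/\sigma}}{|\xi|^{\lfloor N^{1/\sigma}\rfloor}},\qquad N\in\mathbf{N},\ \xi\in\mathbf{R}^d\setminus\{0\}.$$ Then $u\in\mathcal{E}_{\{\tau,\sigma\}}(\Omega)$.
   Context: $\mathbf{N}$ denotes the nonnegative integers, $\mathcal{D}'(U)$ the Schwartz distributions on $U$, $\mathcal{E}'(U)$ the compactly supported ones (with the strong topology), $\lfloor\cdot\rfloor$ the floor function, and $\widehat f(\xi)=\int f(x)e^{-2\pi i x\xi}\,dx$. $\mathcal{E}_{\{\tau,\sigma\}}(\Omega)$ is the set of $\phi\in C^\infty(\Omega)$ such that for every compact $K\subset\Omega$ there are $h>0$, $A>0$ with $|\partial^\alpha\phi(x)|\le A h^{|\alpha|^\sigma}|\alpha|^{\tau|\alpha|^\sigma}$ for all $\alpha\in\mathbf{N}^d$, $x\in K$ (with $|\alpha|^{\tau|\alpha|^\sigma}=1$ for $\alpha=0$); $u\in\mathcal{E}_{\{\tau,\sigma\}}(\Omega)$ means that the restriction of $u$ to $\Omega$ is given by such a function. *)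

(* Defs.v *)
From mathcomp Require Import all_boot all_order all_algebra.
From mathcomp Require Import all_classical all_reals all_analysis.
From mathcomp Require Import complex.

Set Implicit Arguments.
Unset Strict Implicit.
Unset Printing Implicit Defensive.

Import Order.TTheory GRing.Theory Num.Theory.
Import numFieldNormedType.Exports.

Local Open Scope classical_set_scope.
Local Open Scope ring_scope.
Local Open Scope complex_scope.

(* Functions on an open subset of R^d are represented by total functions on
   'rV[R]_d whose values outside that subset are irrelevant.  Functionals are
   likewise total on all functions, and only their values on smooth or test
   functions matter. *)

Section Calculus.
Variables (R : realType) (d : nat).
Local Notation Rd := 'rV[R]_d.
Implicit Types (U K : set Rd) (phi : Rd -> R[i]).

Definition partials (s : seq 'I_d) (f : Rd -> R) : Rd -> R :=
  foldr (fun i g => 'D_(delta_mx 0 i : Rd) g) f s.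

Definition real_smooth U (f : Rd -> R) : Prop :=
  forall (s : seq 'I_d) (x : Rd), U x ->
    {for x, continuous (partials s f)} /\
    (forall i : 'I_d, derivable (partials s f) x (delta_mx 0 i : Rd)).

Definition smooth U phi : Prop :=
  real_smooth U (fun x => complex.Re (phi x)) /\
  real_smooth U (fun x => complex.Im (phi x)).

Definition mindex := {ffun 'I_d -> nat}.

Definition mlen (alpha : mindex) : nat := (\sum_i alpha i)%N.

Definition mdirs (alpha : mindex) : seq 'I_d :=
  flatten [seq nseq (alpha i) i | i <- enum 'I_d].

Definition mderive (alpha : mindex) phi (x : Rd) : R[i] :=
  partials (mdirs alpha) (fun y => complex.Re (phi y)) x +i*
  partials (mdirs alpha) (fun y => complex.Im (phi y)) x.

(* max over |alpha| <= m of sup_K |d^alpha phi| *)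
Definition seminorm K (m : nat) phi : R :=
  sup [set r | exists (alpha : mindex) (x : Rd),
         [/\ (mlen alpha <= m)%N, K x & r = Normc.normc (mderive alpha phi x)]].

Definition fsupp phi : set Rd := closure [set x | phi x != 0].

Definition test_fun U phi : Prop :=
  [/\ smooth setT phi, compact (fsupp phi) & fsupp phi `<=` U].

Definition dotv (x y : Rd) : R := \sum_i x 0 i * y 0 i.

(* The norm of the library on 'rV[R]_d is the maximum norm. *)
Definition euclid (x : Rd) : R := Num.sqrt (dotv x x).

(* x |-> exp (- 2 pi i x.xi) *)
Definition fourier_kernel (xi : Rd) : Rd -> R[i] := fun x =>
  cos (2 * pi * dotv x xi) +i* - sin (2 * pi * dotv x xi).

End Calculus.

(* Integral over R^d, as an iterated Lebesgue integral; it is only applied to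
   continuous functions of compact support, for which this is the
   d-dimensional Lebesgue integral by Fubini's theorem. *)
Fixpoint integralRd (R : realType) (d : nat) : ('rV[R]_d -> R) -> R :=
  match d with
  | 0%N => fun f => f 0
  | d'.+1 => fun f =>
      Rintegral (@lebesgue_measure R) setT (fun t : R =>
        integralRd (fun y : 'rV[R]_d' => f (row_mx (t%:M : 'rV[R]_1) y)))
  end.

Definition integralC (R : realType) (d : nat) (f : 'rV[R]_d -> R[i]) : R[i] :=
  integralRd (fun x => complex.Re (f x)) +i*
  integralRd (fun x => complex.Im (f x)).

Section Distributions.
Variables (R : realType) (d : nat).
Local Notation Rd := 'rV[R]_d.
Local Notation functional := ((Rd -> R[i]) -> R[i]).
Implicit Types (U V W K : set Rd) (T : functional).

(* D'(U) *)
Definition schwartz_distribution U T : Prop :=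
  (forall (a : R[i]) (phi psi : Rd -> R[i]), test_fun U phi -> test_fun U psi ->
     T (fun x => a * phi x + psi x) = a * T phi + T psi) /\
  (forall K, compact K -> K `<=` U ->
     exists (C : R) (m : nat), forall phi : Rd -> R[i],
       test_fun U phi -> fsupp phi `<=` K ->
       Normc.normc (T phi) <= C * seminorm K m phi).

Definition dsupp U T : set Rd :=
  [set x | U x /\ forall V, open V -> V x -> V `<=` U ->
             exists phi, test_fun V phi /\ T phi != 0].

(* E'(U) *)
Definition compact_distribution U T : Prop :=
  schwartz_distribution U T /\ compact (dsupp U T).

Definition is_cutoff U T (chi : Rd -> R[i]) : Prop :=
  test_fun U chi /\
  exists V, [/\ open V, dsupp U T `<=` V & forall x, V x -> chi x = 1].

(* The canonical extension of T in E'(U) to C^oo(U): <T, phi> = T (chi phi) for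
   a cutoff chi; it does not depend on the chosen chi. *)
Definition pairing U T (phi : Rd -> R[i]) : R[i] :=
  T (fun x => xget (fun=> 0) [set chi | is_cutoff U T chi] x * phi x).

Definition fourier U T (xi : Rd) : R[i] := pairing U T (fourier_kernel xi).

Definition bounded_in_smooth U (B : set (Rd -> R[i])) : Prop :=
  (forall phi, B phi -> smooth U phi) /\
  (forall K (m : nat), compact K -> K `<=` U ->
     exists M : R, forall phi, B phi -> seminorm K m phi <= M).

(* Boundedness in E'(U) for the strong topology, whose seminorms are
   T |-> sup_(phi in B) |<T, phi>| for B bounded in C^oo(U). *)
Definition strongly_bounded U (S : set functional) : Prop :=
  (forall T, S T -> compact_distribution U T) /\
  (forall B, bounded_in_smooth U B ->
     exists M : R, forall T phi, S T -> B phi ->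
       Normc.normc (pairing U T phi) <= M).

Definition dist_eq_on W T1 T2 : Prop :=
  forall psi, test_fun W psi -> T1 psi = T2 psi.

Definition dist_fun_on W T (phi : Rd -> R[i]) : Prop :=
  forall psi, test_fun W psi -> T psi = integralC (fun x => phi x * psi x).

(* E_{tau,sigma}(W).  As 0 `^ 0 = 1, the bound for alpha = 0 is A. *)
Definition ext_gevrey (tau sigma : R) W (phi : Rd -> R[i]) : Prop :=
  smooth W phi /\
  forall K, compact K -> K `<=` W ->
    exists h A : R, [/\ 0 < h, 0 < A &
      forall (alpha : mindex d) (x : Rd), K x ->
        Normc.normc (mderive alpha phi x) <=
          A * h `^ ((mlen alpha)%:R `^ sigma)
            * (mlen alpha)%:R `^ (tau * (mlen alpha)%:R `^ sigma)].

Definition dist_ext_gevrey (tau sigma : R) W T : Prop :=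
  exists phi, ext_gevrey tau sigma W phi /\ dist_fun_on W T phi.

End Distributions.

(* Main.v *)
Require Import Defs.
From mathcomp Require Import all_boot all_order all_algebra.
From mathcomp Require Import all_classical all_reals all_analysis.
From mathcomp Require Import complex ring lra.
Set Implicit Arguments.
Unset Strict Implicit.
Unset Printing Implicit Defensive.
Import Order.TTheory GRing.Theory Num.Theory.
Import numFieldNormedType.Exports.
Local Open Scope classical_set_scope.
Local Open Scope ring_scope.
Local Open Scope complex_scope.

(** The proof uses Fourier series in place of Fourier integrals.

Fix N and write T for u_N, chi for a cutoff of T. For L >= 1 so large that the
support of chi lies in the box |x_i| <= L/4, the claim is that T is given inside
that box by the sum of the series
L^-d sum_xi T^(xi) exp (2 pi i x.xi), xi in L^-1 Z^d, where T^(xi) is the value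
of the transform of T. To see this, approximate a test function psi, supported in
the box, by its Fejer means, that is by its convolutions over the period with the
Fejer kernel. The means converge uniformly in the box ([korovkin]: the kernel
has mass one and its second moment is O(1/n)), and so do all their derivatives,
because integration by parts makes the means commute with differentiation
([fmean_partials]). Hence T(psi) = T(chi psi) is the limit of T applied to chi
times the means ([fmean_dist]). These are finite combinations of functions chi
times an exponential, so T of them is the integral of psi against the Fejer means
of the series above ([dist_fmean]), which converge uniformly ([dist_box_density]).

This avoids the inversion theorem on R^d and gives estimates in which L does not
appear. If |T^(xi)| <= B max(1, |xi|)^-(p + 2d), then the sum over the lattice
of the weights prod_i 4/(1 + |xi_i|)^2, normalised by L^-d, is at most 12^d for
every L >= 1, and the derivatives of order < p of the real and of the imaginary
part of the sum of the series are at most 2 (2 pi)^p 12^d B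
([fourier_series_deriv], [fourier_series_partials]). The period may therefore
depend on N.

The decay for |xi| >= 1 is the hypothesis, for an N with N^(1/sigma) >= p + 2 + 2d.
The exponentials with |xi| <= 1 form a bounded set of smooth functions, so the
strong boundedness of the sequence gives one bound for all N
([small_freq_bound], [fourier_decay]). The choice of N of size
(p + 2 + 2d)^sigma turns h^N N!^(tau/sigma) into
exp(O(p^sigma)) p^(tau p^sigma), since
N log N = sigma p^sigma log p + O(p^sigma) ([gevrey_growth]).

It remains to put the pieces together. The densities obtained from different N
and L all represent u in Omega, so they agree where both are defined
([box_unique], [dn_agree]); the function phi that they define is near each point,
and for each p, the sum of a series whose derivatives of order p obey the bound
above. *)

(** * Functions of finite differentiability order *)

Section QuadraticRemainder.
Variables (R : realType) (V : normedModType R).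

(** In this form differentiability passes to limits and to integrals: a remainder
bounded by C h^2 with the same C for all approximants survives. *)
Lemma is_derive_quad (v : V) (f : V -> R) (x : V) (df C : R) :
  (forall h, `|f (h *: v + x) - f x - h * df| <= C * h ^+ 2) ->
  is_derive x v f df.
Proof.
move=> H.
have cv : (fun h => h^-1 *: ((f \o shift x) (h *: v) - f x)) @ 0^' --> df.
  apply/cvgrPdist_le => e e0.
  have C1 : 0 < `|C| + 1 by rewrite ltr_wpDl.
  have e1 : 0 < e / (`|C| + 1) by rewrite divr_gt0.
  exists (e / (`|C| + 1)) => //= h; rewrite /ball_/= sub0r normrN => hlt h0.
  rewrite distrC /GRing.scale/=.
  have -> : h^-1 * (f (h *: v + x) - f x) - df =
            h^-1 * (f (h *: v + x) - f x - h * df).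
    by rewrite [RHS]mulrBr mulrA mulVf// mul1r.
  rewrite normrM normfV ler_pdivrMl ?normr_gt0//.
  apply: (le_trans (H h)).
  have -> : h ^+ 2 = `|h| * `|h| by rewrite -expr2 real_normK ?num_real.
  rewrite mulrA mulrC ler_wpM2l//.
  apply: le_trans (_ : (`|C| + 1) * `|h| <= _).
    by rewrite ler_wpM2r// (le_trans (ler_norm _))// lerDl.
  by rewrite mulrC -ler_pdivlMr// ltW.
apply: DeriveDef; first by apply/cvg_ex; exists df.
exact: cvg_lim.
Qed.

End QuadraticRemainder.

Section CnCalculus.
Variables (R : realType) (d : nat).
Local Notation Rd := 'rV[R]_d.
Implicit Types (f g : Rd -> R) (x : Rd).

Definition dir (i : 'I_d) : Rd := delta_mx 0 i.

(** The derivatives are asserted to exist rather than computed, so that the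
calculus rules follow by exhibiting them, by induction on the order. *)
Fixpoint Cn (n : nat) (f : Rd -> R) : Prop :=
  continuous f /\
  match n with
  | 0%N => True
  | n'.+1 => exists Df : 'I_d -> Rd -> R,
      (forall i x, is_derive x (dir i) f (Df i x)) /\ forall i, Cn n' (Df i)
  end.

Lemma Cn_continuous n f : Cn n f -> continuous f.
Proof. by case: n => [|n] []. Qed.

Lemma CnW n f : Cn n.+1 f -> Cn n f.
Proof.
elim: n f => [|n IH] f [cf [Df [dDf cDf]]]; split=> //.
by exists Df; split=> // i; exact: IH.
Qed.

Lemma partials_rcons s i f : partials (rcons s i) f = partials s ('D_(dir i) f).
Proof. by rewrite /partials foldr_rcons. Qed.

Lemma derive_fun v f (Df : Rd -> R) :
  (forall x, is_derive x v f (Df x)) -> 'D_v f = Df.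
Proof. by move=> h; apply/funext => x; rewrite derive_val. Qed.

(** The innermost derivative of an iterated one is its last direction; hence the
induction on the list from the right. *)
Lemma Cn_partials s f : Cn (size s).+1 f ->
  continuous (partials s f) /\
  forall i x, derivable (partials s f) x (dir i).
Proof.
elim/last_ind: s f => [|s i IH] f.
  by move=> [cf [Df [dDf _]]]; split=> // i x; have [] := dDf i x.
rewrite size_rcons partials_rcons => -[cf [Df [dDf cDf]]].
by rewrite (derive_fun (dDf i)); apply: IH.
Qed.

Lemma real_smoothTP f : real_smooth setT f <-> forall n, Cn n f.
Proof.
split; last first.
  move=> Cf s x _; have [cs ds] := Cn_partials (Cf (size s).+1).
  by split=> [|i]; [exact: cs|exact: ds].
move=> sf n; elim: n f sf => [|n IH] f sf.
  by split=> // x; have [] := sf [::] x I.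
split; first by move=> x; have [] := sf [::] x I.
exists (fun i => 'D_(dir i) f); split=> [i x|i].
  by apply: derivableP; have [_] := sf [::] x I; exact.
by apply: IH => s x _; rewrite -partials_rcons; exact: sf.
Qed.

Lemma is_derive_bigsum (I : Type) (r : seq I) (F : I -> Rd -> R) (DF : I -> R) x v :
  (forall i, is_derive x v (F i) (DF i)) ->
  is_derive x v (fun y => \sum_(i <- r) F i y) (\sum_(i <- r) DF i).
Proof.
move=> dF; elim: r => [|i r IH].
  rewrite big_nil (_ : (fun y => _) = fun=> 0); first exact: is_derive_cst.
  by apply/funext => y; rewrite big_nil.
rewrite big_cons (_ : (fun y => _) = fun y => F i y + \sum_(j <- r) F j y).
  exact: is_deriveD.
by apply/funext => y; rewrite big_cons.
Qed.

Lemma Cn_cst n c : Cn n (fun=> c).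
Proof.
elim: n c => [|n IH] c; split=> //; try exact: cst_continuous.
exists (fun _ _ => 0); split=> [i x|i]; last exact: IH.
exact: is_derive_cst.
Qed.

Lemma Cn_add n f g : Cn n f -> Cn n g -> Cn n (fun x => f x + g x).
Proof.
elim: n f g => [|n IH] f g.
  by move=> [cf _] [cg _]; split=> //; move=> x; exact: (cvgD (cf x) (cg x)).
move=> [cf [Df [dDf cDf]]] [cg [Dg [dDg cDg]]]; split.
  by move=> x; exact: (cvgD (cf x) (cg x)).
exists (fun i x => Df i x + Dg i x); split=> [i x|i]; last exact: (IH _ _ (cDf i) (cDg i)).
exact: is_deriveD.
Qed.

Lemma Cn_mul n f g : Cn n f -> Cn n g -> Cn n (fun x => f x * g x).
Proof.
elim: n f g => [|n IH] f g.
  by move=> [cf _] [cg _]; split=> //; move=> x; exact: (cvgM (cf x) (cg x)).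
move=> Cf Cg; have Cf' := CnW Cf; have Cg' := CnW Cg.
move: Cf Cg => [cf [Df [dDf cDf]]] [cg [Dg [dDg cDg]]]; split.
  by move=> x; exact: (cvgM (cf x) (cg x)).
exists (fun i x => f x * Dg i x + g x * Df i x); split=> [i x|i].
  exact: is_deriveM.
exact: (Cn_add (IH _ _ Cf' (cDg i)) (IH _ _ Cg' (cDf i))).
Qed.

Lemma Cn_scale n c f : Cn n f -> Cn n (fun x => c * f x).
Proof. by move=> Cf; apply: Cn_mul => //; exact: Cn_cst. Qed.

Lemma Cn_opp n f : Cn n f -> Cn n (fun x => - f x).
Proof.
move=> Cf; rewrite (_ : (fun x => _) = (fun x => -1 * f x)).
  exact: Cn_scale.
by apply/funext => x; rewrite mulN1r.
Qed.

Lemma Cn_sub n f g : Cn n f -> Cn n g -> Cn n (fun x => f x - g x).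
Proof. by move=> Cf Cg; apply: Cn_add => //; exact: Cn_opp. Qed.

Lemma Cn_sum n (I : Type) (r : seq I) (P : pred I) (F : I -> Rd -> R) :
  (forall i, P i -> Cn n (F i)) -> Cn n (fun x => \sum_(i <- r | P i) F i x).
Proof.
move=> CF; elim: r => [|i r IH].
  by rewrite (_ : (fun x => _) = fun=> 0); [exact: Cn_cst|apply/funext => x; rewrite big_nil].
case: (boolP (P i)) => Pi.
  rewrite (_ : (fun x => _) = fun x => F i x + \sum_(j <- r | P j) F j x).
    by apply: Cn_add => //; exact: CF.
  by apply/funext => x; rewrite big_cons Pi.
rewrite (_ : (fun x => _) = fun x => \sum_(j <- r | P j) F j x) //.
by apply/funext => x; rewrite big_cons (negbTE Pi).
Qed.

Lemma Cn_prod n (I : Type) (r : seq I) (P : pred I) (F : I -> Rd -> R) :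
  (forall i, P i -> Cn n (F i)) -> Cn n (fun x => \prod_(i <- r | P i) F i x).
Proof.
move=> CF; elim: r => [|i r IH].
  by rewrite (_ : (fun x => _) = fun=> 1); [exact: Cn_cst|apply/funext => x; rewrite big_nil].
case: (boolP (P i)) => Pi.
  rewrite (_ : (fun x => _) = fun x => F i x * \prod_(j <- r | P j) F j x).
    by apply: Cn_mul => //; exact: CF.
  by apply/funext => x; rewrite big_cons Pi.
rewrite (_ : (fun x => _) = fun x => \prod_(j <- r | P j) F j x) //.
by apply/funext => x; rewrite big_cons (negbTE Pi).
Qed.

Lemma Cn_coord n j : Cn n (fun x => x 0 j).
Proof.
case: n => [|n]; split=> //; try by move=> x; exact: coord_continuous.
exists (fun i _ => (j == i)%:R); split=> [i x|i]; last exact: Cn_cst.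
apply: (@is_derive_quad _ _ _ _ _ _ 0) => h; rewrite !mxE eqxx/= mul0r.
by rewrite addrK subrr normr0.
Qed.

Lemma line_quotE v f x (t : R) :
  (fun h : R => h^-1 *: (((fun k : R => f (k *: v + x)) \o shift t) (h *: (1 : R))
     - f (t *: v + x))) =
  (fun h : R => h^-1 *: ((f \o shift (t *: v + x)) (h *: v) - f (t *: v + x))).
Proof. by apply/funext => h /=; rewrite [_%:A]mulr1 scalerDl addrA. Qed.

Lemma is_derive_lineE v f x (t df : R) :
  is_derive t (1 : R) (fun h : R => f (h *: v + x)) df <->
  is_derive (t *: v + x) v f df.
Proof.
by split=> -[dv dfE]; apply: DeriveDef; move: dv dfE;
  rewrite /derivable /derive line_quotE.
Qed.

Lemma is_derive_line v f x (df : R) :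
  is_derive x v f df <-> is_derive (0 : R) (1 : R) (fun h : R => f (h *: v + x)) df.
Proof. by rewrite is_derive_lineE scale0r add0r. Qed.

Lemma is_derive_line_at v f (Df : Rd -> R) x (t : R) :
  (forall y, is_derive y v f (Df y)) ->
  is_derive t (1 : R) (fun h : R => f (h *: v + x)) (Df (t *: v + x)).
Proof. by move=> H; rewrite is_derive_lineE. Qed.

Lemma MVT_line v f (Df : Rd -> R) x (h : R) :
  (forall y, is_derive y v f (Df y)) ->
  exists2 t : R, `|t| <= `|h| & f (h *: v + x) - f x = h * Df (t *: v + x).
Proof.
move=> H.
have der t : is_derive t (1 : R) (fun h : R => f (h *: v + x)) (Df (t *: v + x)).
  exact: is_derive_line_at.
have cont (a b : R) : {within `[a, b], continuous (fun h : R => f (h *: v + x))}.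
  apply: continuous_subspaceT => t; apply: differentiable_continuous.
  by apply/derivable1_diffP; have [] := der t.
case: (ltgtP 0 h) => h0.
- have [c /[!in_itv]/= /andP[c0 ch]] := MVT h0 (fun t _ => der t) (cont 0 h).
  rewrite scale0r add0r subr0 mulrC => ->; exists c => //.
  by rewrite !ger0_norm// ltW.
- have [c /[!in_itv]/= /andP[c0 ch]] := MVT h0 (fun t _ => der t) (cont h 0).
  rewrite scale0r add0r sub0r mulrC => E; exists c.
    by rewrite !ler0_norm ?lerN2// ltW.
  by rewrite -opprB E mulNr opprK.
- by exists 0; rewrite -h0 ?normr0// scale0r add0r subrr mul0r.
Qed.

Fixpoint smooth1 (n : nat) (g : R -> R) : Prop :=
  continuous g /\
  match n with
  | 0%N => True
  | n'.+1 => exists g' : R -> R, (forall t : R, is_derive t (1 : R) g (g' t)) /\ smooth1 n' g'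
  end.

Lemma Cn_comp n (g : R -> R) f : smooth1 n g -> Cn n f -> Cn n (fun x => g (f x)).
Proof.
elim: n g f => [|n IH] g f.
  by move=> [cg _] [cf _]; split=> //; move=> x; exact: (continuous_comp (cf x) (cg _)).
move=> sg Cf; have Cf' := CnW Cf.
move: sg Cf => [cg [g' [dg' sg']]] [cf [Df [dDf cDf]]]; split.
  by move=> x; exact: (continuous_comp (cf x) (cg _)).
exists (fun i x => g' (f x) * Df i x); split=> [i x|i]; last first.
  exact: (Cn_mul (IH _ _ sg' Cf') (cDf i)).
apply/is_derive_line; have /is_derive_line dl := dDf i x.
have dg0 : is_derive (f (0 *: dir i + x)) (1 : R) g (g' (f x)).
  by rewrite scale0r add0r.
exact: (is_derive1_comp dg0 dl).
Qed.

End CnCalculus.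

(** * Plateau functions *)

Section Plateau.
Variable R : realType.

(** The polynomial factor makes the class stable under differentiation, hence
made of smooth functions. *)
Definition flat (p : {poly R}) (t : R) : R :=
  if 0 < t then p.[t^-1] * expR (- t^-1) else 0.

(** One term of the exponential series. *)
Lemma exprn_le_expR (s : R) k : 0 <= s -> s ^+ k <= k`!%:R * expR s.
Proof.
move=> s0; case: k => [|k].
  by rewrite expr0 fact0 mul1r (le_trans _ (expR_ge1Dx s))// lerDl.
rewrite -ler_pdivrMl ?ltr0n ?fact_gt0//.
have := expR_ge1Dxn k s0; rewrite mulrC; apply: le_trans.
by rewrite lerDr.
Qed.

Lemma poly_le_expR (p : {poly R}) : exists2 C : R, 0 <= C &
  forall s, 0 <= s -> `|p.[s]| * s ^+ 2 <= C * expR s.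
Proof.
exists (\sum_(i < size p) `|p`_i| * (i + 2)`!%:R).
  by apply: sumr_ge0 => i _; rewrite mulr_ge0.
move=> s s0; rewrite horner_coef mulr_suml.
apply: le_trans (_ : (\sum_(i < size p) `|p`_i * s ^+ i|) * s ^+ 2 <= _).
  by rewrite ler_wpM2r ?exprn_ge0// ler_norm_sum.
rewrite mulr_suml; apply: ler_sum => i _.
rewrite normrM (ger0_norm (exprn_ge0 _ s0)) -mulrA -exprD -mulrA.
by rewrite ler_wpM2l// exprn_le_expR.
Qed.

(** The quadratic bound at the origin yields the derivative there. *)
Lemma flat_quad (p : {poly R}) : exists2 C : R, 0 <= C &
  forall t, `|flat p t| <= C * t ^+ 2.
Proof.
have [C C0 HC] := poly_le_expR p; exists C => // t; rewrite /flat.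
case: ifPn => t0; last by rewrite normr0 mulr_ge0 ?sqr_ge0.
have s0 : 0 < t^-1 by rewrite invr_gt0.
have := HC _ (ltW s0); rewrite expRN normrM normfV (ger0_norm (expR_ge0 _)) => H.
rewrite ler_pdivrMr ?expR_gt0//.
rewrite mulrAC -[leLHS]mulr1 -(expr1n _ 2) -(mulVf (lt0r_neq0 t0)) exprMn mulrA.
by rewrite ler_wpM2r ?sqr_ge0.
Qed.

Lemma flat_derive (p : {poly R}) (t : R) :
  is_derive t (1 : R) (flat p) (flat ('X^2 * (p - p^`())) t).
Proof.
case: (ltgtP 0 t) => t0; last first.
- rewrite -t0 {2}/flat ltxx.
  have [C C0 HC] := flat_quad p.
  apply: (@is_derive_quad _ _ _ _ _ _ C) => h.
  by rewrite [h *: _]mulr1 addr0 {2}/flat ltxx subr0 mulr0 subr0.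
- have -> : flat ('X^2 * (p - p^`())) t = 0 by rewrite /flat ltNge (ltW t0).
  apply: (@near_eq_is_derive _ _ _ (cst 0)); rewrite ?oner_eq0//.
  by near=> y; rewrite /flat/= ifN// -leNgt ltW//; near: y; exact: lt_nbhsl.
- have tN : t != 0 by rewrite gt_eqF.
  apply: (@near_eq_is_derive _ _ _ (fun y : R => p.[y^-1] * expR (- y^-1))).
    by near=> y; rewrite /flat/= ifT//; near: y; exact: lt_nbhsr.
  have dinv : is_derive t (1 : R) (fun y : R => y^-1) (- t ^- 2).
    apply: DeriveDef.
      by apply: (@derivableV _ _ (fun y : R => y)) => //; exact: derivable_id.
    by rewrite (@deriveV _ _ (fun y : R => y)) ?derive_id ?scaler1//; exact: derivable_id.
  have dp : is_derive (t^-1) (1 : R) (horner p) (p^`().[t^-1]).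
    by rewrite derivE derive1E; apply: derivableP; exact: derivable_horner.
  have d1 := is_derive1_comp dp dinv.
  have d2 : is_derive t (1 : R) (fun y => expR (- y^-1)) (expR (- t^-1) * (t ^- 2)).
    have dn : is_derive t (1 : R) (fun y : R => - y^-1) (t ^- 2).
      by have := is_deriveN dinv; rewrite opprK.
    exact: (is_derive1_comp (is_derive_expR _) dn).
  apply: (is_derive_eq (is_deriveM d1 d2)).
  rewrite /flat t0 !hornerE /GRing.scale/=; set E := expR _.
  by rewrite -exprVn; ring.
Unshelve. all: by end_near. Qed.

Lemma flat_smooth n (p : {poly R}) : smooth1 n (flat p).
Proof.
have cf q : continuous (flat q).
  move=> t; apply: differentiable_continuous; apply/derivable1_diffP.
  by have [] := flat_derive q t.
elim: n p => [|n IH] p; split=> //.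
by exists (flat ('X^2 * (p - p^`()))); split=> // t; exact: flat_derive.
Qed.

(** A step from 1 (for t <= 0) down to 0 (for t >= 1): composing the flat
function with c - flat, c = flat(1), makes both ends constant. *)
Definition step (t : R) : R :=
  flat 1 (flat 1 1 - flat 1 t) / flat 1 (flat 1 1).

Lemma flat1E (t : R) : 0 < t -> flat 1 t = expR (- t^-1).
Proof. by move=> t0; rewrite /flat t0 hornerE mul1r. Qed.

Lemma flat1_gt0 : 0 < flat 1 1.
Proof. by rewrite flat1E ?ltr01// expR_gt0. Qed.

Lemma step1 (t : R) : t <= 0 -> step t = 1.
Proof.
move=> t0; have z : flat 1 t = 0 by rewrite /flat ltNge t0.
rewrite /step z subr0 divff//.
by rewrite flat1E ?expR_eq0 ?flat1_gt0.
Qed.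

Lemma step0 (t : R) : 1 <= t -> step t = 0.
Proof.
move=> t1; have t0 := lt_le_trans ltr01 t1.
rewrite /step [flat 1 (_ - _)]/flat ifF ?mul0r//; apply/negbTE; rewrite -leNgt subr_le0.
by rewrite !flat1E// ler_expR lerN2 invr1 invf_le1.
Qed.

Lemma step_smooth d n (f : 'rV[R]_d -> R) : Cn n f -> Cn n (fun x => step (f x)).
Proof.
move=> Cf; rewrite /step (_ : (fun x => _) = fun x =>
  (flat 1 (flat 1 1))^-1 * flat 1 (flat 1 1 - flat 1 (f x))); last first.
  by apply/funext => x; rewrite mulrC.
apply: Cn_scale; apply: Cn_comp; first exact: flat_smooth.
apply: Cn_sub; first exact: Cn_cst.
by apply: Cn_comp => //; exact: flat_smooth.
Qed.

(** The product over the coordinates of a step in ((y_i - x_i)/r)^2 - 1, which is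
at most 0 in the box of half-side r and at least 1 as soon as some coordinate
leaves the box of half-side 2r. *)
Lemma plateau d (x0 : 'rV[R]_d) (r : R) : 0 < r -> exists rho : 'rV[R]_d -> R,
  [/\ forall n, Cn n rho,
      forall y : 'rV[R]_d, (forall i, `|y 0 i - x0 0 i| <= r) -> rho y = 1 &
      forall y : 'rV[R]_d, rho y != 0 -> forall i, `|y 0 i - x0 0 i| <= 2 * r].
Proof.
move=> r0.
exists (fun y : 'rV[R]_d => \prod_(i < d) step (((y 0 i - x0 0 i) / r) ^+ 2 - 1)); split.
- move=> n; apply: Cn_prod => i _; apply: step_smooth.
  apply: Cn_sub; last exact: Cn_cst.
  have C1 : Cn n (fun y : 'rV[R]_d => (y 0 i - x0 0 i) / r).
    apply: Cn_mul; last exact: Cn_cst.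
    by apply: Cn_sub; [exact: Cn_coord|exact: Cn_cst].
  rewrite (_ : (fun x => _) = fun y : 'rV[R]_d =>
     ((y 0 i - x0 0 i) / r) * ((y 0 i - x0 0 i) / r)); first exact: Cn_mul.
  by apply/funext => y; rewrite expr2.
- move=> y H; apply: big1 => i _; apply: step1.
  rewrite subr_le0 -real_normK ?num_real// expr_le1// normrM normfV.
  by rewrite (gtr0_norm r0) ler_pdivrMr// mul1r.
- move=> y /prodf_neq0 H i; rewrite leNgt; apply/negP => lt.
  have := H i isT; rewrite step0 ?eqxx//.
  rewrite lerBrDr -real_normK ?num_real// normrM normfV (gtr0_norm r0).
  have : 2 <= `|y 0 i - x0 0 i| / r by rewrite ler_pdivlMr// ltW.
  set z := _ / r => z2; have : 2 * 2 <= z * z by rewrite ler_pM.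
  by rewrite expr2; lra.
Qed.

End Plateau.

(** * Test functions and cutoffs *)

Section TestFunctions.
Variables (R : realType) (d : nat).
Local Notation Rd := 'rV[R]_d.
Local Notation cball x r := [set y : Rd | forall i, `|y 0 i - x 0 i| <= r].
Implicit Types (f g : Rd -> R) (phi psi chi : Rd -> R[i]) (U V K : set Rd).

Definition smoothR f := forall n, Cn n f.

Lemma smoothTP phi : smooth setT phi <->
  smoothR (fun x => complex.Re (phi x)) /\ smoothR (fun x => complex.Im (phi x)).
Proof. by rewrite /smooth !real_smoothTP. Qed.

Lemma smooth_real f : smoothR f -> smooth setT (fun x => (f x)%:C).
Proof. by move=> sf; apply/smoothTP; split => n /=; [exact: sf|exact: Cn_cst]. Qed.

Lemma ReM (z w : R[i]) : complex.Re (z * w) =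
  complex.Re z * complex.Re w - complex.Im z * complex.Im w.
Proof. by case: z w => [a b] [c e]. Qed.

Lemma ImM (z w : R[i]) : complex.Im (z * w) =
  complex.Re z * complex.Im w + complex.Im z * complex.Re w.
Proof. by case: z w => [a b] [c e]. Qed.

Lemma ReD (z w : R[i]) : complex.Re (z + w) = complex.Re z + complex.Re w.
Proof. by case: z w => [a b] [c e]. Qed.

Lemma ImD (z w : R[i]) : complex.Im (z + w) = complex.Im z + complex.Im w.
Proof. by case: z w => [a b] [c e]. Qed.

Lemma smoothT_mul phi psi : smooth setT phi -> smooth setT psi ->
  smooth setT (fun x => phi x * psi x).
Proof.
move=> /smoothTP[r1 i1] /smoothTP[r2 i2]; apply/smoothTP; split=> n.
  rewrite (_ : (fun x => _) = (fun x => complex.Re (phi x) * complex.Re (psi x)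
     - complex.Im (phi x) * complex.Im (psi x))).
    by apply: Cn_sub; apply: Cn_mul.
  by apply/funext => x; rewrite ReM.
rewrite (_ : (fun x => _) = (fun x => complex.Re (phi x) * complex.Im (psi x)
   + complex.Im (phi x) * complex.Re (psi x))).
  by apply: Cn_add; apply: Cn_mul.
by apply/funext => x; rewrite ImM.
Qed.

Lemma smoothT_add phi psi : smooth setT phi -> smooth setT psi ->
  smooth setT (fun x => phi x + psi x).
Proof.
move=> /smoothTP[r1 i1] /smoothTP[r2 i2]; apply/smoothTP; split=> n.
  rewrite (_ : (fun x => _) = (fun x => complex.Re (phi x) + complex.Re (psi x))).
    exact: Cn_add.
  by apply/funext => x; rewrite ReD.
rewrite (_ : (fun x => _) = (fun x => complex.Im (phi x) + complex.Im (psi x))).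
  exact: Cn_add.
by apply/funext => x; rewrite ImD.
Qed.

Lemma smoothT_cst (c : R[i]) : smooth setT (fun _ : Rd => c).
Proof. by apply/smoothTP; split=> n; exact: Cn_cst. Qed.

Lemma subset_fsupp phi x : phi x != 0 -> fsupp phi x.
Proof. by move=> h; apply: subset_closure. Qed.

Lemma fsuppP phi x : ~ fsupp phi x -> phi x = 0.
Proof. by move=> h; apply/eqP/negP => /negP/subset_fsupp. Qed.

Lemma fsupp_sub phi K : closed K -> (forall x, phi x != 0 -> K x) -> fsupp phi `<=` K.
Proof.
by move=> cK h; rewrite ((closure_id K).1 cK); apply: closure_subset => x /=; exact: h.
Qed.

Lemma closed_fsupp phi : closed (fsupp phi).
Proof. exact: closed_closure. Qed.

Lemma fsupp_mull phi psi : fsupp (fun x => phi x * psi x) `<=` fsupp phi.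
Proof. by apply: closure_subset => x /=; rewrite mulf_eq0 negb_or => /andP[]. Qed.

Lemma fsupp_mulr phi psi : fsupp (fun x => phi x * psi x) `<=` fsupp psi.
Proof. by apply: closure_subset => x /=; rewrite mulf_eq0 negb_or => /andP[]. Qed.

Lemma test_fun_mull V phi psi : smooth setT phi -> test_fun V psi ->
  test_fun V (fun x => phi x * psi x).
Proof.
move=> sphi [spsi cpsi subV]; split; first exact: smoothT_mul.
  exact: (subclosed_compact (@closed_fsupp _) cpsi (@fsupp_mulr phi psi)).
exact: (subset_trans (@fsupp_mulr phi psi)).
Qed.

Lemma test_fun_mulr V phi psi : test_fun V phi -> smooth setT psi ->
  test_fun V (fun x => phi x * psi x).
Proof.
move=> tphi spsi; rewrite (_ : (fun x => _) = fun x => psi x * phi x).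
  exact: test_fun_mull.
by apply/funext => x; rewrite mulrC.
Qed.

Lemma test_fun_scale V c phi : test_fun V phi -> test_fun V (fun x => c * phi x).
Proof. by move=> tp; apply: test_fun_mull => //; exact: smoothT_cst. Qed.

Lemma test_fun_add V phi psi : test_fun V phi -> test_fun V psi ->
  test_fun V (fun x => phi x + psi x).
Proof.
move=> [s1 c1 v1] [s2 c2 v2].
have sub : fsupp (fun x => phi x + psi x) `<=` fsupp phi `|` fsupp psi.
  apply: fsupp_sub => [|x]; first by apply: closedU; exact: closed_fsupp.
  have [->|p0 _] := eqVneq (phi x) 0; last by left; exact: subset_fsupp.
  by rewrite add0r => p0; right; exact: subset_fsupp.
split; first exact: smoothT_add.
  exact: (subclosed_compact (@closed_fsupp _) (compactU c1 c2) sub).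
by move=> x /sub[/v1|/v2].
Qed.

Lemma test_fun0 V : test_fun V (fun _ : Rd => 0).
Proof.
have E : fsupp (fun _ : Rd => 0 : R[i]) = set0.
  by apply/seteqP; split=> // x; apply: fsupp_sub => //; [exact: closed0|move=> y; rewrite eqxx].
by split; [exact: smoothT_cst|rewrite E; exact: compact0|rewrite E].
Qed.

Lemma test_funW V W phi : V `<=` W -> test_fun V phi -> test_fun W phi.
Proof. by move=> VW [s c v]; split=> //; exact: (subset_trans v). Qed.

Lemma compact_cball (x : Rd) (r : R) : compact (cball x r).
Proof.
have -> : cball x r = [set v : Rd | forall i, `[x 0 i - r, x 0 i + r]%classic (v ord0 i)].
  apply/seteqP; split=> y /= H i; have := H i; rewrite /= in_itv/= ler_distl.
    by move=> /andP[-> ->].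
  by move=> /andP[-> ->].
by apply: (@rV_compact R d (fun i => `[x 0 i - r, x 0 i + r]%classic)) => i; exact: segment_compact.
Qed.

Lemma closed_cball (x : Rd) (r : R) : closed (cball x r).
Proof. by apply: compact_closed; [exact: norm_hausdorff|exact: compact_cball]. Qed.

Lemma open_cball U (x : Rd) : open U -> U x -> exists2 r : R, 0 < r & cball x r `<=` U.
Proof.
move=> oU Ux; have : nbhs x U by apply: open_nbhs_nbhs.
move=> /nbhs_ballP[r /= r0 H]; exists (r / 2); first by rewrite divr_gt0.
move=> y /= hy; apply: H; split=> // i j; rewrite ord1 /ball/= distrC.
apply: (le_lt_trans (hy j)); rewrite ltr_pdivrMr//; lra.
Qed.

Lemma nbhs_cball (x : Rd) (r : R) : 0 < r -> nbhs x (cball x r).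
Proof.
move=> r0; apply/nbhs_ballP; exists r => //= y [_ H] i /=.
by have /ltW := H 0 i; rewrite distrC.
Qed.

Lemma plateau_test V (x : Rd) (r : R) : 0 < r -> cball x (2 * r) `<=` V ->
  exists rho : Rd -> R, [/\ smoothR rho, test_fun V (fun y => (rho y)%:C),
    fsupp (fun y => (rho y)%:C) `<=` cball x (2 * r) &
    forall y, cball x r y -> rho y = 1].
Proof.
move=> r0 sV; have [rho [s1 s2 s3]] := plateau x r0.
have sub : fsupp (fun y => (rho y)%:C) `<=` cball x (2 * r).
  apply: fsupp_sub; first exact: closed_cball.
  move=> y h; apply: s3; apply: contraNN h => /eqP ->; exact: eqxx.
exists rho; split=> //; split; first exact: smooth_real.
- exact: (subclosed_compact (@closed_fsupp _) (@compact_cball x (2 * r)) sub).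
- exact: (subset_trans sub).
Qed.

(** The centres come as a list because the supports are exhausted by induction,
one plateau function at a time. *)
Lemma compact_cballs K (r : Rd -> R) : compact K -> (forall x, K x -> 0 < r x) ->
  exists s : seq Rd, (forall x, x \in s -> K x) /\
    forall y, K y -> exists2 x, x \in s & (cball x (r x))° y.
Proof.
rewrite compact_cover => cK r0.
have [||D DK Dc] := cK Rd K (fun x => (cball x (r x))°).
- by move=> x Kx; exact: open_interior.
- by move=> x Kx; exists x => //; exact/nbhs_cball/r0.
exists (finmap.enum_fset D); split=> [x /DK|y /Dc[x /= xD xy]]; first by rewrite inE.
by exists x.
Qed.

(** Adding a plateau function rho to chi as chi + rho (1 - chi) keeps the value 1
where chi has it and creates it where rho has it. *)
Lemma smooth_cutoff U K : open U -> compact K -> K `<=` U -> exists chi : Rd -> R[i],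
  test_fun U chi /\ exists V, [/\ open V, K `<=` V & forall x, V x -> chi x = 1].
Proof.
move=> oU cK KU.
have /choice[r Hr] : forall x, exists r : R, K x -> 0 < r /\ cball x (2 * r) `<=` U.
  move=> x; have [Kx|nKx] := pselect (K x); last by exists 0 => /nKx.
  have [r r0 H] := open_cball oU (KU _ Kx); exists (r / 2) => _.
  by rewrite divr_gt0// mulrC divfK.
have [s [sK Hs]] := compact_cballs cK (fun x Kx => (Hr x Kx).1).
suff [chi [tchi chi1]] : exists chi : Rd -> R[i], test_fun U chi /\
    forall x y, x \in s -> cball x (r x) y -> chi y = 1.
  exists chi; split=> //; exists (\bigcup_(x in [set` s]) (cball x (r x))°); split.
  - by apply: bigcup_open => x _; exact: open_interior.
  - by move=> y /Hs[x xs xy]; exists x.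
  - by move=> y [x /= xs xy]; apply: (chi1 x) => //; exact: interior_subset.
elim: s sK {Hs} => [_|x s IH sK].
  by exists (fun=> 0); split=> //; exact: test_fun0.
have [|chi [tchi chi1]] := IH; first by move=> y ys; apply: sK; rewrite inE ys orbT.
have [r0 rU] := Hr _ (sK x (mem_head _ _)).
have [rho [_ trho _ rho1]] := plateau_test r0 rU.
exists (fun y => chi y + (rho y)%:C * (1 - chi y)); split.
  rewrite (_ : (fun y => _) = fun y => chi y + ((rho y)%:C + (rho y)%:C * (-1 * chi y))).
    apply: test_fun_add => //; apply: test_fun_add => //.
    by apply: test_fun_mulr => //; have [] := test_fun_scale (-1) tchi.
  by apply/funext => y; rewrite mulrBr mulr1 mulN1r mulrN.
move=> z y; rewrite inE => /orP[/eqP ->{z}|zs] zy.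
  by rewrite rho1// mul1r addrC subrK.
by rewrite (chi1 z)// subrr mulr0 addr0.
Qed.

End TestFunctions.

(** * Distributions and their supports *)

Section Distributions.
Variables (R : realType) (d : nat).
Local Notation Rd := 'rV[R]_d.
Local Notation dir := (@dir R d).
Local Notation cball x r := [set y : Rd | forall i, `|y 0 i - x 0 i| <= r].
Implicit Types (f g : Rd -> R) (phi psi chi : Rd -> R[i]) (U V K : set Rd).

Section Fixed.
Variables (U : set Rd) (T : (Rd -> R[i]) -> R[i]).
Hypothesis TD : schwartz_distribution U T.

Lemma dist_lin a phi psi : test_fun U phi -> test_fun U psi ->
  T (fun x => a * phi x + psi x) = a * T phi + T psi.
Proof. exact: TD.1. Qed.

Lemma dist0 : T (fun=> 0) = 0.
Proof.
have := dist_lin (-1) (@test_fun0 R d U) (@test_fun0 R d U).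
rewrite (_ : (fun x => _) = fun=> 0); first by rewrite mulN1r addNr.
by apply/funext => x; rewrite mulr0 addr0.
Qed.

Lemma distD phi psi : test_fun U phi -> test_fun U psi ->
  T (fun x => phi x + psi x) = T phi + T psi.
Proof.
move=> tp ts; rewrite -[T phi]mul1r -dist_lin//; congr T.
by apply/funext => x; rewrite mul1r.
Qed.

Lemma dist_sum (I : Type) (r : seq I) (a : I -> R[i]) (F : I -> Rd -> R[i]) :
  (forall i, test_fun U (F i)) ->
  test_fun U (fun x => \sum_(i <- r) a i * F i x) /\
  T (fun x => \sum_(i <- r) a i * F i x) = \sum_(i <- r) a i * T (F i).
Proof.
move=> tF; elim: r => [|i r [IHt IHT]].
  rewrite big_nil (_ : (fun x => _) = fun=> 0).
    by split; [exact: test_fun0|exact: dist0].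
  by apply/funext => x; rewrite big_nil.
rewrite big_cons (_ : (fun x => _) = fun x => a i * F i x + \sum_(j <- r) a j * F j x).
  split; first by apply: test_fun_add => //; exact: test_fun_scale.
  by rewrite dist_lin// IHT.
by apply/funext => x; rewrite big_cons.
Qed.

(** Plateau functions cut phi into finitely many pieces, each supported in an open
set where T vanishes. *)
Lemma dist_off_supp phi : test_fun U phi ->
  (forall x, fsupp phi x -> ~ dsupp U T x) -> T phi = 0.
Proof.
move=> tphi off; have [_ cphi phiU] := tphi.
have /choice[r Hr] : forall x, exists r : R, fsupp phi x -> 0 < r /\
    exists V, [/\ V `<=` U, cball x (2 * r) `<=` V &
              forall psi, test_fun V psi -> T psi = 0].
  move=> x; have [sx|nsx] := pselect (fsupp phi x); last by exists 0 => /nsx.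
  have [V [oV Vx VU TV]] : exists V, [/\ open V, V x, V `<=` U &
      forall psi, test_fun V psi -> T psi = 0].
    have := off x sx; rewrite /dsupp/= => /not_andP[|]; first by have := phiU _ sx.
    move=> /existsNP[V] /not_implyP[oV] /not_implyP[Vx] /not_implyP[VU] nT.
    exists V; split=> // psi tpsi; apply/eqP/negP => /negP Tpsi.
    by apply: nT; exists psi.
  have [r r0 H] := open_cball oV Vx; exists (r / 2) => _.
  rewrite divr_gt0//; split=> //; exists V; split=> //.
  by rewrite mulrC divfK.
have [s [sK Hs]] := compact_cballs cphi (fun x Kx => (Hr x Kx).1).
have {}sK : forall x, x \in s -> 0 < r x /\
    exists V, [/\ V `<=` U, cball x (2 * r x) `<=` V &
              forall psi, test_fun V psi -> T psi = 0].
  by move=> x /sK; exact: Hr.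
have {}Hs : forall y, fsupp phi y -> exists2 x, x \in s & (cball x (r x))° y by [].
move: {off cphi phiU Hr} phi tphi Hs; elim: s sK => [_|x s IH sK] phi tphi Hs.
  rewrite (_ : phi = fun=> 0) ?dist0//; apply/funext => y; apply: fsuppP.
  by move=> /Hs[].
have [r0 [V [VU sV TV]]] := sK x (mem_head _ _).
have [rho [srho trho fs rho1]] := plateau_test r0 sV.
have sphi : smooth setT phi by case: tphi.
have s1 : smooth setT (fun y => 1 - (rho y)%:C).
  rewrite (_ : (fun y => _) = fun y => 1 + -1 * (rho y)%:C).
    apply: smoothT_add; first exact: smoothT_cst.
    by apply: smoothT_mul; [exact: smoothT_cst|exact: smooth_real].
  by apply/funext => y; rewrite mulN1r.
rewrite (_ : phi = fun y => (rho y)%:C * phi y + (1 - (rho y)%:C) * phi y); last first.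
  by apply/funext => y; rewrite -mulrDl addrCA subrr addr0 mul1r.
rewrite distD; first last.
- exact: test_fun_mull.
- exact: (test_fun_mull (smooth_real srho) tphi).
rewrite TV ?add0r; last exact: test_fun_mulr.
apply: IH.
- by move=> y ys; apply: sK; rewrite inE ys orbT.
- exact: test_fun_mull.
move=> y yf; have [z] := Hs y (@fsupp_mulr _ _ _ _ _ yf).
rewrite inE => /orP[/eqP ->{z} yi|zs zy]; last by exists z.
exfalso; have : (~` (cball x (r x))°) y; last by [].
apply: fsupp_sub yf; first by apply: open_closedC; exact: open_interior.
move=> w + /interior_subset /rho1 w1; rewrite w1 subrr mul0r eqxx; by [].
Qed.

Lemma cutoff_exists : compact (dsupp U T) -> open U -> exists chi, is_cutoff U T chi.
Proof.
move=> cT oU; have sub : dsupp U T `<=` U by move=> x [].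
by have [chi [tchi H]] := smooth_cutoff oU cT sub; exists chi.
Qed.

(** 1 - chi vanishes near the support of T. *)
Lemma dist_cutoff chi phi : is_cutoff U T chi -> test_fun U phi ->
  T (fun x => chi x * phi x) = T phi.
Proof.
move=> [tchi [V [oV sV chi1]]] tphi.
have schi : smooth setT chi by case: tchi.
have s1 : smooth setT (fun y => 1 - chi y).
  rewrite (_ : (fun y => _) = fun y => 1 + -1 * chi y).
    apply: smoothT_add; first exact: smoothT_cst.
    by apply: smoothT_mul; first exact: smoothT_cst.
  by apply/funext => y; rewrite mulN1r.
rewrite [in RHS](_ : phi = fun y => chi y * phi y + (1 - chi y) * phi y); last first.
  by apply/funext => y; rewrite -mulrDl addrCA subrr addr0 mul1r.
rewrite distD; [|exact: test_fun_mull..].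
rewrite [X in _ = _ + X]dist_off_supp ?addr0//; first exact: test_fun_mull.
move=> x xf /sV Vx; have : (~` V) x; last exact.
apply: fsupp_sub (fsupp_mull xf); first exact: open_closedC.
by move=> w + /chi1 w1; rewrite w1 subrr eqxx.
Qed.

End Fixed.

(** The choice made in the definition of the pairing is one cutoff, used for all
functions phi at once. *)
Lemma pairing_cutoff U T : open U -> compact_distribution U T ->
  exists chi, is_cutoff U T chi /\
    forall phi, pairing U T phi = T (fun x => chi x * phi x).
Proof.
move=> oU [TD cT]; have ex := cutoff_exists cT oU.
exists (xget (fun=> 0) [set chi | is_cutoff U T chi]); split=> //.
by case: ex => chi hchi; exact: (xgetPex (fun=> 0) (ex_intro _ chi hchi)).
Qed.

(** * Leibniz estimates and the order of a distribution *)

Lemma smoothR_derive f i : smoothR f -> smoothR ('D_(dir i) f).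
Proof.
move=> sf n; have [_ [Df [dDf cDf]]] := sf n.+1.
by rewrite (derive_fun (dDf i)); exact: cDf.
Qed.

Lemma smoothR_is_derive f i x : smoothR f -> is_derive x (dir i) f ('D_(dir i) f x).
Proof. by move=> sf; apply: derivableP; have [_ [Df [/(_ i x)[+ _] _]]] := sf 1%N. Qed.

Lemma partials_add s f g : smoothR f -> smoothR g ->
  partials s (fun x => f x + g x) = fun x => partials s f x + partials s g x.
Proof.
elim/last_ind: s f g => [//|s i IH] f g sf sg.
rewrite !partials_rcons -IH; [|exact: smoothR_derive..]; congr partials.
by apply: derive_fun => x; apply: is_deriveD; exact: smoothR_is_derive.
Qed.

Lemma smoothR_mul f g : smoothR f -> smoothR g -> smoothR (fun x => f x * g x).
Proof. by move=> sf sg n; apply: Cn_mul. Qed.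

Lemma partials_rcons_mul s i f g : smoothR f -> smoothR g ->
  partials (rcons s i) (fun x => f x * g x) = fun x =>
    partials s (fun x => f x * 'D_(dir i) g x) x +
    partials s (fun x => g x * 'D_(dir i) f x) x.
Proof.
move=> sf sg; rewrite partials_rcons -partials_add.
- congr partials; apply: derive_fun => x.
  by apply: is_deriveM; exact: smoothR_is_derive.
- by apply: smoothR_mul => //; exact: smoothR_derive.
- by apply: smoothR_mul => //; exact: smoothR_derive.
Qed.

Lemma compact_bound f K : compact K -> continuous f ->
  exists2 C : R, 0 <= C & forall x, K x -> `|f x| <= C.
Proof.
move=> cK cf.
have : compact (f @` K) by apply: continuous_compact => //; exact: continuous_subspaceT.
move=> /compact_bounded[M [Mr HM]]; exists (`|M| + 1); first by rewrite addr_ge0.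
by move=> x Kx; apply: HM; [rewrite (le_lt_trans (ler_norm _))// ltrDl|exists x].
Qed.

(** The constant depends on f and the order only, so that multiplication by a
cutoff is continuous for the seminorms. *)
Lemma leibniz_bound m K f : compact K -> smoothR f -> exists2 C : R, 0 <= C &
  forall g (eta : R), smoothR g -> 0 <= eta ->
    (forall s x, (size s <= m)%N -> K x -> `|partials s g x| <= eta) ->
    forall s x, (size s <= m)%N -> K x ->
      `|partials s (fun y => f y * g y) x| <= C * eta.
Proof.
move=> cK; elim: m f => [|m IH] f sf.
  have [C C0 HC] := compact_bound cK (Cn_continuous (sf 0%N)).
  exists C => // g eta sg eta0 Hg [|//] x _ Kx /=; rewrite normrM ler_pM ?HC//.
  exact: (Hg [::]).
have [C0 C00 HC0] := IH f sf.
have /choice[C1 HC1] : forall i, exists C : R, 0 <= C /\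
   forall g (eta : R), smoothR g -> 0 <= eta ->
    (forall s x, (size s <= m)%N -> K x -> `|partials s g x| <= eta) ->
    forall s x, (size s <= m)%N -> K x ->
      `|partials s (fun y => 'D_(dir i) f y * g y) x| <= C * eta.
  by move=> i; have [C C0' HC] := IH _ (smoothR_derive i sf); exists C.
have S0 : 0 <= \sum_i C1 i by apply: sumr_ge0 => i _; exact: (HC1 i).1.
exists (C0 + \sum_i C1 i); first by rewrite addr_ge0.
move=> g eta sg eta0 Hg s x; case/lastP: s => [_ Kx|s i].
  apply: le_trans (HC0 g eta sg eta0 _ [::] x isT Kx) _.
    by move=> s y sm; apply: Hg; exact: leqW.
  by rewrite ler_wpM2r// lerDl.
rewrite size_rcons ltnS => sm Kx; rewrite partials_rcons_mul//.
apply: (le_trans (ler_normD _ _)); rewrite mulrDl lerD//.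
  apply: HC0 => //; first exact: smoothR_derive.
  by move=> t y tm Ky; rewrite -partials_rcons; apply: Hg => //; rewrite size_rcons.
rewrite (_ : (fun y => _) = fun y => 'D_(dir i) f y * g y); last first.
  by apply/funext => y; rewrite mulrC.
apply: le_trans ((HC1 i).2 g eta sg eta0 _ s x sm Kx) _.
  by move=> t y tm; apply: Hg; exact: leqW.
by rewrite ler_wpM2r// (bigD1 i)//= lerDl sumr_ge0// => j _; exact: (HC1 j).1.
Qed.

Lemma normc_le (z : R[i]) : Normc.normc z <= `|complex.Re z| + `|complex.Im z|.
Proof.
case: z => a b /=; rewrite -(@ler_pXn2r _ 2)// ?nnegrE ?sqrtr_ge0 ?addr_ge0//.
rewrite sqr_sqrtr ?addr_ge0 ?sqr_ge0// sqrrD !real_normK ?num_real//.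
by rewrite addrAC lerDl mulrn_wge0// mulr_ge0.
Qed.

Lemma size_mdirs (alpha : mindex d) : size (mdirs alpha) = mlen alpha.
Proof.
rewrite /mdirs /mlen size_flatten /shape -map_comp sumnE big_map big_enum/=.
by apply: eq_bigr => i _ /=; rewrite size_nseq.
Qed.

Lemma seminorm_le K m phi (M : R) : 0 <= M ->
  (forall s x, (size s <= m)%N -> K x ->
    `|partials s (fun y => complex.Re (phi y)) x| +
    `|partials s (fun y => complex.Im (phi y)) x| <= M) ->
  seminorm K m phi <= M.
Proof.
move=> M0 H; rewrite /seminorm; set S := [set _ | _].
have [S0|/set0P S0] := eqVneq S set0; first by rewrite S0 sup0.
apply: ge_sup => // r [alpha [x [am Kx ->]]].
apply: (le_trans (normc_le _)); apply: H => //; by rewrite size_mdirs.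
Qed.

Lemma seminorm_ge0 K m phi : 0 <= seminorm K m phi.
Proof.
rewrite /seminorm; set S := [set _ | _].
have [hS|nS] := pselect (has_sup S); last by rewrite sup_out.
have [[r Sr] ub] := hS; apply: le_trans (ub_le_sup ub Sr).
by case: Sr => alpha [x [_ _ ->]]; rewrite /Normc.normc; case: mderive => a b; exact: sqrtr_ge0.
Qed.

(** The finite order of T on the support of chi, in the form that suits a
sequence of smooth functions g without compact support. *)
Lemma dist_continuity U T chi : schwartz_distribution U T -> test_fun U chi ->
  exists m, exists2 C : R, 0 <= C & forall g (eta : R), smoothR g -> 0 <= eta ->
    (forall s x, (size s <= m)%N -> fsupp chi x -> `|partials s g x| <= eta) ->
    Normc.normc (T (fun x => chi x * (g x)%:C)) <= C * eta.
Proof.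
move=> [_ Tc] tchi; have [schi cchi chiU] := tchi.
have [C0 [m HC0]] := Tc _ cchi chiU.
move/smoothTP: (schi) => [sr si].
have [C1 C10 HC1] := leibniz_bound m cchi sr.
have [C2 C20 HC2] := leibniz_bound m cchi si.
exists m; exists (`|C0| * (C1 + C2)); first by rewrite mulr_ge0// addr_ge0.
move=> g eta sg eta0 Hg.
have tg : test_fun U (fun x => chi x * (g x)%:C).
  exact: (test_fun_mulr tchi (smooth_real sg)).
have fs : fsupp (fun x => chi x * (g x)%:C) `<=` fsupp chi by exact: fsupp_mull.
apply: (le_trans (HC0 _ tg fs)); set S := seminorm _ _ _.
apply: le_trans (_ : `|C0| * S <= _).
  by rewrite ler_wpM2r ?seminorm_ge0// ler_norm.
rewrite -mulrA ler_wpM2l//; apply: seminorm_le => [|s x sm Kx].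
  by rewrite mulr_ge0// addr_ge0.
rewrite mulrDl lerD//.
  rewrite (_ : (fun y => _) = fun y => complex.Re (chi y) * g y); first exact: HC1.
  by apply/funext => y; rewrite ReM/= mulr0 subr0.
rewrite (_ : (fun y => _) = fun y => complex.Im (chi y) * g y); first exact: HC2.
by apply/funext => y; rewrite ImM/= mulr0 add0r.
Qed.

End Distributions.

(** * Iterated integrals over boxes *)

Section Int1.
Variables (R : realType) (a : R).
Hypothesis a0 : 0 < a.
Implicit Types g h : R -> R.
Local Notation mu := (@lebesgue_measure R).

Definition int1 g : R := \int[mu]_(t in `[- a, a]) g t.

Lemma int1_integrable g : continuous g -> mu.-integrable `[- a, a] (EFin \o g).
Proof.
move=> cg; apply: continuous_compact_integrable; first exact: segment_compact.
exact: continuous_subspaceT.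
Qed.

Lemma int1D g h : continuous g -> continuous h ->
  int1 (fun t => g t + h t) = int1 g + int1 h.
Proof. by move=> cg ch; apply: RintegralD => //; exact: int1_integrable. Qed.

Lemma int1Z c g : continuous g -> int1 (fun t => c * g t) = c * int1 g.
Proof. by move=> cg; apply: RintegralZl => //; exact: int1_integrable. Qed.

Lemma int1_le g h : continuous g -> continuous h ->
  (forall t, `|t| <= a -> g t <= h t) -> int1 g <= int1 h.
Proof.
move=> cg ch H; apply: le_Rintegral => //; try exact: int1_integrable.
by move=> t /=; rewrite in_itv/= -ler_norml; exact: H.
Qed.

Lemma int1_cst c : int1 (fun=> c) = 2 * a * c.
Proof.
rewrite /int1 Rintegral_cst//= lebesgue_measure_itv/= lte_fin.
have aa : - a < a by move: a0; lra.
rewrite aa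
  /= opprK; ring.
Qed.

Lemma int1_norm g c : continuous g -> (forall t, `|t| <= a -> `|g t| <= c) ->
  `|int1 g| <= 2 * a * c.
Proof.
move=> cg H; rewrite ler_norml -int1_cst.
have cc (e : R) : continuous (fun _ : R => e) by exact: cst_continuous.
apply/andP; split; last first.
  by apply: int1_le => // t /H; exact: le_trans (ler_norm _).
rewrite -mulN1r -int1Z//; apply: int1_le => // t /H.
by rewrite mulN1r ler_norml => /andP[].
Qed.

Lemma int1_ftc (G g : R -> R) : (forall t, is_derive t (1 : R) G (g t)) ->
  continuous g -> int1 g = G a - G (- a).
Proof.
move=> dG cg; have aa : - a < a by move: a0; lra.
have cG : continuous G.
  move=> t; apply: differentiable_continuous; apply/derivable1_diffP.
  by have [] := dG t.
rewrite /int1 /Rintegral (@continuous_FTC2 _ g G)//.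
- exact: continuous_subspaceT.
- split.
  + by move=> t _; have [] := dG t.
  + exact: cvg_at_right_filter (cG _).
  + exact: cvg_at_left_filter (cG _).
- by move=> t _; rewrite derive1E derive_val.
Qed.

End Int1.

Section BoxIntegral.
Variable R : realType.

Definition dist1 d (x y : 'rV[R]_d) : R := \sum_i `|x 0 i - y 0 i|.

(** Bounded and Lipschitz: the iterated integral of such a function over a box
has sections which are again bounded and Lipschitz. *)
Definition bl d (f : 'rV[R]_d -> R) : Prop := exists C : R, [/\ 0 <= C,
  forall x, `|f x| <= C & forall x y, `|f x - f y| <= C * dist1 x y].

Definition inbox d (a : R) (x : 'rV[R]_d) : Prop := forall i, `|x 0 i| <= a.

Definition slice d (f : 'rV[R]_d.+1 -> R) (t : R) : 'rV[R]_d -> R :=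
  fun y => f (row_mx (t%:M : 'rV[R]_1) y).

Fixpoint boxint (a : R) (d : nat) : ('rV[R]_d -> R) -> R :=
  match d with
  | 0%N => fun f => f 0
  | d'.+1 => fun f => int1 a (fun t => boxint a (slice f t))
  end.

Lemma dist1_ge0 d (x y : 'rV[R]_d) : 0 <= dist1 x y.
Proof. by apply: sumr_ge0. Qed.

Lemma line_coord d (h : R) (i k : 'I_d) (x : 'rV[R]_d) :
  (h *: dir R i + x) 0 k = h * (k == i)%:R + x 0 k.
Proof. by rewrite !mxE eqxx. Qed.

Lemma row_lift d (t : 'rV[R]_1) (y : 'rV[R]_d) (i : 'I_d) :
  (row_mx t y : 'rV[R]_d.+1) 0 (lift ord0 i) = y 0 i.
Proof.
rewrite (_ : lift ord0 i = rshift 1 i :> 'I_(1 + d)); last exact/val_inj.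
exact: row_mxEr.
Qed.

Lemma row_ord0 d (t : R) (y : 'rV[R]_d) :
  (row_mx (t%:M : 'rV[R]_1) y : 'rV[R]_d.+1) 0 ord0 = t.
Proof.
rewrite (_ : ord0 = lshift d ord0 :> 'I_(1 + d)); last exact/val_inj.
transitivity ((t%:M : 'rV[R]_1) 0 0); last by rewrite mxE eqxx mulr1n.
exact: (row_mxEl (t%:M : 'rV[R]_1) y 0 ord0).
Qed.

Lemma dist1_row d (t t' : R) (y y' : 'rV[R]_d) :
  dist1 (row_mx (t%:M : 'rV[R]_1) y : 'rV[R]_d.+1) (row_mx (t'%:M : 'rV[R]_1) y') =
  `|t - t'| + dist1 y y'.
Proof.
rewrite /dist1 big_ord_recl !row_ord0; congr (_ + _).
by apply: eq_bigr => i _; rewrite !row_lift.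
Qed.

Lemma dist1xx d (x : 'rV[R]_d) : dist1 x x = 0.
Proof. by apply: big1 => i _; rewrite subrr normr0. Qed.

Lemma row_box d a (t : R) (y : 'rV[R]_d) :
  inbox a (row_mx (t%:M : 'rV[R]_1) y : 'rV[R]_d.+1) <-> `|t| <= a /\ inbox a y.
Proof.
split=> [H|[ta ya] i].
  split; first by have := H ord0; rewrite row_ord0.
  by move=> i; have := H (lift ord0 i); rewrite row_lift.
by case: (fintype.unliftP ord0 i) => [j ->|->]; rewrite ?row_lift ?row_ord0.
Qed.

Lemma bl_cst d (c : R) : bl (fun _ : 'rV[R]_d => c).
Proof.
exists `|c|; split=> // x y.
by rewrite subrr normr0 mulr_ge0// dist1_ge0.
Qed.

Lemma bl_add d (f g : 'rV[R]_d -> R) : bl f -> bl g -> bl (fun x => f x + g x).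
Proof.
move=> [C [C0 Cb Cl]] [D [D0 Db Dl]]; exists (C + D); split=> [|x|x y].
- exact: addr_ge0.
- by rewrite (le_trans (ler_normD _ _))// lerD.
- rewrite opprD addrACA mulrDl (le_trans (ler_normD _ _))// lerD//.
Qed.

Lemma bl_mul d (f g : 'rV[R]_d -> R) : bl f -> bl g -> bl (fun x => f x * g x).
Proof.
move=> [C [C0 Cb Cl]] [D [D0 Db Dl]]; exists (C * D + C * D); split=> [|x|x y].
- by rewrite addr_ge0// mulr_ge0.
- by rewrite normrM (le_trans (ler_pM _ _ (Cb x) (Db x)))// lerDl mulr_ge0.
- have -> : f x * g x - f y * g y = f x * (g x - g y) + (f x - f y) * g y by ring.
  rewrite (le_trans (ler_normD _ _))// !normrM mulrDl lerD//.
    by rewrite -mulrA ler_pM.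
  by rewrite mulrAC ler_pM.
Qed.

Lemma bl_scale d c (f : 'rV[R]_d -> R) : bl f -> bl (fun x => c * f x).
Proof. by move=> blf; apply: bl_mul => //; exact: bl_cst. Qed.

Lemma bl_sub d (f g : 'rV[R]_d -> R) : bl f -> bl g -> bl (fun x => f x - g x).
Proof.
move=> blf blg; rewrite (_ : (fun x => _) = fun x => f x + -1 * g x).
  by apply: bl_add => //; exact: bl_scale.
by apply/funext => x; rewrite mulN1r.
Qed.

Lemma bl_sum d (I : Type) (r : seq I) (F : I -> 'rV[R]_d -> R) :
  (forall i, bl (F i)) -> bl (fun x => \sum_(i <- r) F i x).
Proof.
move=> H; elim: r => [|i r IH].
  rewrite (_ : (fun x => _) = fun=> 0); first exact: bl_cst.
  by apply/funext => x; rewrite big_nil.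
rewrite (_ : (fun x => _) = fun x => F i x + \sum_(j <- r) F j x).
  exact: bl_add.
by apply/funext => x; rewrite big_cons.
Qed.

Lemma bl_prod d (I : Type) (r : seq I) (F : I -> 'rV[R]_d -> R) :
  (forall i, bl (F i)) -> bl (fun x => \prod_(i <- r) F i x).
Proof.
move=> H; elim: r => [|i r IH].
  rewrite (_ : (fun x => _) = fun=> 1); first exact: bl_cst.
  by apply/funext => x; rewrite big_nil.
rewrite (_ : (fun x => _) = fun x => F i x * \prod_(j <- r) F j x).
  exact: bl_mul.
by apply/funext => x; rewrite big_cons.
Qed.

Lemma bl_slice d (f : 'rV[R]_d.+1 -> R) t : bl f -> bl (slice f t).
Proof.
move=> [C [C0 Cb Cl]]; exists C; split=> // [x|x y]; first exact: Cb.
by apply: (le_trans (Cl _ _)); rewrite dist1_row subrr normr0 add0r.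
Qed.

Lemma lip_continuous (g : R -> R) (C : R) :
  (forall t u, `|g t - g u| <= C * `|t - u|) -> continuous g.
Proof.
move=> H t; apply/cvgrPdist_le => e e0.
have C1 : 0 < `|C| + 1 by rewrite ltr_wpDl.
have e1 : 0 < e / (`|C| + 1) by rewrite divr_gt0.
exists (e / (`|C| + 1)) => //= u /= /ltW tu.
apply: (le_trans (H t u)); apply: le_trans (_ : (`|C| + 1) * `|t - u| <= _).
  by rewrite ler_wpM2r// (le_trans (ler_norm _))// lerDl.
by rewrite mulrC -ler_pdivlMr.
Qed.

Section Fixed.
Variable a : R.
Hypothesis a0 : 0 < a.

(** Linearity and boundedness have to be proved together: the continuity of
the inner integral follows from both. *)
Lemma boxint_main d :
  (forall (c : R) (f g : 'rV[R]_d -> R), bl f -> bl g ->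
    boxint a (fun x => c * f x + g x) = c * boxint a f + boxint a g) /\
  (forall (f : 'rV[R]_d -> R) (M : R), bl f -> (forall x, inbox a x -> `|f x| <= M) ->
    `|boxint a f| <= (2 * a) ^+ d * M).
Proof.
elim: d => [|d [IHl IHb]].
  split=> [//|f M _ H] /=; rewrite expr0 mul1r; apply: H; by case.
have cont (f : 'rV[R]_d.+1 -> R) : bl f -> continuous (fun t => boxint a (slice f t)).
  move=> blf; have [C [C0 Cb Cl]] := blf.
  apply: (@lip_continuous _ ((2 * a) ^+ d * C)) => t u.
  have -> : boxint a (slice f t) - boxint a (slice f u) =
      boxint a (fun y => -1 * slice f u y + slice f t y).
    by rewrite IHl ?mulN1r; [rewrite addrC|exact: bl_slice..].
  rewrite -mulrA; apply: IHb.
    by apply: bl_add; [apply: bl_scale|]; exact: bl_slice.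
  move=> y _; rewrite mulN1r addrC; apply: (le_trans (Cl _ _)).
  by rewrite dist1_row dist1xx addr0.
split=> [c f g blf blg|f M blf H] /=.
  have -> : (fun t => boxint a (slice (fun x => c * f x + g x) t)) =
            (fun t => c * boxint a (slice f t) + boxint a (slice g t)).
    by apply/funext => t; apply: IHl; exact: bl_slice.
  rewrite int1D// ?int1Z//; try exact: cont.
  move=> t; apply: cvgM; [exact: cvg_cst|exact: cont].
rewrite exprS -mulrA; apply: int1_norm => // [|t ta]; first exact: cont.
apply: IHb; first exact: bl_slice.
by move=> y yb; apply: H; apply/row_box.
Qed.

Lemma boxint_lin d (c : R) (f g : 'rV[R]_d -> R) : bl f -> bl g ->
  boxint a (fun x => c * f x + g x) = c * boxint a f + boxint a g.
Proof. exact: (boxint_main d).1. Qed.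

Lemma boxint_norm d (f : 'rV[R]_d -> R) (M : R) : bl f ->
  (forall x, inbox a x -> `|f x| <= M) -> `|boxint a f| <= (2 * a) ^+ d * M.
Proof. exact: (boxint_main d).2. Qed.

Lemma boxint0 d : boxint a (fun _ : 'rV[R]_d => 0) = 0.
Proof.
have := @boxint_lin d (-1) _ _ (bl_cst d 0) (bl_cst d 0).
rewrite (_ : (fun x => _) = fun=> 0); first by rewrite mulN1r addNr.
by apply/funext => x; rewrite mulr0 addr0.
Qed.

Lemma boxintZ d (c : R) (f : 'rV[R]_d -> R) : bl f ->
  boxint a (fun x => c * f x) = c * boxint a f.
Proof.
move=> blf; have := @boxint_lin d c _ _ blf (bl_cst d 0); rewrite boxint0 addr0 => <-.
by congr boxint; apply/funext => x; rewrite addr0.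
Qed.

Lemma boxintD d (f g : 'rV[R]_d -> R) : bl f -> bl g ->
  boxint a (fun x => f x + g x) = boxint a f + boxint a g.
Proof.
move=> blf blg; rewrite -[boxint a f]mul1r -boxint_lin//.
by congr boxint; apply/funext => x; rewrite mul1r.
Qed.

Lemma boxintB d (f g : 'rV[R]_d -> R) : bl f -> bl g ->
  boxint a (fun x => f x - g x) = boxint a f - boxint a g.
Proof.
move=> blf blg; rewrite -mulN1r -boxintZ// -boxintD//; last exact: bl_scale.
by congr boxint; apply/funext => x; rewrite mulN1r.
Qed.

Lemma boxint_sum d (I : Type) (r : seq I) (F : I -> 'rV[R]_d -> R) :
  (forall i, bl (F i)) ->
  boxint a (fun x => \sum_(i <- r) F i x) = \sum_(i <- r) boxint a (F i).
Proof.
move=> H; elim: r => [|i r IH].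
  rewrite big_nil (_ : (fun x => _) = fun=> 0); first exact: boxint0.
  by apply/funext => x; rewrite big_nil.
rewrite big_cons -IH -boxintD//; last exact: bl_sum.
by congr boxint; apply/funext => x; rewrite big_cons.
Qed.

Lemma bl_slice_cont d (f : 'rV[R]_d.+1 -> R) : bl f ->
  continuous (fun t => boxint a (slice f t)).
Proof.
move=> blf; have [C [C0 Cb Cl]] := blf.
apply: (@lip_continuous _ ((2 * a) ^+ d * C)) => t u.
rewrite -boxintB; [|exact: bl_slice..]; rewrite -mulrA; apply: boxint_norm.
  by apply: bl_sub; exact: bl_slice.
by move=> y _; apply: (le_trans (Cl _ _)); rewrite dist1_row dist1xx addr0.
Qed.

Lemma boxint_le d (f g : 'rV[R]_d -> R) : bl f -> bl g ->
  (forall x, inbox a x -> f x <= g x) -> boxint a f <= boxint a g.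
Proof.
elim: d f g => [|d IH] f g blf blg H /=; first by apply: H; case.
apply: int1_le => //; try exact: bl_slice_cont.
move=> t ta; apply: IH; try exact: bl_slice.
by move=> y yb; apply: H; apply/row_box.
Qed.

Lemma boxint_prod d (g : 'I_d -> R -> R) :
  (forall i, continuous (g i)) -> (forall i, bl (fun x : 'rV[R]_d => g i (x 0 i))) ->
  boxint a (fun x : 'rV[R]_d => \prod_i g i (x 0 i)) = \prod_i int1 a (g i).
Proof.
elim: d g => [|d IH] g cg blg; first by rewrite /= !big_ord0.
rewrite big_ord_recl/=; set P := \prod_(i < d) _.
have blg' i : bl (fun x : 'rV[R]_d => g (lift ord0 i) (x 0 i)).
  have [C [C0 Cb Cl]] := blg (lift ord0 i).
  exists C; split=> // [x|x y].
    by have := Cb (row_mx (0%:M : 'rV[R]_1) x); rewrite row_lift.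
  have := Cl (row_mx (0%:M : 'rV[R]_1) x) (row_mx (0%:M : 'rV[R]_1) y).
  by rewrite dist1_row subrr normr0 add0r !row_lift.
have E t : boxint a (slice (fun x : 'rV[R]_d.+1 => \prod_i g i (x 0 i)) t) = P * g ord0 t.
  rewrite [RHS]mulrC /P -(IH (fun i => g (lift ord0 i)))// -boxintZ; last exact: bl_prod.
  congr boxint; apply/funext => y; rewrite /slice big_ord_recl row_ord0; congr (_ * _).
  by apply: eq_bigr => i _; rewrite row_lift.
by rewrite (_ : (fun t => _) = fun t => P * g ord0 t) ?int1Z 1?mulrC//; exact/funext.
Qed.

(** In the direction of the first coordinate the integral of the slices is
differentiated under the integral sign, the remainder being quadratic by the
Lipschitz bound on Df; in the other directions the slices are used. *)
Lemma boxint_deriv d (i : 'I_d) (f Df : 'rV[R]_d -> R) :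
  (forall x, is_derive x (dir R i) f (Df x)) -> bl f -> bl Df ->
  (forall x : 'rV[R]_d, a <= `|x 0 i| -> f x = 0) -> boxint a Df = 0.
Proof.
elim: d i f Df => [[]//|d IH] i f Df dDf blf blDf f0 /=.
have shiftE (t h : R) (y : 'rV[R]_d) : row_mx ((t + h)%:M : 'rV[R]_1) y =
    h *: dir R (ord0 : 'I_d.+1) + (row_mx (t%:M : 'rV[R]_1) y : 'rV[R]_d.+1).
  apply/rowP => k; rewrite [RHS]line_coord.
  case: (fintype.unliftP ord0 k) => [j ->|->].
    by rewrite !row_lift eq_sym (negbTE (neq_lift _ _)) mulr0 add0r.
  by rewrite !row_ord0 eqxx mulr1 addrC.
case: (fintype.unliftP ord0 i) => [j ij|ij]; rewrite ij in dDf f0.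
  rewrite (_ : (fun t => _) = fun=> 0) ?int1_cst ?mulr0//; apply/funext => t.
  apply: (IH j (slice f t)); try exact: bl_slice.
  - move=> y; apply/is_derive_line.
    have /is_derive_line := dDf (row_mx (t%:M : 'rV[R]_1) y).
    rewrite (_ : (fun h : R => f _) = fun h : R => slice f t (h *: dir R j + y))//.
    apply/funext => h; rewrite /slice; congr f; apply/rowP => k.
    rewrite [LHS]line_coord.
    case: (fintype.unliftP ord0 k) => [l ->|->].
      by rewrite !row_lift [RHS]line_coord (inj_eq lift_inj).
    by rewrite !row_ord0 (negbTE (neq_lift _ _)) mulr0 add0r.
  - by move=> y yj; apply: f0; rewrite row_lift.
have [C [C0 Cb Cl]] := blDf.
transitivity (boxint a (slice f a) - boxint a (slice f (- a))); last first.
  have z t : a <= `|t| -> boxint a (slice f t) = 0.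
    move=> ta; rewrite -(boxint0 d); congr boxint; apply/funext => y; apply: f0.
    by rewrite row_ord0.
  by rewrite !z ?normrN ?subr0 ?ger0_norm// ltW.
apply: (@int1_ftc _ _ a0 (fun t => boxint a (slice f t))); last exact: bl_slice_cont.
move=> t; apply: (@is_derive_quad _ _ _ _ _ _ ((2 * a) ^+ d * C)) => h.
have -> : h *: (1 : R) + t = t + h by rewrite [_%:A]mulr1 addrC.
have bh : bl (fun y => h * slice Df t y) by apply: bl_scale; exact: bl_slice.
have b2 : bl (fun y => slice f (t + h) y - slice f t y) by apply: bl_sub; exact: bl_slice.
rewrite -(boxintZ h (bl_slice t blDf)) -boxintB; [|exact: bl_slice..].
rewrite -(boxintB b2 bh) -mulrA; apply: boxint_norm; first exact: bl_sub.
move=> y _; rewrite /slice shiftE.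
have [u uh ->] := MVT_line (row_mx (t%:M : 'rV[R]_1) y) h dDf.
rewrite -mulrBr normrM -[h ^+ 2]real_normK ?num_real// expr2 mulrCA ler_wpM2l//.
apply: (le_trans (Cl _ _)); rewrite ler_wpM2l//.
by rewrite -shiftE dist1_row dist1xx addr0 addrC addKr.
Qed.

Lemma integralRd0 d : integralRd (fun _ : 'rV[R]_d => 0) = 0.
Proof.
elim: d => [//|d IH] /=; rewrite (_ : (fun t => _) = fun=> 0).
  by rewrite Rintegral_cst// mul0r.
by apply/funext => t; exact: IH.
Qed.

(** This is what links the integral over the whole space to the boxes. *)
Lemma integralRd_boxint d (f : 'rV[R]_d -> R) :
  (forall x, ~ inbox a x -> f x = 0) -> integralRd f = boxint a f.
Proof.
elim: d f => [//|d IH] f f0 /=; rewrite /int1 [RHS]Rintegral_mkcond.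
congr Rintegral; apply/funext => t; rewrite patchE; case: ifPn; rewrite ?inE/= ?notin_setE/=.
  rewrite in_itv/= -ler_norml => ta; apply: IH => y ny; apply: f0 => /row_box[_]; exact: ny.
rewrite in_itv/= => /negP; rewrite -ler_norml => ta.
rewrite -[RHS](integralRd0 d); congr integralRd; apply/funext => y.
by apply: f0 => /row_box[h _]; exact: (negP ta h).
Qed.

End Fixed.
End BoxIntegral.

(** * Lipschitz bounds, trigonometric functions and the Fejer kernel *)

Section SmoothBl.
Variables (R : realType) (d : nat).
Local Notation Rd := 'rV[R]_d.
Local Notation dir := (@dir R d).
Implicit Types (f g : Rd -> R) (K : set Rd).

(** Going from x to y by changing the coordinates one at a time gives the constant
B for the sum distance. *)
Lemma deriv_lip f (Df : 'I_d -> Rd -> R) (B : R) :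
  (forall i x, is_derive x (dir i) f (Df i x)) ->
  (forall i x, `|Df i x| <= B) -> forall x y, `|f x - f y| <= B * dist1 x y.
Proof.
move=> dDf DB x y.
pose z (k : nat) : Rd := \row_j (if (j < k)%N then y 0 j else x 0 j).
have z0 : z 0%N = x by apply/rowP => j; rewrite mxE.
have zd : z d = y by apply/rowP => j; rewrite mxE ltn_ord.
have step k (kd : (k < d)%N) :
    `|f (z k.+1) - f (z k)| <= B * `|x 0 (Ordinal kd) - y 0 (Ordinal kd)|.
  set i := Ordinal kd.
  have -> : z k.+1 = (y 0 i - x 0 i) *: dir i + z k.
    apply/rowP => j; rewrite line_coord !mxE ltnS leq_eqVlt.
    rewrite -[(j == k :> nat)]/(j == i).
    have [->|ji] := eqVneq j i; first by rewrite ltnn mulr1 subrK.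
    by rewrite mulr0 add0r.
  have [t _ ->] := MVT_line (z k) (y 0 i - x 0 i) (dDf i).
  by rewrite normrM mulrC (distrC (x 0 i)) ler_wpM2r.
have : `|\sum_(0 <= k < d) (f (z k.+1) - f (z k))| <= B * dist1 x y.
  rewrite big_mkord /dist1 mulr_sumr.
  apply: (le_trans (ler_norm_sum _ _ _)); apply: ler_sum => i _.
  by have := step i (ltn_ord i); rewrite (_ : Ordinal _ = i)//; exact: val_inj.
by rewrite telescope_sumr// z0 zd distrC.
Qed.

Lemma deriv_bl f (Df : 'I_d -> Rd -> R) (A B : R) :
  (forall i x, is_derive x (dir i) f (Df i x)) -> 0 <= A -> 0 <= B ->
  (forall x, `|f x| <= A) -> (forall i x, `|Df i x| <= B) -> bl f.
Proof.
move=> dDf A0 B0 fA DB; exists (A + B); split=> [|x|x y]; first exact: addr_ge0.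
  by rewrite (le_trans (fA x))// lerDl.
apply: (le_trans (deriv_lip dDf DB x y)).
by rewrite ler_wpM2r ?dist1_ge0// lerDr.
Qed.

Lemma derive_off f K i : closed K -> (forall x, ~ K x -> f x = 0) ->
  forall x, ~ K x -> 'D_(dir i) f x = 0.
Proof.
move=> cK f0 x nx; rewrite -(derive_cst (0 : R) x (dir i)).
apply: near_eq_derive; have oK : open (~` K) by exact: closed_openC.
have : nbhs x (~` K) by apply: open_nbhs_nbhs.
by apply: filterS => y; exact: f0.
Qed.

Lemma smooth_cs_bl f K : smoothR f -> compact K -> (forall x, ~ K x -> f x = 0) -> bl f.
Proof.
move=> sf cK f0; have clK : closed K by apply: compact_closed cK; exact: norm_hausdorff.
have bnd g : smoothR g -> (forall x, ~ K x -> g x = 0) ->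
    exists2 C : R, 0 <= C & forall x, `|g x| <= C.
  move=> sg g0; have [C C0 HC] := compact_bound cK (Cn_continuous (sg 0%N)).
  exists C => // x; have [Kx|nKx] := pselect (K x); first exact: HC.
  by rewrite g0// normr0.
have [A A0 HA] := bnd f sf f0.
have /choice[B HB] : forall i, exists B : R, 0 <= B /\ forall x, `|'D_(dir i) f x| <= B.
  move=> i; have [B B0 HB] := bnd _ (smoothR_derive i sf) (derive_off i clK f0).
  by exists B.
apply: (deriv_bl (B := \sum_i B i)) A0 _ HA _.
- move=> i x; exact: smoothR_is_derive.
- by apply: sumr_ge0 => i _; exact: (HB i).1.
- move=> i x; apply: (le_trans ((HB i).2 x)).
  by rewrite (bigD1 i)//= lerDl sumr_ge0// => j _; exact: (HB j).1.
Qed.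

End SmoothBl.

Section Trig.
Variables (R : realType) (d : nat).
Local Notation Rd := 'rV[R]_d.
Local Notation dir := (@dir R d).

(** Real trigonometric monomials: the class is stable under differentiation, with
explicit coefficients. *)
Definition trig (a b : R) (xi x : Rd) : R :=
  a * cos (2 * pi * dotv x xi) + b * sin (2 * pi * dotv x xi).

Lemma dotv_line (h : R) i (x xi : Rd) :
  dotv (h *: dir i + x) xi = h * xi 0 i + dotv x xi.
Proof.
rewrite /dotv (bigD1 i)//= [in RHS](bigD1 i)//= addrA; congr (_ + _).
  by rewrite line_coord eqxx mulr1 mulrDl.
by apply: eq_bigr => j ji; rewrite line_coord (negbTE ji) mulr0 add0r.
Qed.

Lemma is_derive_affine (c e t : R) : is_derive t (1 : R) (fun h : R => c * h + e) c.
Proof.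
apply: (@is_derive_quad _ _ _ _ _ _ 0) => h; rewrite [h *: _]mulr1 mul0r normr_le0.
by apply/eqP; ring.
Qed.

Lemma is_derive_cos_affine (c e t : R) :
  is_derive t (1 : R) (fun h : R => cos (c * h + e)) (- sin (c * t + e) * c).
Proof.
exact: (@is_derive1_comp _ (@cos R) (fun h => c * h + e) t _ _
          (is_derive_cos _) (is_derive_affine c e t)).
Qed.

Lemma is_derive_sin_affine (c e t : R) :
  is_derive t (1 : R) (fun h : R => sin (c * h + e)) (cos (c * t + e) * c).
Proof.
exact: (@is_derive1_comp _ (@sin R) (fun h => c * h + e) t _ _
          (is_derive_sin _) (is_derive_affine c e t)).
Qed.

Lemma trig_deriv a b (xi : Rd) i x :
  is_derive x (dir i) (trig a b xi)
    (trig (2 * pi * xi 0 i * b) (- (2 * pi * xi 0 i * a)) xi x).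
Proof.
apply/is_derive_line; set e := 2 * pi * dotv x xi; set c := 2 * pi * xi 0 i.
have E h : 2 * pi * dotv (h *: dir i + x) xi = c * h + e.
  by rewrite dotv_line /c /e; ring.
rewrite (_ : (fun h => _) = fun h => a * cos (c * h + e) + b * sin (c * h + e)); last first.
  by apply/funext => h; rewrite /trig E.
have := is_deriveD (is_deriveZ a (is_derive_cos_affine c e 0))
                   (is_deriveZ b (is_derive_sin_affine c e 0)).
move=> H; apply: (is_derive_eq H); rewrite /trig -/e mulr0 add0r /GRing.scale/=.
by ring.
Qed.

Lemma trig_norm a b (xi x : Rd) : `|trig a b xi x| <= `|a| + `|b|.
Proof.
rewrite /trig (le_trans (ler_normD _ _))// !normrM lerD// ler_piMr//.
  exact: cos_max.
exact: sin_max.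
Qed.

Lemma trig_smooth a b (xi : Rd) : smoothR (trig a b xi).
Proof.
have ct a' b' : continuous (trig a' b' xi).
  have dl : Cn 0 (fun y : Rd => 2 * pi * dotv y xi).
    apply: Cn_scale; apply: Cn_sum => i _.
    by apply: Cn_mul; [exact: Cn_coord|exact: Cn_cst].
  apply: (@Cn_continuous _ _ 0); apply: Cn_add; apply: Cn_scale; apply: Cn_comp => //.
    by split=> //; exact: continuous_cos.
  by split=> //; exact: continuous_sin.
move=> n; elim: n a b => [|n IH] a b; split=> //.
exists (fun i => trig (2 * pi * xi 0 i * b) (- (2 * pi * xi 0 i * a)) xi).
by split=> // i x; exact: trig_deriv.
Qed.

Lemma trig_bl a b (xi : Rd) : bl (trig a b xi).
Proof.
apply: (deriv_bl (A := `|a| + `|b|)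
   (B := \sum_i (`|2 * pi * xi 0 i * b| + `|2 * pi * xi 0 i * a|))).
- move=> i x; exact: trig_deriv.
- by rewrite addr_ge0.
- by apply: sumr_ge0 => i _; rewrite addr_ge0.
- exact: trig_norm.
- move=> i x; apply: (le_trans (trig_norm _ _ _ _)); rewrite normrN.
  by rewrite (bigD1 i)//= lerDl sumr_ge0// => j _; rewrite addr_ge0.
Qed.

End Trig.

Section Fejer.
Variable R : realType.
Implicit Types (n : nat) (w t L : R).

(** (1/n) |sum_(j < n) exp(i j w t)|^2, written with real functions. *)
Definition fejer n w t : R := n%:R^-1 *
  ((\sum_(j < n) cos (j%:R * (w * t))) ^+ 2 + (\sum_(j < n) sin (j%:R * (w * t))) ^+ 2).

Lemma fejer_ge0 n w t : 0 <= fejer n w t.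
Proof. by rewrite mulr_ge0 ?invr_ge0// addr_ge0// sqr_ge0. Qed.

Lemma sum_pair_mul n (F G : 'I_n -> R) :
  (\sum_j F j) * (\sum_l G l) = \sum_(p : 'I_n * 'I_n) F p.1 * G p.2.
Proof.
rewrite mulr_suml -(pair_bigA _ (fun j l => F j * G l))/=.
by apply: eq_bigr => j _; rewrite mulr_sumr.
Qed.

Lemma fejer_cos n w t : fejer n w t =
  n%:R^-1 * \sum_(p : 'I_n * 'I_n) cos ((p.1%:R - p.2%:R) * (w * t)).
Proof.
congr (_ * _); rewrite !expr2 !sum_pair_mul -big_split/=.
by apply: eq_bigr => p _; rewrite mulrBl cosB.
Qed.

(** The summand is odd under the exchange of the two indices. *)
Lemma fejer_sin n w t :
  \sum_(p : 'I_n * 'I_n) sin ((p.1%:R - p.2%:R) * (w * t)) = 0.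
Proof.
rewrite (eq_bigr (fun p : 'I_n * 'I_n => sin (p.1%:R * (w * t)) * cos (p.2%:R * (w * t))
   - cos (p.1%:R * (w * t)) * sin (p.2%:R * (w * t)))); last first.
  by move=> p _; rewrite mulrBl sinB.
have /= E1 := sum_pair_mul (fun j : 'I_n => sin (j%:R * (w * t)))
                           (fun l : 'I_n => cos (l%:R * (w * t))).
have /= E2 := sum_pair_mul (fun j : 'I_n => cos (j%:R * (w * t)))
                           (fun l : 'I_n => sin (l%:R * (w * t))).
by rewrite sumrB -E1 -E2 mulrC subrr.
Qed.

Definition sqc (z : R[i]) : R := complex.Re z ^+ 2 + complex.Im z ^+ 2.

Lemma sqcM (z u : R[i]) : sqc (z * u) = sqc z * sqc u.
Proof. by case: z u => [a b] [c e]; rewrite /sqc /=; ring. Qed.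

Definition expi (t : R) : R[i] := cos t +i* sin t.

Lemma expiD (s t : R) : expi (s + t) = expi s * expi t.
Proof.
rewrite /expi cosD sinD; apply/eqP.
by rewrite eq_complex/= eqxx/= addrC mulrC [sin s * _]mulrC [sin t * _]mulrC.
Qed.

Lemma expi0 : expi 0 = 1.
Proof. by rewrite /expi cos0 sin0. Qed.

Lemma expi_natr n (t : R) : expi (n%:R * t) = expi t ^+ n.
Proof.
elim: n => [|n IH]; first by rewrite mul0r expi0.
by rewrite -addn1 natrD mulrDl mul1r expiD IH exprD expr1.
Qed.

Lemma sqc_expi1 (t : R) : sqc (expi t - 1) = 2 - 2 * cos t.
Proof.
rewrite /sqc /= oppr0 addr0; have := cos2Dsin2 t.
move=> h; transitivity (cos t ^+ 2 + sin t ^+ 2 + 1 - 2 * cos t); first by ring.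
by rewrite h; ring.
Qed.

Lemma Re_sum (I : Type) (r : seq I) (F : I -> R[i]) :
  complex.Re (\sum_(i <- r) F i) = \sum_(i <- r) complex.Re (F i).
Proof. by elim: r => [|i r IH]; rewrite ?big_nil// !big_cons ReD IH. Qed.

Lemma Im_sum (I : Type) (r : seq I) (F : I -> R[i]) :
  complex.Im (\sum_(i <- r) F i) = \sum_(i <- r) complex.Im (F i).
Proof. by elim: r => [|i r IH]; rewrite ?big_nil// !big_cons ImD IH. Qed.

(** |e^(is) - 1|^2 |sum_(j < n) e^(ijs)|^2 = |e^(ins) - 1|^2 <= 4. *)
Lemma fejer_moment n w t : (0 < n)%N -> fejer n w t * (2 - 2 * cos (w * t)) <= 4 / n%:R.
Proof.
move=> n0; rewrite /fejer -mulrA [leRHS]mulrC ler_wpM2l ?invr_ge0//.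
set s := w * t; pose D : R[i] := \sum_(j < n) expi s ^+ j.
have -> : (\sum_(j < n) cos (j%:R * s)) ^+ 2 + (\sum_(j < n) sin (j%:R * s)) ^+ 2 = sqc D.
  rewrite /sqc /D Re_sum Im_sum.
  by congr (_ ^+ 2 + _ ^+ 2); apply: eq_bigr => j _; rewrite -expi_natr.
rewrite -sqc_expi1 -sqcM mulrC /D -subrX1 -expi_natr sqc_expi1.
by have := cos_geN1 (n%:R * s); lra.
Qed.

Lemma cosR_lip (s t : R) : `|cos s - cos t| <= `|s - t|.
Proof.
have H (u v : R) : u < v -> `|cos v - cos u| <= `|v - u|.
  move=> uv; have [|c _ ->] := @MVT R cos (fun x => - sin x) u v uv.
    exact: continuous_subspaceT (@continuous_cos R).
  by rewrite normrM normrN ler_piMl// sin_max.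
have [st|ts|->] := ltgtP s t; last by rewrite !subrr.
  by rewrite distrC (distrC s); exact: H.
exact: H.
Qed.

Lemma sinR_lip (s t : R) : `|sin s - sin t| <= `|s - t|.
Proof.
have H (u v : R) : u < v -> `|sin v - sin u| <= `|v - u|.
  move=> uv; have [|c _ ->] := @MVT R sin cos u v uv.
    exact: continuous_subspaceT (@continuous_sin R).
  by rewrite normrM ler_piMl// cos_max.
have [st|ts|->] := ltgtP s t; last by rewrite !subrr.
  by rewrite distrC (distrC s); exact: H.
exact: H.
Qed.

Lemma bl_coord d (g : R -> R) (c e : R) (i : 'I_d) :
  (forall t, `|g t| <= 1) -> (forall s t, `|g s - g t| <= `|s - t|) ->
  bl (fun y : 'rV[R]_d => g (c * (e - y 0 i))).
Proof.
move=> g1 gl; exists (1 + `|c|); split=> [|x|x y].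
- by rewrite addr_ge0.
- by rewrite (le_trans (g1 _))// lerDl.
- apply: (le_trans (gl _ _)).
  have -> : c * (e - x 0 i) - c * (e - y 0 i) = - (c * (x 0 i - y 0 i)) by ring.
  rewrite normrN normrM; apply: ler_pM => //; first by rewrite lerDr.
  by rewrite /dist1 (bigD1 i)//= lerDl sumr_ge0.
Qed.

Lemma fejer_bl d n w (e : R) (i : 'I_d) : bl (fun y : 'rV[R]_d => fejer n w (e - y 0 i)).
Proof.
have bc (j : 'I_n) : bl (fun y : 'rV[R]_d => cos (j%:R * (w * (e - y 0 i)))).
  rewrite (_ : (fun y => _) = fun y : 'rV[R]_d => cos ((j%:R * w) * (e - y 0 i))).
    by apply: bl_coord; [exact: cos_max|exact: cosR_lip].
  by apply/funext => y; rewrite mulrA.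
have bs (j : 'I_n) : bl (fun y : 'rV[R]_d => sin (j%:R * (w * (e - y 0 i)))).
  rewrite (_ : (fun y => _) = fun y : 'rV[R]_d => sin ((j%:R * w) * (e - y 0 i))).
    by apply: bl_coord; [exact: sin_max|exact: sinR_lip].
  by apply/funext => y; rewrite mulrA.
have bC := bl_sum (index_enum _) bc; have bS := bl_sum (index_enum _) bs.
exact: (bl_scale _ (bl_add (bl_mul bC bC) (bl_mul bS bS))).
Qed.

Lemma dist1_const d (t u : R) :
  dist1 (const_mx t : 'rV[R]_d) (const_mx u) = d%:R * `|t - u|.
Proof.
rewrite /dist1 (eq_bigr (fun=> `|t - u|)); last by move=> i _; rewrite !mxE.
by rewrite sumr_const card_ord mulr_natl.
Qed.

Lemma bl_coord_continuous d (i : 'I_d) (g : R -> R) :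
  bl (fun x : 'rV[R]_d => g (x 0 i)) -> continuous g.
Proof.
move=> [C [C0 _ Cl]]; apply: (@lip_continuous _ _ (C * d%:R)) => t u.
by have := Cl (const_mx t) (const_mx u); rewrite !mxE dist1_const mulrA.
Qed.

Lemma cos_cont (c e : R) : continuous (fun t : R => cos (c * (e - t))).
Proof.
apply: (@bl_coord_continuous 1 0); apply: bl_coord; [exact: cos_max|exact: cosR_lip].
Qed.

Lemma fejer_cont n w (e : R) : continuous (fun t : R => fejer n w (e - t)).
Proof. exact: (@bl_coord_continuous 1 0 _ (@fejer_bl 1 n w e 0)). Qed.

Lemma sin_nat2pi n (y : R) : sin (y + 2 * pi * n%:R) = sin y.
Proof.
rewrite -[RHS](periodicn (@sinD2pi R) n); congr sin.
by rewrite -[pi *+ 2]mulr_natl -[RHS]/(y + _ *+ n) mulr_natr.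
Qed.

Lemma int1_sum (a : R) (I : Type) (r : seq I) (F : I -> R -> R) : 0 < a ->
  (forall i, continuous (F i)) -> continuous (fun t => \sum_(i <- r) F i t) /\
  int1 a (fun t => \sum_(i <- r) F i t) = \sum_(i <- r) int1 a (F i).
Proof.
move=> a0 cF; elim: r => [|i r [IHc IH]].
  rewrite big_nil (_ : (fun t => _) = fun=> 0).
    by split; [exact: cst_continuous|rewrite int1_cst// mulr0].
  by apply/funext => t; rewrite big_nil.
rewrite big_cons -IH -int1D// (_ : (fun t => _) = fun t => F i t + \sum_(j <- r) F j t).
  by split=> // t; exact: (cvgD (cF i t) (IHc t)).
by apply/funext => t; rewrite big_cons.
Qed.

Lemma int1_cos L (j l : nat) (e : R) : 0 < L ->
  int1 (L / 2) (fun t => cos ((j%:R - l%:R) * (2 * pi / L * (e - t)))) =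
  if j == l then L else 0.
Proof.
move=> L0; have L2 : 0 < L / 2 by rewrite divr_gt0.
case: eqP => [->|/eqP jl].
  rewrite (_ : (fun t => _) = fun=> 1).
    by rewrite int1_cst// mulr1 mulrC divfK.
  by apply/funext => t; rewrite subrr mul0r cos0.
set c := (j%:R - l%:R) * (2 * pi / L).
have c0 : c != 0.
  apply: mulf_neq0; first by rewrite subr_eq0 eqr_nat.
  apply: mulf_neq0; last by rewrite invr_neq0// gt_eqF.
  by apply: mulf_neq0; rewrite ?gt_eqF ?pi_gt0.
rewrite (_ : (fun t => _) = fun t => cos (c * (e - t))); last first.
  by apply/funext => t; rewrite mulrA.
pose G (t : R) := - c^-1 * sin ((- c) * t + c * e).
transitivity (G (L / 2) - G (- (L / 2))).
  apply: (@int1_ftc _ _ L2 G); last exact: cos_cont.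
  move=> t; have H := is_deriveZ (- c^-1) (is_derive_sin_affine (- c) (c * e) t).
  apply: (is_derive_eq H); rewrite /GRing.scale/=.
  have -> : c * (e - t) = - c * t + c * e by ring.
  by field.
have E : - c * (- (L / 2)) + c * e = - c * (L / 2) + c * e - 2 * pi * l%:R + 2 * pi * j%:R.
  by rewrite /c; field; rewrite gt_eqF.
by rewrite /G E sin_nat2pi -(sin_nat2pi l (_ - _)) subrK; ring.
Qed.

Lemma fejer_mass n L (e : R) : 0 < L -> (0 < n)%N ->
  int1 (L / 2) (fun t => fejer n (2 * pi / L) (e - t)) = L.
Proof.
move=> L0 n0; have L2 : 0 < L / 2 by rewrite divr_gt0.
have cc (p : 'I_n * 'I_n) :
    continuous (fun t => cos ((p.1%:R - p.2%:R) * (2 * pi / L * (e - t)))).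
  rewrite (_ : (fun t => _) = fun t => cos (((p.1%:R - p.2%:R) * (2 * pi / L)) * (e - t))).
    exact: cos_cont.
  by apply/funext => t; rewrite mulrA.
have [cs S] := int1_sum (index_enum _) L2 cc.
rewrite (_ : (fun t => _) = fun t => n%:R^-1 *
   \sum_(p : 'I_n * 'I_n) cos ((p.1%:R - p.2%:R) * (2 * pi / L * (e - t)))); last first.
  by apply/funext => t; rewrite fejer_cos.
rewrite int1Z// S (eq_bigr _ (fun (p : 'I_n * 'I_n) _ => int1_cos p.1 p.2 e L0)).
rewrite -(pair_bigA _ (fun j l : 'I_n => if (j : nat) == l then L else 0))/=.
rewrite (eq_bigr (fun=> L)); last first.
  move=> j _; rewrite (bigD1 j)//= eqxx big1 ?addr0// => l /negbTE lj.
  by rewrite eq_sym [_ == _]lj.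
by rewrite sumr_const card_ord -[L *+ n]mulr_natl mulrA mulVf ?mul1r// pnatr_eq0 -lt0n.
Qed.

(** From sin s = 2 sin(s/2) cos(s/2) with |s/2| <= 3 pi/8 < pi/2, a range where
cos is bounded below. *)
Lemma sin_lower (s : R) : `|s| <= 3 * pi / 4 ->
  s ^+ 2 * cos (3 * pi / 8) ^+ 4 <= sin s ^+ 2.
Proof.
wlog s0 : s / 0 <= s.
  move=> H hs; have [/H//|sN] := leP 0 s; first exact.
  by have := H (- s); rewrite oppr_ge0 ltW// normrN sinN !sqrrN; exact.
rewrite ger0_norm// => hs; have := @pi_gt0 R => p0.
have [<-|sp] := eqVneq 0 s; first by rewrite sin0 expr0n/= mul0r.
have {s0}s0 : 0 < s by rewrite lt_def eq_sym sp s0.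
set u := s / 2; have u0 : 0 < u by rewrite divr_gt0.
have u3 : u <= 3 * pi / 8 by rewrite /u; lra.
have c3 : 0 < cos (3 * pi / 8 : R) by apply: cos_gt0_pihalf; apply/andP; split; lra.
have cmono v : 0 <= v -> v <= u -> cos (3 * pi / 8) <= cos v.
  move=> v0 vu; rewrite leNgt; apply/negP => lt.
  have : 3 * pi / 8 < v; last by lra.
  by rewrite -(ltr_cos) ?in_itv/=//; apply/andP; split; lra.
have cu := cmono u (ltW u0) (lexx u).
have su : u * cos (3 * pi / 8) <= sin u.
  have [|c /[!in_itv]/= /andP[c0 cu'] E] := @MVT R sin cos 0 u u0.
    exact: continuous_subspaceT (@continuous_sin R).
  move: E; rewrite sin0 !subr0 => ->; rewrite mulrC ler_wpM2r ?(ltW u0)//.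
  by apply: cmono; exact: ltW.
have sE : sin s = 2 * (cos u * sin u).
  have su2 : u *+ 2 = s by rewrite /u mulr2n; lra.
  by rewrite -{1}su2 sin_mulr2n mulr_natl.
have lb : s * cos (3 * pi / 8) ^+ 2 <= sin s.
  have -> : s * cos (3 * pi / 8) ^+ 2 = 2 * (cos (3 * pi / 8) * (u * cos (3 * pi / 8))).
    by rewrite /u; field.
  rewrite sE ler_pM2l// ler_pM// ?(ltW c3)// mulr_ge0// ltW//.
have -> : s ^+ 2 * cos (3 * pi / 8) ^+ 4 = (s * cos (3 * pi / 8) ^+ 2) ^+ 2 by ring.
have h0 : 0 <= s * cos (3 * pi / 8) ^+ 2 by rewrite mulr_ge0 ?sqr_ge0// ltW.
by rewrite [leLHS]expr2 [leRHS]expr2 ler_pM.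
Qed.

(** The difference of a point of the box |x_i| <= L/4 and a point of the period
|y_i| <= L/2 is at most 3L/4 < L in each coordinate, so that the only zero of
2 - 2 cos(2 pi t/L) in the range is t = 0. *)
Lemma square_le_cos L : 0 < L -> exists2 kappa : R, 0 <= kappa &
  forall t, `|t| <= 3 * L / 4 -> t ^+ 2 <= kappa * (2 - 2 * cos (2 * pi / L * t)).
Proof.
move=> L0; have p0 := @pi_gt0 R.
have c3 : 0 < cos (3 * pi / 8 : R) by apply: cos_gt0_pihalf; apply/andP; split; lra.
set k := cos (3 * pi / 8) in c3.
exists ((L / pi) ^+ 2 / (4 * k ^+ 4)).
  by rewrite divr_ge0 ?sqr_ge0// mulr_ge0// exprn_ge0// ltW.
have pN : pi != 0 :> R by rewrite gt_eqF.
have LN : L != 0 by rewrite gt_eqF.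
have kN : k != 0 by rewrite gt_eqF.
move=> t tL; set s := pi / L * t.
have sb : `|s| <= 3 * pi / 4.
  have pl : 0 <= pi / L by rewrite divr_ge0 ?pi_ge0 ?(ltW L0).
  rewrite normrM (ger0_norm pl).
  have -> : 3 * pi / 4 = pi / L * (3 * L / 4) by field; rewrite gt_eqF.
  by rewrite ler_wpM2l.
have := sin_lower sb; rewrite -/k => H.
have cE : 2 - 2 * cos (2 * pi / L * t) = 4 * sin s ^+ 2.
  have -> : 2 * pi / L * t = s *+ 2 by rewrite /s mulr2n; ring.
  by rewrite cos_mulr2n sin2cos2 -mulr_natl; ring.
have tE : t ^+ 2 = (L / pi) ^+ 2 * s ^+ 2.
  by rewrite /s; move: pN; generalize (pi : R) => p pN; field; rewrite pN LN.
rewrite cE tE; move: H; rewrite -ler_pdivlMr ?exprn_gt0//.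
move: (sin s) (L / pi) => v q.
have -> : q ^+ 2 / (4 * k ^+ 4) * (4 * v ^+ 2) = q ^+ 2 * (v ^+ 2 / k ^+ 4).
  by field; rewrite kN.
by move=> H; rewrite ler_wpM2l ?sqr_ge0.
Qed.

End Fejer.

(** * Fejer means of test functions *)

Section FejerMeans.
Variables (R : realType) (d : nat).
Local Notation Rd := 'rV[R]_d.
Local Notation dir := (@dir R d).
Implicit Types (F : Rd -> R) (L : R) (n : nat).

(** The frequency lattice is indexed by pairs, with repetitions: the number of
pairs with a given difference is the weight of the frequency in the Fejer
kernel. *)
Definition freq n L (g : {ffun 'I_d -> 'I_n * 'I_n}) : Rd :=
  \row_i (((g i).1%:R - (g i).2%:R) / L).

Definition kern n L (z : Rd) : R := \prod_i fejer n (2 * pi / L) (z 0 i).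

Lemma expi_sum (I : Type) (r : seq I) (t : I -> R) :
  expi (\sum_(i <- r) t i) = \prod_(i <- r) expi (t i).
Proof. by apply: (big_morph _ (@expiD R) (@expi0 R)). Qed.

(** Product over the coordinates of the double sums of [fejer_cos]; their
imaginary parts vanish by [fejer_sin]. *)
Lemma expi_kern n L z : (0 < n)%N ->
  \sum_(g : {ffun 'I_d -> 'I_n * 'I_n}) expi (2 * pi * dotv z (freq L g)) =
  (n%:R ^+ d * kern n L z)%:C.
Proof.
move=> n0.
have E (g : {ffun 'I_d -> 'I_n * 'I_n}) : expi (2 * pi * dotv z (freq L g)) =
    \prod_i expi (((g i).1%:R - (g i).2%:R) * (2 * pi / L * z 0 i)).
  rewrite -expi_sum /dotv mulr_sumr; congr expi; apply: eq_bigr => i _.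
  by rewrite mxE; ring.
rewrite (eq_bigr _ (fun g _ => E g)).
rewrite -(bigA_distr_bigA (fun i (p : 'I_n * 'I_n) =>
   expi ((p.1%:R - p.2%:R) * (2 * pi / L * z 0 i)))).
rewrite /kern -[n%:R ^+ d](_ : \prod_(i < d) n%:R = _); last first.
  by rewrite prodr_const card_ord.
rewrite -big_split/= rmorph_prod; apply: eq_bigr => i _.
apply/eqP; rewrite eq_complex/= Re_sum Im_sum/= fejer_sin eqxx andbT.
by rewrite fejer_cos mulrA mulfV ?mul1r// pnatr_eq0 -lt0n.
Qed.

Lemma sum_cos_kern n L z : (0 < n)%N ->
  \sum_(g : {ffun 'I_d -> 'I_n * 'I_n}) cos (2 * pi * dotv z (freq L g)) =
  n%:R ^+ d * kern n L z.
Proof. by move=> n0; have := congr1 (@complex.Re R) (expi_kern L z n0); rewrite Re_sum. Qed.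

Lemma sum_sin_kern n L z : (0 < n)%N ->
  \sum_(g : {ffun 'I_d -> 'I_n * 'I_n}) sin (2 * pi * dotv z (freq L g)) = 0.
Proof. by move=> n0; have := congr1 (@complex.Im R) (expi_kern L z n0); rewrite Im_sum. Qed.

Lemma kern_ge0 n L z : 0 <= kern n L z.
Proof. by apply: prodr_ge0 => i _; exact: fejer_ge0. Qed.

Lemma kernBE n L (x y : Rd) :
  kern n L (x - y) = \prod_i fejer n (2 * pi / L) (x 0 i - y 0 i).
Proof. by apply: eq_bigr => i _; rewrite !mxE. Qed.

Lemma kern_bl n L (x : Rd) : bl (fun y => kern n L (x - y)).
Proof.
rewrite (_ : (fun y => _) = fun y : Rd => \prod_i fejer n (2 * pi / L) (x 0 i - y 0 i)).
  by apply: bl_prod => i; exact: fejer_bl.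
by apply/funext => y; rewrite kernBE.
Qed.

Definition fmean n L F (x : Rd) : R :=
  (L ^+ d)^-1 * boxint (L / 2) (fun y => F y * kern n L (x - y)).

Lemma kern_mass n L (x : Rd) : 0 < L -> (0 < n)%N ->
  boxint (L / 2) (fun y => kern n L (x - y)) = L ^+ d.
Proof.
move=> L0 n0; have L2 : 0 < L / 2 by rewrite divr_gt0.
rewrite (_ : (fun y => _) = fun y : Rd => \prod_i fejer n (2 * pi / L) (x 0 i - y 0 i)).
  rewrite (boxint_prod L2 (g := fun i t => fejer n (2 * pi / L) (x 0 i - t))).
  - by rewrite (eq_bigr (fun=> L)) ?prodr_const ?card_ord// => i _; exact: fejer_mass.
  - by move=> i; exact: fejer_cont.
  - by move=> i; exact: fejer_bl.
by apply/funext => y; rewrite kernBE.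
Qed.

(** Small differences are paid by the mass of the kernel, large ones by its second
moment. *)
Lemma le_split (u de : R) : 0 < de -> `|u| <= de + u ^+ 2 / de.
Proof.
move=> d0; have [le|lt] := leP `|u| de.
  by rewrite (le_trans le)// lerDl divr_ge0 ?sqr_ge0// ltW.
rewrite -[leLHS]add0r lerD ?(ltW d0)// ler_pdivlMr// -real_normK ?num_real// expr2.
by rewrite ler_wpM2l// ltW.
Qed.

(** A Korovkin argument: the kernel is nonnegative of mass one, and its second
moment, measured by 2 - 2 cos, is at most 4/n. *)
Lemma korovkin L F : 0 < L -> bl F -> forall e : R, 0 < e -> exists n0, forall n,
  (n0 <= n)%N -> (0 < n)%N -> forall x, inbox (L / 4) x -> `|fmean n L F x - F x| <= e.
Proof.
move=> L0 blF e e0; have [C [C0 Cb Cl]] := blF.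
have L2 : 0 < L / 2 by rewrite divr_gt0.
have [kap kap0 Hkap] := square_le_cos L0.
have dC1 : 0 < d%:R * C + 1 by rewrite ltr_wpDl// mulr_ge0.
pose de := e / (2 * (d%:R * C + 1)).
have de0 : 0 < de by rewrite divr_gt0// mulr_gt0.
have deE : e = (d%:R * C + 1) * (de + de) by rewrite /de; field; rewrite gt_eqF.
clearbody de.
exists (Num.bound (4 * kap / de ^+ 2)) => n nn0 n0 x xb.
have nde : 4 * kap / n%:R <= de ^+ 2.
  rewrite ler_pdivrMr ?ltr0n// [leRHS]mulrC -ler_pdivrMr ?exprn_gt0//.
  have h0 : 0 <= 4 * kap / de ^+ 2 by rewrite divr_ge0 ?sqr_ge0// mulr_ge0.
  by apply: (le_trans (ltW (archi_boundP h0))); rewrite ler_nat.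
pose K (y : Rd) := kern n L (x - y).
have blK : bl K by exact: kern_bl.
(* the kernel without its factor in the coordinate i *)
pose M i (y : Rd) := \prod_j (if j == i then fun=> 1 else
     fun t => fejer n (2 * pi / L) (x 0 j - t)) (y 0 j).
have blMc i j : bl (fun y : Rd => (if j == i then fun=> 1 else
     fun t => fejer n (2 * pi / L) (x 0 j - t)) (y 0 j)).
  by case: eqP => _; [exact: bl_cst|exact: fejer_bl].
have blM i : bl (M i) by exact: bl_prod.
have IM i : boxint (L / 2) (M i) = L ^+ d.
  rewrite /M (boxint_prod L2 (g := fun j => if j == i then fun=> 1 else
     fun t => fejer n (2 * pi / L) (x 0 j - t))).
  - rewrite (eq_bigr (fun=> L)) ?prodr_const ?card_ord// => j _.
    case: eqP => _; last exact: fejer_mass.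
    by rewrite int1_cst// mulr1 mulrC divfK.
  - by move=> j; case: eqP => _; [exact: cst_continuous|exact: fejer_cont].
  - exact: blMc.
have KM i y : inbox (L / 2) y -> (x 0 i - y 0 i) ^+ 2 * K y <= kap * (4 / n%:R) * M i y.
  move=> yb; have xy : `|x 0 i - y 0 i| <= 3 * L / 4.
    by apply: (le_trans (ler_normB _ _)); have := xb i; have := yb i; lra.
  rewrite /K kernBE /M (bigD1 i)//= [in leRHS](bigD1 i)//= eqxx mul1r mulrA.
  rewrite [in leRHS](eq_bigr (fun j => fejer n (2 * pi / L) (x 0 j - y 0 j))); last first.
    by move=> j /negbTE ->.
  rewrite ler_wpM2r//; first by apply: prodr_ge0 => j _; exact: fejer_ge0.
  apply: le_trans (_ : (kap * (2 - 2 * cos (2 * pi / L * (x 0 i - y 0 i)))) *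
     fejer n (2 * pi / L) (x 0 i - y 0 i) <= _).
    by rewrite ler_wpM2r ?fejer_ge0// Hkap.
  by rewrite -mulrA ler_wpM2l// mulrC fejer_moment.
pose H (y : Rd) := \sum_(i < d) (C * de * K y + C * (kap * (4 / n%:R) / de) * M i y).
have blHi i : bl (fun y => C * de * K y + C * (kap * (4 / n%:R) / de) * M i y).
  exact: (bl_add (bl_scale _ blK) (bl_scale _ (blM i))).
have blH : bl H by exact: bl_sum.
have IH : boxint (L / 2) H = d%:R * (C * de + C * (kap * (4 / n%:R) / de)) * L ^+ d.
  rewrite /H boxint_sum//.
  rewrite (eq_bigr (fun=> (C * de + C * (kap * (4 / n%:R) / de)) * L ^+ d)).
    by rewrite sumr_const card_ord -[X in X = _]mulr_natl mulrA.
  move=> i _; rewrite boxintD//; [|exact: bl_scale..].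
  by rewrite !boxintZ// IM /K kern_mass// [RHS]mulrDl.
pose D (y : Rd) := F y * K y - F x * K y.
have blD : bl D by apply: bl_sub; [exact: bl_mul|exact: bl_scale].
have DH y : inbox (L / 2) y -> `|D y| <= H y.
  move=> yb; rewrite /D -mulrBl normrM (ger0_norm (kern_ge0 _ _ _)).
  apply: le_trans (_ : C * dist1 y x * K y <= _).
    by rewrite ler_wpM2r// kern_ge0.
  rewrite /dist1 mulr_sumr mulr_suml; apply: ler_sum => i _.
  have := KM i y yb; have := le_split (x 0 i - y 0 i) de0; rewrite distrC => h1 h2.
  rewrite -!mulrA -mulrDr ler_wpM2l//.
  apply: le_trans (_ : (de + (x 0 i - y 0 i) ^+ 2 / de) * K y <= _).
    by rewrite ler_wpM2r// kern_ge0.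
  rewrite mulrDl lerD2l.
  have -> : (x 0 i - y 0 i) ^+ 2 / de * K y = (x 0 i - y 0 i) ^+ 2 * K y / de by ring.
  have -> : kap * (4 * (n%:R^-1 * (de^-1 * M i y))) = kap * (4 / n%:R) * M i y / de by ring.
  by rewrite ler_pM2r ?invr_gt0.
have -> : fmean n L F x - F x = (L ^+ d)^-1 * boxint (L / 2) D.
  rewrite /D boxintB//; [|exact: bl_mul|exact: bl_scale].
  rewrite boxintZ// kern_mass// mulrBr mulrCA mulVf ?mulr1//.
  by rewrite expf_neq0// gt_eqF.
have ID : `|boxint (L / 2) D| <= boxint (L / 2) H.
  rewrite ler_norml; apply/andP; split; last first.
    by apply: boxint_le => // y /DH; exact: le_trans (ler_norm _).
  rewrite -mulN1r -boxintZ//; apply: boxint_le => //; first exact: bl_scale.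
  by move=> y /DH; rewrite mulN1r ler_norml => /andP[].
rewrite normrM ger0_norm ?invr_ge0 ?exprn_ge0 ?(ltW L0)//.
rewrite mulrC ler_pdivrMr ?exprn_gt0//; apply: (le_trans ID); rewrite IH.
rewrite ler_wpM2r ?exprn_ge0 ?(ltW L0)//.
rewrite -mulrDr mulrA.
apply: le_trans (_ : d%:R * C * (de + de) <= _).
  rewrite ler_wpM2l ?mulr_ge0// lerD2l ler_pdivrMr// -expr2.
  by rewrite mulrA [kap * 4]mulrC.
by rewrite deE ler_wpM2r ?addr_ge0 ?(ltW de0)// lerDl.
Qed.

Definition fcos L F (xi : Rd) : R := boxint (L / 2) (fun y => F y * cos (2 * pi * dotv y xi)).
Definition fsin L F (xi : Rd) : R := boxint (L / 2) (fun y => F y * sin (2 * pi * dotv y xi)).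

Lemma cos_bl (xi : Rd) : bl (fun y : Rd => cos (2 * pi * dotv y xi)).
Proof.
rewrite (_ : (fun y => _) = trig 1 0 xi); first exact: trig_bl.
by apply/funext => y; rewrite /trig mul1r mul0r addr0.
Qed.

Lemma sin_bl (xi : Rd) : bl (fun y : Rd => sin (2 * pi * dotv y xi)).
Proof.
rewrite (_ : (fun y => _) = trig 0 1 xi); first exact: trig_bl.
by apply/funext => y; rewrite /trig mul1r mul0r add0r.
Qed.

Lemma dotvBl (x y xi : Rd) : dotv (x - y) xi = dotv x xi - dotv y xi.
Proof. by rewrite /dotv -sumrB; apply: eq_bigr => i _; rewrite !mxE mulrBl. Qed.

Lemma fmeanE n L F x : 0 < L -> (0 < n)%N -> bl F -> fmean n L F x =
  (L ^+ d)^-1 * (n%:R ^+ d)^-1 *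
  \sum_(g : {ffun 'I_d -> 'I_n * 'I_n})
    trig (fcos L F (freq L g)) (fsin L F (freq L g)) (freq L g) x.
Proof.
move=> L0 n0 blF; have L2 : 0 < L / 2 by rewrite divr_gt0.
have nd0 : n%:R ^+ d != 0 :> R by rewrite expf_neq0// pnatr_eq0 -lt0n.
rewrite /fmean -mulrA; congr (_ * _).
pose G y := \sum_(g : {ffun 'I_d -> 'I_n * 'I_n})
      (cos (2 * pi * dotv x (freq L g)) * (F y * cos (2 * pi * dotv y (freq L g))) +
       sin (2 * pi * dotv x (freq L g)) * (F y * sin (2 * pi * dotv y (freq L g)))).
have E : (fun y => F y * kern n L (x - y)) = (fun y => (n%:R ^+ d)^-1 * G y).
  apply/funext => y.
  apply: (mulfI nd0); rewrite [RHS]mulrA mulfV// mul1r mulrCA -sum_cos_kern// mulr_sumr.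
  by apply: eq_bigr => g _; rewrite dotvBl mulrBr cosB; ring.
have bc (xi : Rd) : bl (fun y => F y * cos (2 * pi * dotv y xi)).
  by apply: bl_mul => //; exact: cos_bl.
have bs (xi : Rd) : bl (fun y => F y * sin (2 * pi * dotv y xi)).
  by apply: bl_mul => //; exact: sin_bl.
have bcs (g : {ffun 'I_d -> 'I_n * 'I_n}) : bl (fun y =>
    cos (2 * pi * dotv x (freq L g)) * (F y * cos (2 * pi * dotv y (freq L g))) +
    sin (2 * pi * dotv x (freq L g)) * (F y * sin (2 * pi * dotv y (freq L g)))).
  exact: (bl_add (bl_scale _ (bc _)) (bl_scale _ (bs _))).
rewrite E boxintZ//; last exact: bl_sum.
congr (_ * _); rewrite boxint_sum//.
apply: eq_bigr => g _.
rewrite (boxintD L2 (bl_scale _ (bc _)) (bl_scale _ (bs _))).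
rewrite (boxintZ L2 _ (bc _)) (boxintZ L2 _ (bs _)) /trig mulrC; congr (_ + _).
by rewrite mulrC.
Qed.

Lemma fmean_funE n L F : 0 < L -> (0 < n)%N -> bl F -> fmean n L F = fun x =>
  (L ^+ d)^-1 * (n%:R ^+ d)^-1 *
  \sum_(g : {ffun 'I_d -> 'I_n * 'I_n})
    trig (fcos L F (freq L g)) (fsin L F (freq L g)) (freq L g) x.
Proof. by move=> L0 n0 blF; apply/funext => x; exact: fmeanE. Qed.

Lemma fmean_smooth n L F : 0 < L -> (0 < n)%N -> bl F -> smoothR (fmean n L F).
Proof.
move=> L0 n0 blF m; rewrite fmean_funE//.
by apply: Cn_scale; apply: Cn_sum => g _; exact: trig_smooth.
Qed.

(** Compactness leaves a margin to the boundary of the period, so that no boundary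
terms arise. *)
Definition small_supp L F := exists2 K : set Rd, compact K /\
  (forall y, K y -> forall i, `|y 0 i| < L / 2) & forall y, ~ K y -> F y = 0.

Lemma small_supp_bl L F : smoothR F -> small_supp L F -> bl F.
Proof. by move=> sF [K [cK _] F0]; exact: smooth_cs_bl sF cK F0. Qed.

Lemma small_supp_derive L F i : small_supp L F -> small_supp L ('D_(dir i) F).
Proof.
move=> [K [cK KL] F0]; exists K => //; apply: derive_off => //.
by apply: compact_closed cK; exact: norm_hausdorff.
Qed.

(** Integration by parts: the integral of the derivative of F times an exponential
is zero. *)
Lemma fcoef_derive L F i (xi : Rd) : 0 < L -> smoothR F -> small_supp L F ->
  fcos L ('D_(dir i) F) xi = 2 * pi * xi 0 i * fsin L F xi /\
  fsin L ('D_(dir i) F) xi = - (2 * pi * xi 0 i * fcos L F xi).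
Proof.
move=> L0 sF kF; have L2 : 0 < L / 2 by rewrite divr_gt0.
have blF := small_supp_bl sF kF.
have blDF := small_supp_bl (smoothR_derive i sF) (small_supp_derive i kF).
have bc := cos_bl xi; have bs := sin_bl xi.
have F0 (y : Rd) : L / 2 <= `|y 0 i| -> F y = 0.
  move=> yL; case: kF => K [_ KL] H; apply: H => /KL/(_ i); by rewrite ltNge yL.
have parts a b : boxint (L / 2) (fun y => F y *
     trig (2 * pi * xi 0 i * b) (- (2 * pi * xi 0 i * a)) xi y +
     trig a b xi y * 'D_(dir i) F y) = 0.
  apply: (@boxint_deriv _ _ L2 _ i (fun y => F y * trig a b xi y)).
  - move=> y; apply: is_deriveM; first exact: smoothR_is_derive.
    exact: trig_deriv.
  - by apply: bl_mul => //; exact: trig_bl.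
  - by apply: bl_add; apply: bl_mul => //; exact: trig_bl.
  - by move=> y /F0 ->; rewrite mul0r.
set c := 2 * pi * xi 0 i.
split.
  have := parts 1 0; rewrite -/c (_ : (fun y => _) = fun y => (- c) *
     (F y * sin (2 * pi * dotv y xi)) + 'D_(dir i) F y * cos (2 * pi * dotv y xi)).
    rewrite boxint_lin//; [|exact: bl_mul..].
    by rewrite -/(fsin L F xi) -/(fcos L _ xi) mulNr addrC => /eqP; rewrite subr_eq0 => /eqP.
  by apply/funext => y; rewrite /trig; ring.
have := parts 0 1; rewrite -/c (_ : (fun y => _) = fun y => c *
   (F y * cos (2 * pi * dotv y xi)) + 'D_(dir i) F y * sin (2 * pi * dotv y xi)).
  rewrite boxint_lin//; [|exact: bl_mul..].
  by rewrite -/(fcos L F xi) -/(fsin L _ xi) addrC => /eqP; rewrite addr_eq0 => /eqP.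
by apply/funext => y; rewrite /trig; ring.
Qed.

(** Both sides are the same trigonometric polynomial, by [fcoef_derive]. *)
Lemma fmean_derive n L F i : 0 < L -> (0 < n)%N -> smoothR F -> small_supp L F ->
  'D_(dir i) (fmean n L F) = fmean n L ('D_(dir i) F).
Proof.
move=> L0 n0 sF kF; have blF := small_supp_bl sF kF.
have blDF := small_supp_bl (smoothR_derive i sF) (small_supp_derive i kF).
apply: derive_fun => x; rewrite fmeanE// fmean_funE//.
set c := _ * _; rewrite (eq_bigr (fun g : {ffun 'I_d -> 'I_n * 'I_n} =>
    trig (2 * pi * freq L g 0 i * fsin L F (freq L g))
      (- (2 * pi * freq L g 0 i * fcos L F (freq L g))) (freq L g) x)); last first.
  by move=> g _; have [-> ->] := fcoef_derive i (freq L g) L0 sF kF.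
apply: is_deriveZ; apply: is_derive_bigsum => g; exact: trig_deriv.
Qed.

Lemma fmean_partials n L F s : 0 < L -> (0 < n)%N -> smoothR F -> small_supp L F ->
  [/\ partials s (fmean n L F) = fmean n L (partials s F),
     smoothR (partials s F) & small_supp L (partials s F)].
Proof.
move=> L0 n0; elim/last_ind: s F => [//|s i IH] F sF kF.
rewrite !partials_rcons fmean_derive//.
by apply: IH; [exact: smoothR_derive|exact: small_supp_derive].
Qed.

End FejerMeans.

(** * Means over the lattice of frequencies *)

Section Weights.
Variables (R : realType) (L : R).
Hypothesis L1 : 1 <= L.

Lemma L_gt0 : 0 < L. Proof. exact: lt_le_trans L1. Qed.

(** The factor 4 makes prod_i omega(xi_i) at least max(1, |xi|)^(-2d). *)
Definition omega (x : R) : R := 4 / (1 + `|x|) ^+ 2.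

Definition beta (x : R) : R := L^-1 * omega (x / L).

Lemma omega_gt0 x : 0 < omega x.
Proof. by rewrite divr_gt0// exprn_gt0// ltr_pwDl. Qed.

Lemma beta_ge0 x : 0 <= beta x.
Proof. by rewrite mulr_ge0 ?invr_ge0 ?(ltW L_gt0)// ltW// omega_gt0. Qed.

Lemma betaN x : beta (- x) = beta x.
Proof. by rewrite /beta /omega mulNr normrN. Qed.

(** The sum of beta over the integers of absolute value at most p, as beta is
even. *)
Definition bsum (p : nat) : R := beta 0 + 2 * \sum_(j < p) beta j.+1%:R.

(** The right-hand side telescopes. *)
Lemma beta_le (j : nat) : beta j.+1%:R <= 4 * (L / (L + j%:R) - L / (L + j.+1%:R)).
Proof.
have L0 := L_gt0; have j0 : 0 <= j%:R :> R by [].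
have -> : j.+1%:R = j%:R + 1 :> R by rewrite -natr1.
rewrite /beta /omega ger0_norm; last by rewrite divr_ge0// ?(ltW L0)// addr_ge0.
move: (j%:R : R) j0 => x x0.
have -> : L^-1 * (4 / (1 + (x + 1) / L) ^+ 2) = 4 * (L / (L + (x + 1)) ^+ 2).
  by field; rewrite !gt_eqF//; lra.
have -> : L / (L + x) - L / (L + (x + 1)) = L / ((L + x) * (L + (x + 1))).
  by field; rewrite !gt_eqF//; lra.
rewrite ler_pM2l// ler_pM2l// lef_pV2 ?posrE; [|by rewrite exprn_gt0//; lra|by rewrite mulr_gt0//; lra].
by rewrite expr2 ler_pM2r; lra.
Qed.

(** 4 for the term 0, which is where L >= 1 enters, and 4 for each of the two
halves of the sum. *)
Lemma bsum_le p : bsum p <= 12.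
Proof.
have L0 := L_gt0.
have b0 : beta 0 <= 4.
  rewrite /beta /omega mul0r normr0 addr0 expr1n divr1 mulrC ler_pdivrMr//.
  by rewrite ler_pMr.
have bs : \sum_(j < p) beta j.+1%:R <= 4.
  apply: le_trans (_ : \sum_(j < p) 4 * (L / (L + j%:R) - L / (L + j.+1%:R)) <= _).
    by apply: ler_sum => j _; exact: beta_le.
  rewrite -mulr_sumr -(big_mkord xpredT (fun j => L / (L + j%:R) - L / (L + j.+1%:R))).
  rewrite -[leRHS]mulr1 ler_pM2l//.
  rewrite (eq_bigr (fun j => - (L / (L + j.+1%:R)) - (- (L / (L + j%:R))))); last first.
    by move=> j _; rewrite opprK addrC.
  rewrite telescope_sumr// opprK addr0 divff ?gt_eqF// addrC lerBlDr lerDl.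
  by rewrite divr_ge0 ?(ltW L0)// addr_ge0 ?(ltW L0).
by rewrite /bsum; lra.
Qed.

Lemma bsum_ge0 p : 0 <= bsum p.
Proof. by rewrite addr_ge0 ?beta_ge0// mulr_ge0// sumr_ge0// => j _; exact: beta_ge0. Qed.

Lemma bsum_nd : nondecreasing_seq bsum.
Proof.
apply/nondecreasing_seqP => n; rewrite /bsum big_ord_recr/= lerD2l ler_pM2l// lerDl.
exact: beta_ge0.
Qed.

Lemma bsum_box M : \sum_(m < (M + M).+1) beta (m%:R - M%:R) = bsum M.
Proof.
rewrite -(big_mkord xpredT (fun m => beta (m%:R - M%:R))).
elim: M => [|M IH].
  by rewrite /bsum big_ord0 mulr0 addr0 big_nat1 subrr.
rewrite addSn addnS big_nat_recl// big_nat_recr//=.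
have -> : \sum_(0 <= i < (M + M).+1) beta (i.+1%:R - M.+1%:R) = bsum M.
  by rewrite -IH; apply: eq_bigr => i _; congr beta; rewrite -!natr1; ring.
rewrite /bsum big_ord_recr/= sub0r betaN.
have -> : (M + M).+2%:R - M.+1%:R = M.+1%:R :> R.
  by rewrite -addnS -addSn natrD addrK.
ring.
Qed.

(** Passing from n to n + 1 adds the pairs with maximal entry n, whose differences
run once through the integers of absolute value at most n. *)
Lemma pair_bsum n : \sum_(p : 'I_n * 'I_n) beta (p.1%:R - p.2%:R) = \sum_(k < n) bsum k.
Proof.
rewrite -(pair_bigA _ (fun j l : 'I_n => beta (j%:R - l%:R)))/=.
elim: n => [|n IH]; first by rewrite !big_ord0.
rewrite !big_ord_recr/= -IH.
under eq_bigr do rewrite big_ord_recr/=.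
rewrite big_split/= -addrA; congr (_ + _).
have E : \sum_(l < n) beta (n%:R - l%:R) = \sum_(j < n) beta j.+1%:R.
  rewrite (reindex_inj rev_ord_inj)/=; apply: eq_bigr => j _.
  by rewrite natrB// opprB addrCA subrr addr0.
rewrite (eq_bigr (fun j : 'I_n => beta (n%:R - j%:R))); last first.
  by move=> j _; rewrite -betaN opprB.
by rewrite E subrr /bsum; ring.
Qed.

Definition pair_mean n : R := n.+1%:R^-1 * \sum_(p : 'I_n.+1 * 'I_n.+1) beta (p.1%:R - p.2%:R).

(** Cesaro's lemma: the square partial sums run through all the partial sums. *)
Lemma pair_mean_lim : exists2 S : R, (forall p, bsum p <= S) &
  pair_mean @ \oo --> S /\ forall n, pair_mean n <= S.
Proof.
have cv : cvgn bsum.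
  apply: nondecreasing_is_cvgn; first exact: bsum_nd.
  by exists 12 => _ [p _ <-]; exact: bsum_le.
have le p : bsum p <= limn bsum by apply: nondecreasing_cvgn_le => //; exact: bsum_nd.
exists (limn bsum) => //; split.
  have := cesaro cv; rewrite (_ : arithmetic_mean bsum = pair_mean)//; apply/funext => n.
  by rewrite /pair_mean pair_bsum /arithmetic_mean /series/= big_mkord.
move=> n; rewrite /pair_mean pair_bsum ler_pdivrMl ?ltr0n//.
apply: le_trans (_ : \sum_(k < n.+1) limn bsum <= _); first by apply: ler_sum.
by rewrite sumr_const card_ord -[leLHS]mulr_natl.
Qed.

Lemma pair_mean_ge0 n : 0 <= pair_mean n.
Proof. by rewrite mulr_ge0 ?invr_ge0// sumr_ge0// => p _; exact: beta_ge0. Qed.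

Lemma pair_mean_le n : pair_mean n <= 12.
Proof.
rewrite /pair_mean pair_bsum ler_pdivrMl ?ltr0n//.
apply: le_trans (_ : \sum_(k < n.+1) 12 <= _).
  by apply: ler_sum => k _; exact: bsum_le.
by rewrite sumr_const card_ord -[leLHS]mulr_natl.
Qed.

End Weights.

Section Averages.
Variables (R : realType) (d : nat) (L : R).
Local Notation Rd := 'rV[R]_d.
Hypothesis L1 : 1 <= L.
Let L0 : 0 < L := L_gt0 L1.

Definition lattice_mean n (G : Rd -> R) : R := (L ^+ d)^-1 * (n.+1%:R ^+ d)^-1 *
  \sum_(g : {ffun 'I_d -> 'I_n.+1 * 'I_n.+1}) G (freq L g).

Definition freqb M (f : {ffun 'I_d -> 'I_(M + M).+1}) : Rd :=
  \row_i (((f i)%:R - M%:R) / L).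

(** All means of order at most M are compared on the frequencies of absolute value
at most M/L, numbered from 0 to 2M. *)
Definition diff_index M n (p : 'I_n.+1 * 'I_n.+1) : 'I_(M + M).+1 := inord (p.1 + M - p.2).

Lemma diff_indexE M n (p : 'I_n.+1 * 'I_n.+1) : (n <= M)%N ->
  (diff_index M p)%:R - M%:R = p.1%:R - p.2%:R :> R.
Proof.
move=> nM; case: p => j l /=.
have jn := ltn_ord j; have ln := ltn_ord l.
have lM : (l <= j + M)%N by rewrite (leq_trans _ (leq_addl _ _))// (leq_trans _ nM).
rewrite /diff_index/= inordK; first by rewrite natrB// natrD; ring.
rewrite ltnS leq_subLR (leq_trans _ (leq_addl _ _))// leq_add2r.
exact: leq_trans nM.
Qed.

Lemma diff_index_inj M n (j l l' : 'I_n.+1) : (n <= M)%N ->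
  diff_index M (j, l) = diff_index M (j, l') -> l = l'.
Proof.
move=> nM E; have := diff_indexE (j, l) nM; rewrite E (diff_indexE (j, l') nM)/=.
by move=> /addrI/oppr_inj/eqP; rewrite eqr_nat => /eqP/val_inj.
Qed.

(** For n <= M this is the Fejer weight max(0, 1 - |m - M|/(n + 1)). *)
Definition mult M n (m : 'I_(M + M).+1) : R :=
  n.+1%:R^-1 * \sum_(p : 'I_n.+1 * 'I_n.+1) (diff_index M p == m)%:R.

Lemma mult_ge0 M n (m : 'I_(M + M).+1) : 0 <= mult n m.
Proof. by rewrite mulr_ge0 ?invr_ge0// sumr_ge0. Qed.

(** For each j at most one l has a given difference with j. *)
Lemma mult_le1 M n (m : 'I_(M + M).+1) : (n <= M)%N -> mult n m <= 1.
Proof.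
move=> nM; rewrite /mult ler_pdivrMl ?ltr0n// mulr1.
rewrite -(pair_bigA _ (fun j l : 'I_n.+1 => (diff_index M (j, l) == m)%:R))/=.
apply: le_trans (_ : \sum_(j < n.+1) 1 <= _); last by rewrite sumr_const card_ord.
apply: ler_sum => j _.
case: (pickP (fun l => diff_index M (j, l) == m)) => [l /eqP lm|nl]; last first.
  by rewrite big1// => l _; rewrite nl.
rewrite (bigD1 l)//= big1 ?addr0; first by case: eqP.
move=> l' ll'; case: eqP => // l'm; case/eqP: ll'.
by apply: (@diff_index_inj _ _ j _ _ nM); rewrite l'm lm.
Qed.

Definition multv M n (f : {ffun 'I_d -> 'I_(M + M).+1}) : R := \prod_i mult n (f i).

(** The repetitions of a frequency are collected into its weight. *)
Lemma lattice_mean_regroup M n (G : Rd -> R) : (n <= M)%N ->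
  lattice_mean n G = (L ^+ d)^-1 * \sum_(f : {ffun 'I_d -> 'I_(M + M).+1}) multv n f * G (freqb f).
Proof.
move=> nM; rewrite /lattice_mean -mulrA; congr (_ * _).
pose q (g : {ffun 'I_d -> 'I_n.+1 * 'I_n.+1}) := [ffun i => diff_index M (g i)].
have qE g : freq L g = freqb (q g).
  by apply/rowP => i; rewrite !mxE ffunE diff_indexE.
have mE f : multv n f = (n.+1%:R ^+ d)^-1 *
    \sum_(g : {ffun 'I_d -> 'I_n.+1 * 'I_n.+1}) (q g == f)%:R.
  rewrite /multv /mult big_split/= prodr_const card_ord exprVn; congr (_ * _).
  rewrite bigA_distr_bigA/=; apply: eq_bigr => g _.
  have [<-|] := eqVneq (q g) f.
    by rewrite big1// => i _; rewrite ffunE eqxx.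
  move=> /eqP qf; have [i qi] : exists i, diff_index M (g i) != f i.
    apply/existsP; rewrite -negb_forall; apply/negP => /forallP H; apply: qf.
    by apply/ffunP => i; rewrite ffunE; exact/eqP.
  by rewrite (bigD1 i)//= (negbTE qi) mul0r.
under [RHS]eq_bigr do rewrite mE -mulrA mulr_suml.
rewrite -mulr_sumr exchange_big/=; congr (_ * _); apply: eq_bigr => g _.
rewrite (bigD1 (q g))//= eqxx mul1r -qE big1 ?addr0// => f qf.
by rewrite eq_sym (negbTE qf) mul0r.
Qed.

Definition dominated (B : R) (G : Rd -> R) := forall xi : Rd, `|G xi| <= B * \prod_i omega (xi 0 i).

Lemma lattice_mean_omega n : lattice_mean n (fun xi => \prod_i omega (xi 0 i)) = pair_mean L n ^+ d.
Proof.
rewrite /lattice_mean.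
under eq_bigr do under eq_bigr do rewrite mxE.
rewrite -(bigA_distr_bigA (fun i (p : 'I_n.+1 * 'I_n.+1) => omega ((p.1%:R - p.2%:R) / L))).
rewrite prodr_const card_ord -!exprVn -!exprMn /pair_mean; congr (_ ^+ d).
by rewrite /beta -[in RHS]mulr_sumr [RHS]mulrCA mulrA.
Qed.

Lemma multv_ge0 M n (f : {ffun 'I_d -> 'I_(M + M).+1}) : 0 <= multv n f.
Proof. by apply: prodr_ge0 => i _; exact: mult_ge0. Qed.

Lemma multv_le1 M n (f : {ffun 'I_d -> 'I_(M + M).+1}) : (n <= M)%N -> multv n f <= 1.
Proof.
move=> nM; rewrite /multv; apply: prodr_ile1 => i _.
by rewrite mult_ge0 mult_le1.
Qed.

Lemma omega_box M : (L ^+ d)^-1 * \sum_(f : {ffun 'I_d -> 'I_(M + M).+1})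
   \prod_i omega (freqb f 0 i) = bsum L M ^+ d.
Proof.
under eq_bigr do under eq_bigr do rewrite mxE.
rewrite -(bigA_distr_bigA (fun i (m : 'I_(M + M).+1) => omega ((m%:R - M%:R) / L))).
rewrite prodr_const card_ord -!exprVn -!exprMn -bsum_box; congr (_ ^+ d).
by rewrite /beta mulr_sumr.
Qed.

Lemma omegav_ge0 (xi : Rd) : 0 <= \prod_i omega (xi 0 i).
Proof. by apply: prodr_ge0 => i _; exact/ltW/omega_gt0. Qed.

Lemma lattice_mean_norm n B G : dominated B G -> `|lattice_mean n G| <= B * pair_mean L n ^+ d.
Proof.
move=> dG; rewrite -lattice_mean_omega /lattice_mean normrM ger0_norm; last first.
  by rewrite mulr_ge0 ?invr_ge0 ?exprn_ge0// ltW.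
rewrite mulrCA; apply: ler_wpM2l.
  by rewrite mulr_ge0 ?invr_ge0 ?exprn_ge0// ltW.
by rewrite mulr_sumr; apply: (le_trans (ler_norm_sum _ _ _)); apply: ler_sum => g _.
Qed.

(** The multiplicities of the frequencies lie in [0, 1], so that two means
differ at most by what both lack from the full sum of the weights. *)
Lemma lattice_mean_cauchy n k B G M : (n <= M)%N -> (k <= M)%N -> dominated B G ->
  `|lattice_mean n G - lattice_mean k G| <=
    B * ((bsum L M ^+ d - pair_mean L n ^+ d) + (bsum L M ^+ d - pair_mean L k ^+ d)).
Proof.
move=> nM kM dG; rewrite -!lattice_mean_omega -omega_box.
rewrite !(lattice_mean_regroup _ nM) !(lattice_mean_regroup _ kM).
have Ld : 0 <= (L ^+ d)^-1 by rewrite invr_ge0 exprn_ge0// ltW.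
rewrite -!mulrBr -mulrDr mulrCA normrM ger0_norm// ler_wpM2l//.
rewrite -!sumrB -big_split/= mulr_sumr.
apply: (le_trans (ler_norm_sum _ _ _)); apply: ler_sum => f _.
rewrite -mulrBl normrM; set w := \prod_i _; have w0 : 0 <= w by exact: omegav_ge0.
apply: le_trans (_ : `|multv n f - multv k f| * (B * w) <= _).
  by rewrite ler_wpM2l//; exact: dG.
have -> : B * (w - multv n f * w + (w - multv k f * w)) =
  ((1 - multv n f) + (1 - multv k f)) * (B * w) by ring.
rewrite ler_wpM2r//.
  by apply: le_trans (dG (freqb f)).
have := multv_ge0 n f; have := multv_ge0 k f; have := multv_le1 f nM; have := multv_le1 f kM.
by move=> h1 h2 h3 h4; rewrite ler_norml; apply/andP; split; lra.
Qed.

(** A modulus of convergence that serves all dominated families at once. *)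
Lemma lattice_mean_modulus : exists2 err : nat -> R, err @ \oo --> (0 : R) &
  forall n k B G, 0 <= B -> dominated B G ->
    `|lattice_mean n G - lattice_mean k G| <= B * (err n + err k).
Proof.
have [S SM [Slim Sle]] := pair_mean_lim L1.
exists (fun n => S ^+ d - pair_mean L n ^+ d).
  rewrite -(subrr (S ^+ d)); apply: cvgB; first exact: cvg_cst.
  exact: (continuous_cvg _ (@exprn_continuous R d S) Slim).
move=> n k B G B0 dG.
apply: (le_trans (lattice_mean_cauchy (leq_maxl n k) (leq_maxr n k) dG)).
rewrite ler_wpM2l// -subr_ge0.
have : bsum L (maxn n k) ^+ d <= S ^+ d.
  by apply: lerXn2r; rewrite ?nnegrE ?bsum_ge0 ?SM// (le_trans (bsum_ge0 L1 0) (SM _)).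
by lra.
Qed.

(** The supremum of the lower bounds u n - e n; the errors e are kept, so that the
rate of convergence is the same for every sequence with these errors. *)
Lemma cauchy_limit (u e : nat -> R) :
  (forall n k, `|u n - u k| <= e n + e k) -> exists l, forall n, `|u n - l| <= e n.
Proof.
move=> H; pose S : set R := [set u n - e n | n in setT].
have ub k : ubound S (u k + e k).
  by move=> _ [n _ <-]; have := H n k; rewrite ler_norml => /andP[_]; lra.
exists (sup S) => n; rewrite ler_norml; apply/andP; split.
  have : sup S <= u n + e n; last by lra.
  by apply: ge_sup => //; exists (u 0%N - e 0%N); exists 0%N.
have : u n - e n <= sup S; last by lra.
by apply: ub_le_sup; [exists (u 0%N + e 0%N); exact: ub|exists n].
Qed.

End Averages.

(** * Sums of Fourier series *)

Section FourierSeries.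
Variables (R : realType) (d : nat).
Local Notation Rd := 'rV[R]_d.
Local Notation dir := (@dir R d).
Implicit Types (a b : Rd -> R) (B L : R).

Lemma euclid_ge0 (xi : Rd) : 0 <= euclid xi.
Proof. exact: sqrtr_ge0. Qed.

Lemma coord_le_euclid (xi : Rd) i : `|xi 0 i| <= euclid xi.
Proof.
rewrite /euclid -sqrtr_sqr ler_wsqrtr// /dotv (bigD1 i)//= -expr2 lerDl.
by apply: sumr_ge0 => j _; rewrite -expr2 sqr_ge0.
Qed.

Definition emax1 (xi : Rd) : R := Num.max 1 (euclid xi).

Lemma emax1_ge1 xi : 1 <= emax1 xi. Proof. by rewrite /emax1 le_max lexx. Qed.

Lemma euclid_le_emax1 xi : euclid xi <= emax1 xi.
Proof. by rewrite /emax1 le_max lexx orbT. Qed.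

Lemma emax1_gt0 xi : 0 < emax1 xi.
Proof. exact: lt_le_trans (emax1_ge1 xi). Qed.

(** Decay of order p + 2 d: 2 d orders pay for the summation over the lattice. *)
Definition decay (p : nat) B a := forall xi, `|a xi| * emax1 xi ^+ (p + (d + d)) <= B.

Lemma decay_ge0 p B a : decay p B a -> 0 <= B.
Proof. by move=> /(_ 0); apply: le_trans; rewrite mulr_ge0// exprn_ge0// ltW// emax1_gt0. Qed.

Lemma decayW p q B a : (q <= p)%N -> decay p B a -> decay q B a.
Proof.
move=> qp da xi; apply: le_trans (da xi); rewrite ler_wpM2l//.
by apply: ler_weXn2l; rewrite ?emax1_ge1// leq_add2r.
Qed.

Lemma decay_opp p B a : decay p B a -> decay p B (fun xi => - a xi).
Proof. by move=> da xi; rewrite normrN. Qed.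

Lemma decay_deriv p B a i : decay p.+1 B a ->
  decay p (2 * pi * B) (fun xi => 2 * pi * xi 0 i * a xi).
Proof.
move=> da xi; have pi2 : 0 <= 2 * pi :> R by rewrite mulr_ge0// pi_ge0.
rewrite -[2 * pi * _ * _]mulrA normrM (ger0_norm pi2) -[leLHS]mulrA.
rewrite ler_wpM2l// normrM.
apply: le_trans (da xi); rewrite addSn exprS -mulrA mulrCA ler_wpM2l// ler_wpM2r//.
  by rewrite exprn_ge0// ltW// emax1_gt0.
exact: le_trans (coord_le_euclid _ _) (euclid_le_emax1 _).
Qed.

Lemma emax1_omega (xi : Rd) : 1 <= emax1 xi ^+ (d + d) * \prod_i omega (xi 0 i).
Proof.
rewrite exprD -expr2 -[_ ^+ d](_ : \prod_(i < d) emax1 xi = _); last first.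
  by rewrite prodr_const card_ord.
rewrite -prodrXl -big_split/= -[leLHS](_ : \prod_(i < d) 1 = _); last by rewrite big1.
apply: ler_prod => i _; rewrite ler01/= /omega.
have m1 := emax1_ge1 xi; have le := le_trans (coord_le_euclid xi i) (euclid_le_emax1 xi).
rewrite mulrA ler_pdivlMr ?mul1r; last by rewrite exprn_gt0// ltr_pwDl.
have -> : emax1 xi ^+ 2 * 4 = (2 * emax1 xi) ^+ 2 by ring.
by rewrite !expr2 ler_pM ?addr_ge0//; lra.
Qed.

Lemma decay_dominated p B a xi : decay p B a ->
  `|a xi| * emax1 xi ^+ p <= B * \prod_i omega (xi 0 i).
Proof.
move=> da; have := da xi; rewrite exprD mulrA => h.
have w0 := omegav_ge0 xi.
apply: le_trans (ler_wpM2r w0 h); rewrite -[leRHS]mulrA ler_peMr ?emax1_omega//.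
by rewrite mulr_ge0// exprn_ge0// ltW// emax1_gt0.
Qed.

Lemma trig_lip (a b : R) (xi x y : Rd) : `|trig a b xi x - trig a b xi y| <=
  2 * pi * euclid xi * (`|a| + `|b|) * dist1 x y.
Proof.
apply: (deriv_lip (fun i x => trig_deriv a b xi i x)) => i z.
apply: (le_trans (trig_norm _ _ _ _)); rewrite normrN !normrM.
rewrite -[`|2| * _]normrM ger0_norm; last by rewrite mulr_ge0// pi_ge0.
rewrite -mulrDr [`|b| + _]addrC ler_wpM2r ?addr_ge0// ler_wpM2l ?coord_le_euclid//.
by rewrite mulr_ge0// pi_ge0.
Qed.

(** A quadratic remainder whose constant is controlled by two orders of decay. *)
Lemma trig_taylor (a b : R) (xi x : Rd) i (h : R) :
  `|trig a b xi (h *: dir i + x) - trig a b xi x -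
    h * trig (2 * pi * xi 0 i * b) (- (2 * pi * xi 0 i * a)) xi x| <=
  (2 * pi * euclid xi) ^+ 2 * (`|a| + `|b|) * h ^+ 2.
Proof.
have [t th ->] := MVT_line x h (fun y => trig_deriv a b xi i y).
have p0 : 0 <= 2 * pi :> R by rewrite mulr_ge0// pi_ge0.
have pe0 : 0 <= 2 * pi * euclid xi by rewrite mulr_ge0// euclid_ge0.
set q := 2 * pi * euclid xi in pe0 *.
have ds : dist1 (t *: dir i + x) x = `|t|.
  rewrite /dist1 (bigD1 i)//= line_coord eqxx mulr1 addrK big1 ?addr0// => j ji.
  by rewrite line_coord (negbTE ji) mulr0 add0r subrr normr0.
have coef (c : R) : `|2 * pi * xi 0 i * c| <= q * `|c|.
  rewrite normrM ler_wpM2r// normrM (ger0_norm p0) ler_wpM2l//.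
  exact: coord_le_euclid.
rewrite -mulrBr normrM.
apply: le_trans (_ : `|h| * (q * (q * `|b| + q * `|a|) * `|h|) <= _).
  rewrite ler_wpM2l//; apply: (le_trans (trig_lip _ _ _ _ _)).
  rewrite -/q ds; apply: ler_pM => //; first by rewrite mulr_ge0// addr_ge0.
  by rewrite ler_wpM2l// normrN lerD.
by rewrite -(real_normK (num_real h)) le_eqVlt; apply/orP; left; apply/eqP; ring.
Qed.

Section Limit.
Variable L : R.
Hypothesis L1 : 1 <= L.

Definition fejer_series n a b (x : Rd) : R := lattice_mean L n (fun xi => trig (a xi) (b xi) xi x).

Definition fourier_series a b (x : Rd) : R := limn (fun n => fejer_series n a b x).

Lemma lattice_mean_lin n (c : R) (G H : Rd -> R) :
  lattice_mean L n (fun xi => c * G xi + H xi) = c * lattice_mean L n G + lattice_mean L n H.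
Proof. by rewrite /lattice_mean big_split/= -mulr_sumr mulrDr mulrCA. Qed.

Lemma trig_dominated B a b x : decay 0 B a -> decay 0 B b ->
  dominated (2 * B) (fun xi => trig (a xi) (b xi) xi x).
Proof.
move=> da db xi; apply: (le_trans (trig_norm _ _ _ _)).
have := decay_dominated xi da; have := decay_dominated xi db.
by rewrite expr0 !mulr1; lra.
Qed.

(** One error sequence serves all points and all coefficients. *)
Lemma fourier_series_unif : exists2 err : nat -> R, err @ \oo --> (0 : R) &
  forall a b B, decay 0 B a -> decay 0 B b ->
    forall n x, `|fejer_series n a b x - fourier_series a b x| <= 2 * B * err n.
Proof.
have [err err0 H] := lattice_mean_modulus d L1; exists err => // a b B da db n x.
have B0 : 0 <= 2 * B by rewrite mulr_ge0// (decay_ge0 da).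
have [l Hl] : exists l, forall n, `|fejer_series n a b x - l| <= 2 * B * err n.
  apply: cauchy_limit => m k; rewrite -mulrDr; apply: H => //.
  exact: trig_dominated.
suff -> : fourier_series a b x = l by [].
apply: cvg_lim => //; apply/cvgrPdist_le => e e0.
have e2 : (fun n => 2 * B * err n) @ \oo --> (0 : R).
  by rewrite -(mulr0 (2 * B)); apply: cvgM => //; exact: cvg_cst.
move/cvgrPdist_le : e2 => /(_ e e0); apply: filterS => m /=.
rewrite sub0r normrN distrC => h; apply: (le_trans (Hl m)); apply: le_trans h.
exact: ler_norm.
Qed.

Lemma fejer_series_cvg a b B x : decay 0 B a -> decay 0 B b ->
  (fun n => fejer_series n a b x) @ \oo --> fourier_series a b x.
Proof.
move=> da db; have [err err0 H] := fourier_series_unif.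
apply/cvgrPdist_le => e e0.
have e2 : (fun n => 2 * B * err n) @ \oo --> (0 : R).
  by rewrite -(mulr0 (2 * B)); apply: cvgM => //; exact: cvg_cst.
move/cvgrPdist_le : e2 => /(_ e e0); apply: filterS => m /=.
rewrite sub0r normrN distrC => h; apply: (le_trans (H _ _ _ da db m x)).
by apply: le_trans h; exact: ler_norm.
Qed.

Lemma cvg_norm_le (u : nat -> R) (l C : R) : u @ \oo --> l ->
  (forall n, `|u n| <= C) -> `|l| <= C.
Proof.
move=> ul uC; apply/ler_addgt0Pr => e e0.
move/cvgrPdist_le : ul => /(_ e e0)[N _ HN]; have /= := HN N (leqnn N) => h.
have -> : l = u N + (l - u N) by rewrite addrCA subrr addr0.
by rewrite (le_trans (ler_normD _ _))// lerD.
Qed.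

Lemma lattice_mean_norm_le n B (G : Rd -> R) : 0 <= B -> dominated B G ->
  `|lattice_mean L n G| <= B * 12 ^+ d.
Proof.
move=> B0 dG; apply: (le_trans (lattice_mean_norm L1 n dG)); rewrite ler_wpM2l//.
by apply: lerXn2r; rewrite ?nnegrE ?pair_mean_ge0 ?pair_mean_le.
Qed.

Lemma fourier_series_bound a b B x : decay 0 B a -> decay 0 B b ->
  `|fourier_series a b x| <= 2 * B * 12 ^+ d.
Proof.
move=> da db; refine (cvg_norm_le (@fejer_series_cvg a b B x da db) _) => n.
apply: lattice_mean_norm_le; first by rewrite mulr_ge0// (decay_ge0 da).
exact: trig_dominated.
Qed.

Lemma fourier_series_lip a b B x y : decay 1 B a -> decay 1 B b ->
  `|fourier_series a b x - fourier_series a b y| <= 2 * pi * (2 * B) * 12 ^+ d * dist1 x y.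
Proof.
move=> da db; have da0 := decayW (leq0n 1) da; have db0 := decayW (leq0n 1) db.
refine (cvg_norm_le (cvgB (fejer_series_cvg (x := x) da0 db0) (fejer_series_cvg (x := y) da0 db0)) _) => n.
rewrite -[leLHS]/(`|fejer_series n a b x - fejer_series n a b y|).
have -> : fejer_series n a b x - fejer_series n a b y =
    lattice_mean L n (fun xi => -1 * trig (a xi) (b xi) xi y + trig (a xi) (b xi) xi x).
  by rewrite lattice_mean_lin mulN1r addrC.
have B0 := decay_ge0 da; have p0 : 0 <= 2 * pi :> R by rewrite mulr_ge0// pi_ge0.
rewrite [leRHS]mulrAC.
apply: lattice_mean_norm_le; first by rewrite !mulr_ge0 ?dist1_ge0 ?pi_ge0.
move=> xi; rewrite mulN1r addrC; apply: (le_trans (trig_lip _ _ _ _ _)).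
rewrite [leRHS]mulrAC ler_wpM2r ?dist1_ge0// -!mulrA ler_wpM2l// ler_wpM2l ?pi_ge0//.
have := decay_dominated xi da; have := decay_dominated xi db; rewrite expr1 => h1 h2.
apply: le_trans (_ : emax1 xi * (`|a xi| + `|b xi|) <= _).
  by rewrite ler_wpM2r ?addr_ge0// euclid_le_emax1.
by rewrite [leLHS]mulrC mulrDl; lra.
Qed.

(** The quadratic remainders of the terms add up, with two orders of decay to
spare, and the bound passes to the limit. *)
Lemma fourier_series_deriv a b B i x : decay 2 B a -> decay 2 B b ->
  is_derive x (dir i) (fourier_series a b)
    (fourier_series (fun xi => 2 * pi * xi 0 i * b xi) (fun xi => - (2 * pi * xi 0 i * a xi)) x).
Proof.
move=> da db; have da0 := decayW (leq0n 2) da; have db0 := decayW (leq0n 2) db.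
have B0 := decay_ge0 da; have p0 : 0 <= 2 * pi :> R by rewrite mulr_ge0// pi_ge0.
set a' := fun xi : Rd => 2 * pi * xi 0 i * b xi.
set b' := fun xi : Rd => - (2 * pi * xi 0 i * a xi).
have da' : decay 0 (2 * pi * B) a' by apply: decay_deriv; exact: decayW db.
have db' : decay 0 (2 * pi * B) b' by apply: decay_opp; apply: decay_deriv; exact: decayW da.
apply: (@is_derive_quad _ _ _ _ _ _ ((2 * pi) ^+ 2 * (2 * B) * 12 ^+ d)) => h.
have c2 : (fun n => fejer_series n a b (h *: dir i + x) - fejer_series n a b x -
    h * fejer_series n a' b' x)
    @ \oo --> fourier_series a b (h *: dir i + x) - fourier_series a b x - h * fourier_series a' b' x.
  apply: cvgB; first by apply: cvgB; [exact: fejer_series_cvg da0 db0|exact: fejer_series_cvg da0 db0].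
  by apply: cvgM; [exact: cvg_cst|exact: fejer_series_cvg da' db'].
refine (cvg_norm_le c2 _) => n.
rewrite -[leLHS]/(`|fejer_series n a b (h *: dir i + x) - fejer_series n a b x -
  h * fejer_series n a' b' x|).
have -> : fejer_series n a b (h *: dir i + x) - fejer_series n a b x - h * fejer_series n a' b' x =
    lattice_mean L n (fun xi => - h * trig (a' xi) (b' xi) xi x +
      (-1 * trig (a xi) (b xi) xi x + trig (a xi) (b xi) xi (h *: dir i + x))).
  by rewrite !lattice_mean_lin mulN1r mulNr; rewrite /fejer_series; ring.
rewrite [leRHS]mulrAC.
apply: lattice_mean_norm_le; first by rewrite mulr_ge0 ?sqr_ge0// mulr_ge0 ?sqr_ge0// mulr_ge0.
move=> xi; have := trig_taylor (a xi) (b xi) xi x i h.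
rewrite mulN1r mulNr addrC [- _ + trig _ _ _ _]addrC => H; apply: (le_trans H).
rewrite [leRHS]mulrAC ler_wpM2r ?sqr_ge0// exprMn -[leLHS]mulrA -[leRHS]mulrA.
rewrite ler_wpM2l ?sqr_ge0//.
have := decay_dominated xi da; have := decay_dominated xi db => h1 h2.
apply: le_trans (_ : emax1 xi ^+ 2 * (`|a xi| + `|b xi|) <= _).
  rewrite ler_wpM2r ?addr_ge0//; apply: lerXn2r; rewrite ?nnegrE ?euclid_ge0 ?euclid_le_emax1//.
  by rewrite ltW// emax1_gt0.
by rewrite [leLHS]mulrC mulrDl; lra.
Qed.

(** Each differentiation costs one order of decay, and one more makes the last
derivatives Lipschitz, hence continuous. *)
Lemma fourier_series_Cn n a b B : decay n.+1 B a -> decay n.+1 B b -> Cn n (fourier_series a b).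
Proof.
have cont a' b' B' : decay 1 B' a' -> decay 1 B' b' -> continuous (fourier_series a' b').
  move=> da db x; apply/(@cvgrPdist_le _ _ _ _ (nbhs_filter (x : Rd))) => e e0.
  have lip y := fourier_series_lip x y da db; move: lip; set C := 2 * pi * (2 * B') * 12 ^+ d => lip.
  have C0 : 0 <= C.
    by rewrite !mulr_ge0 ?exprn_ge0 ?pi_ge0// (decay_ge0 da).
  clearbody C; have q0 : 0 < e / (C * d%:R + 1) by rewrite divr_gt0// ltr_wpDl// mulr_ge0.
  suff H (y : Rd) : (forall i, `|y 0 i - x 0 i| <= e / (C * d%:R + 1)) ->
      `|fourier_series a' b' x - fourier_series a' b' y| <= e.
    exact: (@filterS _ _ (nbhs_filter (x : Rd)) _ _ H (nbhs_cball x q0)).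
  move=> xy; apply: (le_trans (lip y)).
  apply: le_trans (_ : C * (d%:R * (e / (C * d%:R + 1))) <= _).
    rewrite ler_wpM2l// /dist1 mulr_natl -[X in _ *+ X](card_ord d) -sumr_const.
    by apply: ler_sum => i _; rewrite distrC.
  rewrite mulrA mulrA ler_pdivrMr; last by rewrite ltr_wpDl// mulr_ge0.
  by rewrite mulrA [leLHS]mulrC ler_pM2l// lerDl.
elim: n a b B => [|n IH] a b B da db; first by split=> //; exact: cont da db.
split; first by apply: (cont _ _ B); [exact: decayW da|exact: decayW db].
exists (fun i => fourier_series (fun xi => 2 * pi * xi 0 i * b xi)
  (fun xi => - (2 * pi * xi 0 i * a xi))).
split=> [i x|i].
  by apply: (@fourier_series_deriv _ _ B); [exact: decayW da|exact: decayW db].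
by apply: (IH _ _ (2 * pi * B)); [|apply: decay_opp]; exact: decay_deriv.
Qed.

(** Each derivative costs one order of decay and a factor 2 pi. *)
Lemma fourier_series_partials s a b B x : decay (size s).+1 B a -> decay (size s).+1 B b ->
  `|partials s (fourier_series a b) x| <= 2 * ((2 * pi) ^+ size s * B) * 12 ^+ d.
Proof.
elim/last_ind: s a b B => [|s i IH] a b B.
  move=> da db; rewrite expr0 mul1r.
  by apply: fourier_series_bound; [exact: decayW da|exact: decayW db].
rewrite size_rcons partials_rcons => da db.
rewrite (derive_fun (fun y => @fourier_series_deriv a b B i y (decayW _ da) (decayW _ db)))//.
have -> : (2 * pi) ^+ (size s).+1 * B = (2 * pi) ^+ size s * (2 * pi * B).
  by rewrite exprSr -mulrA.
by apply: IH; [|apply: decay_opp]; exact: decay_deriv.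
Qed.

End Limit.

End FourierSeries.

(** * The density of a distribution in a box *)

Section Density.
Variables (R : realType) (d : nat).
Local Notation Rd := 'rV[R]_d.
Implicit Types (F : Rd -> R) (phi psi chi : Rd -> R[i]) (L : R) (U : set Rd)
  (T : (Rd -> R[i]) -> R[i]).

Lemma eventually_all (Q : seq 'I_d -> nat -> Prop) m :
  (forall s, exists n0, forall n, (n0 <= n)%N -> Q s n) ->
  exists n0, forall n, (n0 <= n)%N -> forall s, (size s <= m)%N -> Q s n.
Proof.
move=> /choice[N HN]; exists (\max_(s : m.-bseq 'I_d) N s) => n nN s sm.
apply: HN; apply: leq_trans nN.
by have := @leq_bigmax _ (fun s : m.-bseq 'I_d => N s) (Bseq sm).
Qed.

Lemma kernel_smooth (xi : Rd) : smooth setT (fourier_kernel xi).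
Proof.
apply/smoothTP; split=> n.
  rewrite (_ : (fun x => _) = trig 1 0 xi); first exact: trig_smooth.
  by apply/funext => x; rewrite /trig /= mul1r mul0r addr0.
rewrite (_ : (fun x => _) = trig 0 (-1) xi); first exact: trig_smooth.
by apply/funext => x; rewrite /trig /= mul0r add0r mulN1r.
Qed.

(** The imaginary part of the complex form of the means: the sine terms of opposite
frequencies cancel. *)
Lemma fmean_sin n L F x : 0 < L -> (0 < n)%N -> bl F ->
  \sum_(g : {ffun 'I_d -> 'I_n * 'I_n})
    trig (fsin L F (freq L g)) (- fcos L F (freq L g)) (freq L g) x = 0.
Proof.
move=> L0 n0 blF; have L2 : 0 < L / 2 by rewrite divr_gt0.
have bc (xi : Rd) : bl (fun y => F y * cos (2 * pi * dotv y xi)).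
  by apply: bl_mul => //; exact: cos_bl.
have bs (xi : Rd) : bl (fun y => F y * sin (2 * pi * dotv y xi)).
  by apply: bl_mul => //; exact: sin_bl.
pose G (g : {ffun 'I_d -> 'I_n * 'I_n}) (y : Rd) :=
  cos (2 * pi * dotv x (freq L g)) * (F y * sin (2 * pi * dotv y (freq L g))) +
  - sin (2 * pi * dotv x (freq L g)) * (F y * cos (2 * pi * dotv y (freq L g))).
have bG g : bl (G g) by exact: (bl_add (bl_scale _ (bs _)) (bl_scale _ (bc _))).
transitivity (\sum_g boxint (L / 2) (G g)).
  apply: eq_bigr => g _.
  rewrite (boxintD L2 (bl_scale _ (bs _)) (bl_scale _ (bc _))).
  rewrite (boxintZ L2 _ (bc _)) (boxintZ L2 _ (bs _)) /trig mulrC; congr (_ + _).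
  by rewrite mulrC mulrN mulNr.
rewrite -boxint_sum// (_ : (fun y => _) = fun=> 0); first exact: boxint0.
apply/funext => y; transitivity (F y *
  \sum_(g : {ffun 'I_d -> 'I_n * 'I_n}) sin (2 * pi * dotv (y - x) (freq L g))).
  rewrite mulr_sumr.
  by apply: eq_bigr => g _; rewrite /G dotvBl mulrBr sinB; ring.
by rewrite sum_sin_kern// mulr0.
Qed.

Lemma fmean_complex n L F x : 0 < L -> bl F -> (fmean n.+1 L F x)%:C =
  \sum_(g : {ffun 'I_d -> 'I_n.+1 * 'I_n.+1})
    (((L ^+ d)^-1 * (n.+1%:R ^+ d)^-1)%:C *
      (fcos L F (freq L g) +i* fsin L F (freq L g))) * fourier_kernel (freq L g) x.
Proof.
move=> L0 blF; under eq_bigr do rewrite -mulrA.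
rewrite -mulr_sumr; apply/eqP; rewrite eq_complex; apply/andP; split; apply/eqP.
  rewrite ReM Re_sum/= mul0r subr0 fmeanE//; congr (_ * _).
  by apply: eq_bigr => g _; rewrite /trig; ring.
rewrite ImM Im_sum/= mul0r addr0.
have := @fmean_sin n.+1 L F x L0 isT blF; set S := (X in X = 0) => S0.
rewrite [X in _ * X](_ : _ = S); first by rewrite S0 mulr0.
by apply: eq_bigr => g _; rewrite /trig; ring.
Qed.

Section OneDistribution.
Variables (U : set Rd) (T : (Rd -> R[i]) -> R[i]) (chi : Rd -> R[i]) (L B : R).
Hypothesis TD : schwartz_distribution U T.
Hypothesis chiT : is_cutoff U T chi.
Hypothesis pairT : forall phi, pairing U T phi = T (fun x => chi x * phi x).
Hypothesis L1 : 1 <= L.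
Hypothesis chiL : forall x, fsupp chi x -> inbox (L / 4) x.

Definition fourier_re xi := complex.Re (fourier U T xi).
Definition fourier_im xi := complex.Im (fourier U T xi).

Hypothesis reD : decay 1 B fourier_re.
Hypothesis imD : decay 1 B fourier_im.

(** The sum of the series with complex coefficients f = fourier_re + i fourier_im
at x: as f exp(2 pi i x.xi) has real part Re f cos - Im f sin and imaginary part
Im f cos + Re f sin, both parts are real trigonometric series. *)
Definition box_density (x : Rd) : R[i] :=
  fourier_series L fourier_re (fun xi => - fourier_im xi) x +i* fourier_series L fourier_im fourier_re x.

Let L0 : 0 < L := L_gt0 L1.
Let L2 : 0 < L / 2. Proof. by rewrite divr_gt0. Qed.
Let tchi : test_fun U chi. Proof. by case: chiT. Qed.

(** All derivatives up to the order of T converge uniformly on the support of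
chi. *)
Lemma fmean_dist (F : Rd -> R) : smoothR F -> small_supp L F -> forall e : R, 0 < e ->
  exists n0, forall n, (n0 <= n)%N ->
    Normc.normc (T (fun x => chi x * (fmean n.+1 L F x)%:C) -
                 T (fun x => chi x * (F x)%:C)) <= e.
Proof.
move=> sF kF e e0; have blF := small_supp_bl sF kF.
have [m [C C0 HC]] := dist_continuity TD tchi.
have q0 : 0 < e / (C + 1) by rewrite divr_gt0// ltr_wpDl.
have [n0 Hn0] : exists n0, forall n, (n0 <= n)%N -> forall s, (size s <= m)%N ->
    forall x, inbox (L / 4) x ->
      `|fmean n.+1 L (partials s F) x - partials s F x| <= e / (C + 1).
  apply: (@eventually_all (fun s n => forall x, inbox (L / 4) x ->
    `|fmean n.+1 L (partials s F) x - partials s F x| <= e / (C + 1))) => s.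
  have [_ sF' kF'] := fmean_partials s L0 (ltn0Sn 0) sF kF.
  have [n0 H] := korovkin L0 (small_supp_bl sF' kF') q0.
  by exists n0 => n nn0; apply: H => //; exact: leqW.
exists n0 => n nn0.
have sM : smoothR (fmean n.+1 L F) by exact: fmean_smooth.
have sN : smoothR (fun x => -1 * F x) by move=> k; exact: Cn_scale.
have -> : T (fun x => chi x * (fmean n.+1 L F x)%:C) - T (fun x => chi x * (F x)%:C) =
    T (fun x => chi x * (fmean n.+1 L F x + -1 * F x)%:C).
  have := dist_lin TD (-1) (test_fun_mulr tchi (smooth_real sF))
                           (test_fun_mulr tchi (smooth_real sM)).
  rewrite mulN1r addrC => <-; congr T; apply/funext => x.
  by rewrite [-1 * F x]mulN1r rmorphB; ring.
apply: le_trans (HC _ (e / (C + 1)) _ (ltW q0) _) _.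
- by move=> k; exact: Cn_add.
- move=> s x sm /chiL xL.
  have [E sF' kF'] := fmean_partials s L0 (ltn0Sn n) sF kF.
  rewrite partials_add// E.
  have -> : partials s (fun x => -1 * F x) = fun x => -1 * partials s F x.
    elim: (s) => [//|i s' IH] /=; apply: derive_fun => y; rewrite IH.
    have [_ sF2 _] := fmean_partials s' L0 (ltn0Sn n) sF kF.
    by apply: is_deriveZ; exact: smoothR_is_derive.
  by rewrite mulN1r; exact: Hn0.
by rewrite mulrA ler_pdivrMr ?ltr_wpDl// mulrC ler_pM2l// lerDl.
Qed.

(** The Fejer mean is a finite combination of exponentials, whose images under
psi |-> T (chi psi) are the values of the transform; the resulting finite sum is
the integral of F against a Fejer mean of the series. *)
Lemma dist_fmean n (F : Rd -> R) : bl F ->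
  T (fun x => chi x * (fmean n.+1 L F x)%:C) =
  boxint (L / 2) (fun y => F y * fejer_series L n fourier_re (fun xi => - fourier_im xi) y) +i*
  boxint (L / 2) (fun y => F y * fejer_series L n fourier_im fourier_re y).
Proof.
move=> blF.
set c := (L ^+ d)^-1 * (n.+1%:R ^+ d)^-1.
have -> : (fun x => chi x * (fmean n.+1 L F x)%:C) = fun x =>
  \sum_(g : {ffun 'I_d -> 'I_n.+1 * 'I_n.+1})
    (c%:C * (fcos L F (freq L g) +i* fsin L F (freq L g))) *
    (chi x * fourier_kernel (freq L g) x).
  by apply/funext => x; rewrite fmean_complex// mulr_sumr; apply: eq_bigr => g _; rewrite mulrCA.
have [_ ->] := dist_sum TD (index_enum _)
  (fun g : {ffun 'I_d -> 'I_n.+1 * 'I_n.+1} =>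
     c%:C * (fcos L F (freq L g) +i* fsin L F (freq L g)))
  (fun g => test_fun_mulr tchi (kernel_smooth (freq L g))).
have bc (xi : Rd) : bl (fun y => F y * cos (2 * pi * dotv y xi)).
  by apply: bl_mul => //; exact: cos_bl.
have bs (xi : Rd) : bl (fun y => F y * sin (2 * pi * dotv y xi)).
  by apply: bl_mul => //; exact: sin_bl.
have S (a b : Rd -> R) : boxint (L / 2) (fun y => F y * fejer_series L n a b y) =
    c * \sum_(g : {ffun 'I_d -> 'I_n.+1 * 'I_n.+1})
       (a (freq L g) * fcos L F (freq L g) + b (freq L g) * fsin L F (freq L g)).
  pose G (g : {ffun 'I_d -> 'I_n.+1 * 'I_n.+1}) (y : Rd) :=
    a (freq L g) * (F y * cos (2 * pi * dotv y (freq L g))) +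
    b (freq L g) * (F y * sin (2 * pi * dotv y (freq L g))).
  have bG g : bl (G g) by exact: (bl_add (bl_scale _ (bc _)) (bl_scale _ (bs _))).
  have -> : (fun y => F y * fejer_series L n a b y) = fun y => c * \sum_g G g y.
    apply/funext => y; rewrite /fejer_series /lattice_mean mulrCA; congr (_ * _); rewrite mulr_sumr.
    by apply: eq_bigr => g _; rewrite /trig /G; ring.
  rewrite boxintZ//; last exact: bl_sum.
  congr (_ * _); rewrite boxint_sum//; apply: eq_bigr => g _.
  rewrite (boxintD L2 (bl_scale _ (bc _)) (bl_scale _ (bs _))).
  by rewrite (boxintZ L2 _ (bc _)) (boxintZ L2 _ (bs _)).
have E g : T (fun x => chi x * fourier_kernel (freq (n := n.+1) L g) x) =
    fourier_re (freq L g) +i* fourier_im (freq L g).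
  by rewrite -pairT -/(fourier U T _) /fourier_re /fourier_im; case: fourier.
apply/eqP; rewrite eq_complex/= Re_sum Im_sum !S; apply/andP; split; apply/eqP.
  rewrite mulr_sumr; apply: eq_bigr => g _; rewrite E /= /fourier_re /fourier_im; ring.
rewrite mulr_sumr; apply: eq_bigr => g _; rewrite E /= /fourier_re /fourier_im; ring.
Qed.

Lemma fourier_series_bl a b : decay 1 B a -> decay 1 B b -> bl (fourier_series L a b : Rd -> R).
Proof.
move=> da db; have B0 := decay_ge0 da.
have p0 : 0 <= 2 * pi :> R by rewrite mulr_ge0// pi_ge0.
exists (2 * B * 12 ^+ d + 2 * pi * (2 * B) * 12 ^+ d); split=> [|x|x y].
- by rewrite addr_ge0// !mulr_ge0 ?exprn_ge0 ?pi_ge0.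
- apply: le_trans (fourier_series_bound L1 x (decayW (leq0n 1) da) (decayW (leq0n 1) db)) _.
  by rewrite lerDl !mulr_ge0 ?exprn_ge0 ?pi_ge0.
- apply: (le_trans (fourier_series_lip L1 x y da db)); rewrite ler_wpM2r ?dist1_ge0//.
  by rewrite lerDr !mulr_ge0 ?exprn_ge0.
Qed.

Lemma boxint_fejer_series_lim (F a b : Rd -> R) : bl F -> decay 1 B a -> decay 1 B b ->
  forall e : R, 0 < e -> exists n0, forall n, (n0 <= n)%N ->
  `|boxint (L / 2) (fun y => F y * fejer_series L n a b y) -
    boxint (L / 2) (fun y => F y * fourier_series L a b y)| <= e.
Proof.
move=> blF da db e e0; have [C [C0 Cb _]] := blF.
have B0 := decay_ge0 da.
have [err err0 Herr] := fourier_series_unif d L1.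
set K := L ^+ d * (C * (2 * B)).
have K0 : 0 <= K by rewrite mulr_ge0 ?exprn_ge0 ?(ltW L0)// mulr_ge0// mulr_ge0.
have q0 : 0 < e / (K + 1) by rewrite divr_gt0// ltr_wpDl.
move/cvgrPdist_le : err0 => /(_ _ q0)[n0 _ Hn0]; exists n0 => n nn0.
have := Hn0 n nn0; rewrite /= sub0r normrN => en.
have bf : bl (fejer_series L n a b).
  rewrite /fejer_series /lattice_mean; apply: bl_scale; apply: bl_sum => g; exact: trig_bl.
have bl1 : bl (fun y => F y * fejer_series L n a b y) by exact: bl_mul.
have bl2 : bl (fun y => F y * fourier_series L a b y) by apply: bl_mul => //; exact: fourier_series_bl.
rewrite -boxintB//.
apply: le_trans (boxint_norm L2 (M := C * (2 * B * (e / (K + 1)))) (bl_sub bl1 bl2) _) _.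
  move=> y _; rewrite -mulrBr normrM ler_pM//.
  apply: (le_trans (Herr _ _ _ (decayW (leq0n 1) da) (decayW (leq0n 1) db) n y)).
  by rewrite ler_wpM2l ?mulr_ge0// (le_trans (ler_norm _)).
have -> : (2 * (L / 2)) ^+ d * (C * (2 * B * (e / (K + 1)))) = K * e / (K + 1).
  by rewrite [2 * (L / 2)]mulrC divfK// /K; ring.
by rewrite ler_pdivrMr ?ltr_wpDl// mulrC ler_pM2l// lerDl.
Qed.

Lemma normc_Re_le (z : R[i]) : `|complex.Re z| <= Normc.normc z.
Proof.
by case: z => x y /=; rewrite -sqrtr_sqr ler_wsqrtr// lerDl sqr_ge0.
Qed.

Lemma normc_Im_le (z : R[i]) : `|complex.Im z| <= Normc.normc z.
Proof.
by case: z => x y /=; rewrite -sqrtr_sqr ler_wsqrtr// lerDr sqr_ge0.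
Qed.

Lemma eq_of_le_eps (x y : R) : (forall e, 0 < e -> `|x - y| <= e) -> x = y.
Proof.
move=> H; apply/eqP; rewrite -subr_eq0 -normr_le0; apply/ler_addgt0Pr => e e0.
by rewrite add0r; exact: H.
Qed.

(** Both sides of [dist_fmean] converge, by [fmean_dist] and
[boxint_fejer_series_lim]. *)
Lemma dist_real (F : Rd -> R) :
  smoothR F -> small_supp L F -> test_fun U (fun x => (F x)%:C) ->
  T (fun x => (F x)%:C) =
  boxint (L / 2) (fun y => F y * fourier_series L fourier_re (fun xi => - fourier_im xi) y) +i*
  boxint (L / 2) (fun y => F y * fourier_series L fourier_im fourier_re y).
Proof.
move=> sF kF tF; have blF := small_supp_bl sF kF.
rewrite -(dist_cutoff TD chiT tF).
have imND := decay_opp imD.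
have near (e : R) : 0 < e -> forall p : R[i] -> R,
    (forall z w, p (z - w) = p z - p w) -> (forall z, `|p z| <= Normc.normc z) ->
    forall a b, decay 1 B a -> decay 1 B b ->
    (forall n, p (T (fun x => chi x * (fmean n.+1 L F x)%:C)) =
       boxint (L / 2) (fun y => F y * fejer_series L n a b y)) ->
    `|p (T (fun x => chi x * (F x)%:C)) -
      boxint (L / 2) (fun y => F y * fourier_series L a b y)| <= e.
  move=> e0 p pB pn a b da db pT; have e2 : 0 < e / 2 by rewrite divr_gt0.
  have [n1 H1] := fmean_dist sF kF e2.
  have [n2 H2] := boxint_fejer_series_lim blF da db e2.
  have := le_trans (pn _) (H1 _ (leq_maxl n1 n2)).
  have := H2 _ (leq_maxr n1 n2).
  rewrite pB pT; set s := boxint _ (fun y => F y * fejer_series L _ a b y).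
  set t := boxint _ (fun y => F y * fourier_series L a b y); set u := p _ => h1 h2.
  have -> : u - t = (s - t) - (s - u) by ring.
  by apply: (le_trans (ler_normB _ _)); lra.
apply/eqP; rewrite eq_complex/=; apply/andP; split; apply/eqP; apply: eq_of_le_eps => e e0.
  apply: near => //.
  - by move=> [? ?] [? ?].
  - exact: normc_Re_le.
  - by move=> n; rewrite dist_fmean.
apply: near => //.
- by move=> [? ?] [? ?].
- exact: normc_Im_le.
- by move=> n; rewrite dist_fmean.
Qed.

(** [dist_real] for the real and the imaginary part of psi. *)
Lemma dist_box_density psi : test_fun U psi -> (forall x, fsupp psi x -> inbox (L / 4) x) ->
  T psi = integralC (fun x => box_density x * psi x).
Proof.
move=> tpsi psiL; have [/smoothTP[sr si] cK KU] := tpsi.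
pose pr x := complex.Re (psi x); pose pm x := complex.Im (psi x).
have L42 : L / 4 < L / 2 by have := L0; lra.
have small (p : Rd -> R) : (forall x, ~ fsupp psi x -> p x = 0) -> small_supp L p.
  by move=> p0; exists (fsupp psi) => //; split=> // y /psiL yL i; exact: le_lt_trans (yL i) L42.
have kr : small_supp L pr by apply: small => x /fsuppP; rewrite /pr => ->.
have km : small_supp L pm by apply: small => x /fsuppP; rewrite /pm => ->.
have test (p : Rd -> R) : smoothR p -> (forall x, p x != 0 -> psi x != 0) ->
    test_fun U (fun x => (p x)%:C).
  move=> sp pp.
  have sub : fsupp (fun x => (p x)%:C) `<=` fsupp psi.
    apply: closure_subset => x /= px; apply: pp; apply: contraNN px => /eqP ->; exact: eqxx.
  split; first exact: smooth_real.
    exact: (subclosed_compact (@closed_fsupp _ _ _) cK sub).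
  exact: (subset_trans sub).
have tr : test_fun U (fun x => (pr x)%:C).
  by apply: test => // x; apply: contraNN => /eqP; rewrite /pr => ->.
have tm : test_fun U (fun x => (pm x)%:C).
  by apply: test => // x; apply: contraNN => /eqP; rewrite /pm => ->.
have -> : psi = fun x => ('i%C * (pm x)%:C) + (pr x)%:C.
  by apply/funext => x; rewrite /pm /pr addrC -complexE.
rewrite (dist_lin TD _ tm tr) !dist_real//.
have imND := decay_opp imD.
have b1 := fourier_series_bl reD imND; have b2 := fourier_series_bl imD reD.
have br := small_supp_bl sr kr; have bm := small_supp_bl si km.
have psi0 x : ~ inbox (L / 2) x -> pr x = 0 /\ pm x = 0.
  move=> nx; have : ~ fsupp psi x.
    by move=> /psiL xL; apply: nx => i; apply: ltW; exact: le_lt_trans (xL i) L42.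
  by move=> /fsuppP; rewrite /pr /pm => ->.
apply/eqP; rewrite eq_complex ReD ImD ReM ImM /=; apply/andP; split; apply/eqP.
  rewrite (@integralRd_boxint _ (L / 2)); last first.
    by move=> x /psi0[h1 h2]; rewrite h1 h2 !(mulr0, mul0r) !(oppr0, addr0) !mulr0 subr0.
  rewrite mul0r sub0r mul1r addrC -boxintB//; try exact: bl_mul.
  by congr boxint; apply/funext => x /=; ring.
rewrite (@integralRd_boxint _ (L / 2)); last first.
  by move=> x /psi0[h1 h2]; rewrite h1 h2 !(mulr0, mul0r) !(oppr0, addr0) !mulr0 addr0.
rewrite mul0r add0r mul1r -boxintD//; try exact: bl_mul.
by congr boxint; apply/funext => x /=; ring.
Qed.

End OneDistribution.
End Density.

(** * Growth of the bounds *)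

Section Numeric.
Variable R : realType.

Lemma fact_le_expn N : (N`! <= N ^ N)%N.
Proof.
elim: N => [//|N IH]; rewrite factS expnS leq_mul2l /=.
by rewrite (leq_trans IH)//; case: N {IH} => // N; rewrite leq_exp2r.
Qed.

Lemma powR_exp (a x : R) : 0 < a -> a `^ x = expR (x * ln a).
Proof. by move=> a0; rewrite /powR gt_eqF. Qed.

Lemma expR_le_lin (y z : R) : 0 <= y -> y <= z -> expR y <= 1 + y * expR z.
Proof.
move=> y0 yz; apply: le_trans (_ : 1 + y * expR y <= _); last first.
  by rewrite lerD2l ler_wpM2l// ler_expR.
have h : (1 - y) * expR y <= 1.
  by have := ler_wpM2r (expR_ge0 y) (expR_ge1Dx (- y)); rewrite -expRD addNr expR0.
by move: h; rewrite mulrBl mul1r; lra.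
Qed.

(** With N of size (p + c)^sigma, N exceeds p^sigma only by a multiple of
p^sigma / p: this is what makes N log N = sigma p^sigma log p + O(p^sigma). *)
Lemma order_choice (sigma : R) (c : nat) : 1 < sigma ->
  exists (Nf : nat -> nat) (k : R), [/\ 0 <= k,
    forall p, (p + c)%:R <= (Nf p)%:R `^ sigma^-1 &
    forall p, (0 < p)%N ->
      (Nf p)%:R <= p%:R `^ sigma + k * (p%:R `^ sigma / p%:R)].
Proof.
move=> s1; have s0 : 0 < sigma := lt_trans ltr01 s1.
exists (fun p => (Num.truncn ((p + c)%:R `^ sigma)).+1).
set y := sigma * c%:R; exists (y * expR y + 1).
have y0 : 0 <= y by rewrite mulr_ge0// ltW.
split.
- by rewrite addr_ge0// mulr_ge0// expR_ge0.
- move=> p; have q0 : 0 <= (p + c)%:R :> R by [].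
  have /andP[_ /ltW h] := truncn_itv (powR_ge0 (p + c)%:R sigma).
  have := ge0_ler_powR (_ : 0 <= sigma^-1) (powR_ge0 (p + c)%:R sigma) (ler0n R _) h.
  rewrite invr_ge0 (ltW s0) => /(_ isT); rewrite -powRrM mulfV ?gt_eqF// powRr1//.
- move=> p p0; have pR : 0 < p%:R :> R by rewrite ltr0n.
  have p1 : 1 <= p%:R :> R by rewrite ler1n.
  set P := p%:R `^ sigma.
  have P0 : 0 < P by rewrite powR_gt0.
  have pP : 1 <= P / p%:R.
    by rewrite ler_pdivlMr// mul1r /P le1r_powR// ltW.
  have /andP[h _] := truncn_itv (powR_ge0 (p + c)%:R sigma).
  rewrite -natr1; apply: le_trans (lerD h pP) _.
  rewrite mulrDl mul1r addrA lerD2r.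
  have -> : (p + c)%:R = p%:R * (1 + c%:R / p%:R) :> R.
    by rewrite natrD mulrDr mulr1 mulrC divfK// gt_eqF.
  have cp : 0 <= c%:R / p%:R :> R by rewrite divr_ge0.
  rewrite powRM ?addr_ge0// -/P.
  have E : (1 + c%:R / p%:R) `^ sigma <= 1 + (y / p%:R) * expR y.
    rewrite powR_exp ?ltr_pwDl//.
    apply: le_trans (_ : expR (y / p%:R) <= _).
      rewrite ler_expR /y -mulrA ler_wpM2l ?(ltW s0)//.
      by apply: le_ln1Dx; rewrite (lt_le_trans _ cp).
    apply: expR_le_lin; first by rewrite divr_ge0.
    by rewrite ler_pdivrMr// ler_peMr.
  apply: le_trans (ler_wpM2l (ltW P0) E) _.
  by rewrite mulrDr mulr1 lerD2l le_eqVlt; apply/orP; left; apply/eqP; ring.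
Qed.

(** N! <= N^N, and log N <= sigma log p + O(1). *)
Lemma gevrey_growth (tau sigma h : R) (c : nat) : 0 < tau -> 1 < sigma -> 0 < h ->
  exists (Nf : nat -> nat) (k : R), [/\ 0 <= k,
    forall p, (p + c)%:R <= (Nf p)%:R `^ sigma^-1 &
    forall p, (0 < p)%N -> h ^+ Nf p * ((Nf p)`!)%:R `^ (tau / sigma) <=
      expR (k * p%:R `^ sigma) * p%:R `^ (tau * p%:R `^ sigma)].
Proof.
move=> t0 s1 h0; have s0 : 0 < sigma := lt_trans ltr01 s1.
have [Nf [k [k0 HN HNb]]] := order_choice c s1.
set k2 := tau / sigma * ((1 + k) * k + sigma * k).
have ts0 : 0 <= tau / sigma by rewrite divr_ge0 ?(ltW t0) ?(ltW s0).
have k20 : 0 <= k2 by rewrite mulr_ge0// addr_ge0// mulr_ge0// ?addr_ge0// ltW.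
exists Nf, (k2 + (1 + k) * `|ln h|); split=> //.
  by rewrite addr_ge0// mulr_ge0// addr_ge0.
move=> p p0; have pR : 0 < p%:R :> R by rewrite ltr0n.
have p1 : 1 <= p%:R :> R by rewrite ler1n.
have NP := HNb p p0; set N := Nf p in NP *.
set P := p%:R `^ sigma in NP *.
have P0 : 0 < P by rewrite powR_gt0.
set l := ln (p%:R : R); have l0 : 0 <= l by rewrite ln_ge0.
have lp : l <= p%:R by rewrite ltW// ln_sublinear.
set Q := P / p%:R in NP.
have Q0 : 0 <= Q by rewrite divr_ge0// ltW.
have QP : Q <= P by rewrite ler_pdivrMr// ler_peMr// ltW.
have Ql : Q * l <= P.
  by rewrite /Q mulrAC ler_pdivrMr// ler_wpM2l// ltW.
have NP' : N%:R <= (1 + k) * P.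
  by rewrite mulrDl mul1r (le_trans NP)// lerD2l ler_wpM2l.
have hN : h ^+ N <= expR ((1 + k) * `|ln h| * P).
  rewrite -(powR_mulrn _ (ltW h0)) powR_exp// ler_expR.
  apply: le_trans (_ : N%:R * `|ln h| <= _); first by rewrite ler_wpM2l// ler_norm.
  by rewrite mulrAC ler_wpM2r.
have NlnN : N%:R * ln (N%:R : R) <= sigma * (P * l) + ((1 + k) * k + sigma * k) * P.
  have [N0|N0] := posnP N.
    rewrite N0 mul0r addr_ge0 ?mulr_ge0 ?addr_ge0 ?mulr_ge0 ?addr_ge0 ?(ltW s0) ?(ltW P0)//.
  have NR : 0 < N%:R :> R by rewrite ltr0n.
  have lnN : ln (N%:R : R) <= k + sigma * l.
    apply: le_trans (_ : ln ((1 + k) * P) <= _).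
      by rewrite ler_ln ?posrE ?mulr_gt0 ?ltr_pwDl.
    rewrite lnM ?posrE ?ltr_pwDl// ln_powR lerD2r.
    by apply: le_ln1Dx; rewrite (lt_le_trans _ k0).
  have kl0 : 0 <= k + sigma * l by rewrite addr_ge0// mulr_ge0// ltW.
  apply: le_trans (_ : N%:R * (k + sigma * l) <= _); first by rewrite ler_wpM2l.
  rewrite mulrDr.
  have a1 : N%:R * k <= (1 + k) * P * k by rewrite ler_wpM2r.
  have a2 : N%:R * (sigma * l) <= (P + k * Q) * (sigma * l).
    by rewrite ler_wpM2r// mulr_ge0// ltW.
  have a3 : sigma * k * (Q * l) <= sigma * k * P by rewrite ler_wpM2l// mulr_ge0// ltW.
  have e1 : (P + k * Q) * (sigma * l) = sigma * (P * l) + sigma * k * (Q * l) by ring.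
  have e2 : ((1 + k) * k + sigma * k) * P = (1 + k) * P * k + sigma * k * P by ring.
  by rewrite e2; rewrite e1 in a2; lra.
have fN : (N`!)%:R `^ (tau / sigma) <= expR (tau * (P * l) + k2 * P).
  apply: le_trans (_ : ((N ^ N)%:R : R) `^ (tau / sigma) <= _).
    by apply: ge0_ler_powR; rewrite ?nnegrE// ler_nat fact_le_expn.
  have [N0|N0] := posnP N.
    have e0 : 0 <= tau * (P * l) + k2 * P.
      exact: (addr_ge0 (mulr_ge0 (ltW t0) (mulr_ge0 (ltW P0) l0)) (mulr_ge0 k20 (ltW P0))).
    by rewrite N0 expn0 powR1 (le_trans _ (expR_ge1Dx _))// lerDl.
  have NR : 0 < N%:R :> R by rewrite ltr0n.
  rewrite natrX powR_exp ?exprn_gt0// ler_expR lnXn// -[ln _ *+ N]mulr_natl.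
  have -> : tau * (P * l) + k2 * P =
      tau / sigma * (sigma * (P * l) + ((1 + k) * k + sigma * k) * P).
    by rewrite /k2; move: (P) (l) => P' l'; field; rewrite gt_eqF.
  by rewrite ler_wpM2l.
have -> : expR ((k2 + (1 + k) * `|ln h|) * P) * p%:R `^ (tau * P) =
    expR ((1 + k) * `|ln h| * P) * expR (tau * (P * l) + k2 * P).
  by rewrite powR_exp// -!expRD; congr expR; rewrite /l; ring.
by apply: ler_pM => //; rewrite ?exprn_ge0 ?(ltW h0) ?powR_ge0.
Qed.

End Numeric.

(** * Decay of the transforms and uniqueness of densities *)

Section LocalSmoothness.
Variables (R : realType) (d : nat).
Local Notation Rd := 'rV[R]_d.
Local Notation dir := (@dir R d).
Implicit Types (f g : Rd -> R).

Lemma partials_eq_on (V : set Rd) f g : open V -> (forall x, V x -> f x = g x) ->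
  forall s x, V x -> partials s f x = partials s g x.
Proof.
move=> oV fg; elim=> [|i s IH] x Vx; first exact: fg.
apply: near_eq_derive; have : nbhs x V by apply: open_nbhs_nbhs.
by apply: filterS => y; exact: IH.
Qed.

(** The neighbourhood and the function that replaces f may depend on the order:
each order of differentiation of the density is seen on another series. *)
Lemma real_smooth_local (W : set Rd) f :
  (forall n x, W x -> exists V g, [/\ open V, V x, Cn n g & forall y, V y -> f y = g y]) ->
  real_smooth W f.
Proof.
move=> H s x Wx; have [V [g [oV Vx Cg fg]]] := H (size s).+1 x Wx.
have [cs ds] := Cn_partials Cg.
have E := partials_eq_on oV fg s.
have nV : nbhs x V by apply: open_nbhs_nbhs.
have nE : \forall y \near x, partials s g y = partials s f y.
  by apply: filterS nV => y Vy; rewrite E.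
split=> [|i]; last exact: near_eq_derivable nE (ds i x).
apply: cvg_trans; first exact: near_eq_cvg nE.
by rewrite E//; exact: cs.
Qed.

End LocalSmoothness.

Section Kernels.
Variables (R : realType) (d : nat).
Local Notation Rd := 'rV[R]_d.
Local Notation dir := (@dir R d).

Lemma trig_partials s (a b : R) (xi x : Rd) :
  `|partials s (trig a b xi) x| <= (2 * pi * euclid xi) ^+ size s * (`|a| + `|b|).
Proof.
elim/last_ind: s a b => [|s i IH] a b; first by rewrite mul1r; exact: trig_norm.
rewrite partials_rcons (derive_fun (fun y => trig_deriv a b xi i y)) size_rcons.
have p0 : 0 <= 2 * pi :> R by rewrite mulr_ge0// pi_ge0.
have coef (c : R) : `|2 * pi * xi 0 i * c| <= 2 * pi * euclid xi * `|c|.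
  rewrite normrM ler_wpM2r// normrM (ger0_norm p0) ler_wpM2l//.
  exact: coord_le_euclid.
apply: (le_trans (IH _ _)); rewrite exprSr -[leRHS]mulrA ler_wpM2l//.
  by rewrite exprn_ge0// mulr_ge0// euclid_ge0.
by rewrite normrN [leRHS]mulrDr [leRHS]addrC lerD.
Qed.

(** The exponentials of frequency at most 1 have derivatives of order k bounded by
(2 pi)^k, hence form a bounded set in the smooth functions. *)
Lemma small_freq_bound U (uN : nat -> (Rd -> R[i]) -> R[i]) :
  strongly_bounded U (range uN) -> exists2 M : R, 0 <= M &
    forall N xi, euclid xi <= 1 -> Normc.normc (fourier U (uN N) xi) <= M.
Proof.
move=> [_ sb].
have [|M HM] := sb [set phi | exists2 xi : Rd, euclid xi <= 1 & phi = fourier_kernel xi].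
  split=> [phi [xi _ ->]|K m cK KU].
    have [h1 h2] := kernel_smooth xi.
    by split=> s x _; [exact: h1|exact: h2].
  have p1 : 1 <= 2 * pi :> R by have := @pi_ge2 R; lra.
  exists ((2 * pi) ^+ m * 2) => phi [xi xi1 ->].
  have pm0 : 0 <= (2 * pi) ^+ m :> R by rewrite exprn_ge0// (le_trans ler01 p1).
  apply: seminorm_le => [|s x sm Kx]; first by rewrite mulr_ge0.
  have tb (a b : R) : `|a| + `|b| = 1 -> `|partials s (trig a b xi) x| <= (2 * pi) ^+ m.
    move=> ab; apply: (le_trans (trig_partials _ _ _ _ _)); rewrite ab mulr1.
    apply: le_trans (_ : (2 * pi) ^+ size s <= _); last exact: ler_weXn2l.
    apply: lerXn2r; rewrite ?nnegrE ?mulr_ge0 ?pi_ge0 ?euclid_ge0//.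
    by rewrite ler_piMr// (le_trans ler01 p1).
  have -> : (fun y => complex.Re (fourier_kernel xi y)) = trig 1 0 xi.
    by apply/funext => y; rewrite /trig /= mul1r mul0r addr0.
  have -> : (fun y => complex.Im (fourier_kernel xi y)) = trig 0 (-1) xi.
    by apply/funext => y; rewrite /trig /= mul0r add0r mulN1r.
  rewrite mulr_natr mulr2n lerD// tb//; first by rewrite normr1 normr0 addr0.
  by rewrite normr0 normrN normr1 add0r.
exists `|M| => // N xi xi1; apply: le_trans (ler_norm _).
by apply: HM; [exists N|exists xi].
Qed.

Lemma fourier_decay U (T : (Rd -> R[i]) -> R[i]) (M D sigma : R) (N p : nat) :
  0 <= M -> 0 <= D ->
  (forall xi, euclid xi <= 1 -> Normc.normc (fourier U T xi) <= M) ->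
  (forall xi : Rd, xi != 0 -> Normc.normc (fourier U T xi) <=
     D / euclid xi ^ Num.floor (N%:R `^ sigma^-1)) ->
  (p + (d + d))%:R <= N%:R `^ sigma^-1 :> R ->
  decay p (M + D) (fourier_re U T) /\ decay p (M + D) (fourier_im U T).
Proof.
move=> M0 D0 small large pN.
suff H xi : Normc.normc (fourier U T xi) * emax1 xi ^+ (p + (d + d)) <= M + D.
  split=> xi; apply: le_trans (H xi); rewrite ler_wpM2r ?exprn_ge0 ?(ltW (emax1_gt0 xi))//.
    exact: normc_Re_le.
  exact: normc_Im_le.
have [le1|gt1] := leP (euclid xi) 1.
  rewrite /emax1 max_l// expr1n mulr1 (le_trans (small _ le1))// lerDl//.
have e0 : 0 < euclid xi := lt_trans ltr01 gt1.
rewrite /emax1 max_r ?(ltW gt1)//.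
have xi0 : xi != 0.
  apply: contraTN gt1 => /eqP ->; rewrite -leNgt /euclid /dotv big1 ?sqrtr0//.
  by move=> i _; rewrite mxE mul0r.
apply: le_trans (_ : D <= _); last by rewrite lerDr.
rewrite -ler_pdivlMr ?exprn_gt0//; apply: (le_trans (large _ xi0)).
rewrite ler_wpM2l// lef_pV2 ?posrE ?exprn_gt0 ?exprz_gt0//.
rewrite exprnP; apply: ler_weXz2l; first exact: ltW.
by rewrite floor_ge_int.
Qed.

(** As a function of y the kernel is a trigonometric polynomial. *)
Lemma kern_smooth n L (x : Rd) : smoothR (fun y => kern n.+1 L (x - y)).
Proof.
have n0 : n.+1%:R ^+ d != 0 :> R by rewrite expf_neq0// pnatr_eq0.
have -> : (fun y => kern n.+1 L (x - y)) = fun y => (n.+1%:R ^+ d)^-1 *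
    \sum_(g : {ffun 'I_d -> 'I_n.+1 * 'I_n.+1})
      trig (cos (2 * pi * dotv x (freq L g))) (sin (2 * pi * dotv x (freq L g)))
           (freq L g) y.
  apply/funext => y; apply: (mulfI n0); rewrite [RHS]mulrA mulfV// mul1r -sum_cos_kern//.
  by apply: eq_bigr => g _; rewrite dotvBl mulrBr cosB.
by move=> k; apply: Cn_scale; apply: Cn_sum => g _; exact: trig_smooth.
Qed.

(** The fundamental lemma of the calculus of variations, by testing against a
plateau function times the Fejer kernels centred at the point. *)
Lemma box_unique (W : set Rd) (L : R) (f : Rd -> R) : 0 < L -> open W -> bl f ->
  (forall rho : Rd -> R, smoothR rho -> test_fun W (fun x => (rho x)%:C) ->
     (forall x, fsupp (fun x => (rho x)%:C) x -> inbox (L / 4) x) ->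
     boxint (L / 2) (fun y => f y * rho y) = 0) ->
  forall x, W x -> inbox (L / 8) x -> f x = 0.
Proof.
move=> L0 oW blf H x Wx xb.
have [r1 r10 HW] := open_cball oW Wx.
pose r := Num.min (r1 / 2) (L / 16).
have r0 : 0 < r by rewrite lt_min !divr_gt0.
have rW : [set y : Rd | forall i, `|y 0 i - x 0 i| <= 2 * r] `<=` W.
  move=> y /= yx; apply: HW => i /=; apply: (le_trans (yx i)).
  by rewrite mulrC -ler_pdivlMr// ge_min lexx.
have [rho [srho trho frho rho1]] := plateau_test r0 rW.
have supp y : fsupp (fun x => (rho x)%:C) y -> inbox (L / 4) y.
  move=> /frho /= yx i; have := yx i; have := xb i.
  have : r <= L / 16 by rewrite ge_min lexx orbT.
  move=> h1 h2 h3; have -> : y 0 i = (y 0 i - x 0 i) + x 0 i by rewrite subrK.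
  by apply: (le_trans (ler_normD _ _)); lra.
have blr : bl rho.
  apply: (smooth_cs_bl srho (K := fsupp (fun x => (rho x)%:C))); first by case: trho.
  by move=> y /fsuppP[].
have rx : rho x = 1 by apply: rho1 => i /=; rewrite subrr normr0 ltW.
have -> : f x = f x * rho x by rewrite rx mulr1.
apply: eq_of_le_eps => e e0.
have [n0 Hn0] := korovkin L0 (bl_mul blf blr) e0.
have xb4 : inbox (L / 4) x by move=> i; apply: (le_trans (xb i)); have := L0; lra.
have := Hn0 n0.+1 (leqnSn _) isT x xb4.
suff -> : fmean n0.+1 L (fun y => f y * rho y) x = 0 by rewrite sub0r normrN subr0.
rewrite /fmean; have sk := kern_smooth n0 L x.
have := H (fun y => rho y * kern n0.+1 L (x - y)).
have E : (fun y => (rho y * kern n0.+1 L (x - y))%:C) =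
    (fun y => (rho y)%:C * (kern n0.+1 L (x - y))%:C).
  by apply/funext => y; rewrite rmorphM.
rewrite E => /(_ (smoothR_mul srho sk) (test_fun_mulr trho (smooth_real sk))).
move=> Z; rewrite (_ : (fun y => _) = fun y => f y * (rho y * kern n0.+1 L (x - y))).
  by rewrite Z ?mulr0// => y /fsupp_mull; exact: supp.
by apply/funext => y; rewrite mulrA.
Qed.

End Kernels.

(** * Gluing the densities *)

Section Gluing.
Variables (R : realType) (d : nat) (Omega : set 'rV[R]_d).
Variable u : ('rV[R]_d -> R[i]) -> R[i].
Local Notation Rd := 'rV[R]_d.
Hypothesis oOmega : open Omega.

(** The test functions live in a box larger than the one where they determine f,
which has half-side L/8 ([density_unique]). *)
Definition density_on (L : R) (f : Rd -> R[i]) := forall psi, test_fun Omega psi ->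
  (forall x, fsupp psi x -> inbox (L / 4) x) -> u psi = integralC (fun x => f x * psi x).

Definition blC (f : Rd -> R[i]) :=
  bl (fun x => complex.Re (f x)) /\ bl (fun x => complex.Im (f x)).

Lemma density_onW (L L' : R) f : L' <= L -> density_on L f -> density_on L' f.
Proof.
move=> LL Hf psi tpsi psiL; apply: Hf => // x /psiL xL i.
by apply: (le_trans (xL i)); lra.
Qed.

(** [box_unique] for the real and the imaginary parts, both of which are treated
as a projection p. *)
Lemma density_unique (L : R) f g : 0 < L -> blC f -> blC g ->
  density_on L f -> density_on L g -> forall x, Omega x -> inbox (L / 8) x -> f x = g x.
Proof.
move=> L0 [fr fi] [gr gi] Hf Hg x Ox xb; have L2 : 0 < L / 2 by rewrite divr_gt0.
have key (p : R[i] -> R) : (forall (z : R[i]) (c : R), p (z * c%:C) = p z * c) ->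
    (forall h, p (integralC h) = integralRd (fun y : Rd => p (h y))) ->
    bl (fun y => p (f y)) -> bl (fun y => p (g y)) -> p (f x) = p (g x).
  move=> pM pI bf bg; apply/eqP; rewrite -subr_eq0; apply/eqP.
  apply: (box_unique L0 oOmega (bl_sub bf bg) _ Ox xb) => rho srho trho rhoL.
  have blr : bl rho.
    apply: (smooth_cs_bl srho (K := fsupp (fun x => (rho x)%:C))); first by case: trho.
    by move=> y /fsuppP[].
  have rho0 y : ~ inbox (L / 2) y -> rho y = 0.
    move=> ny; have : ~ fsupp (fun x => (rho x)%:C) y; last by move=> /fsuppP[].
    by move=> /rhoL yL; apply: ny => i; apply: (le_trans (yL i)); lra.
  have box h : p (integralC (fun y => h y * (rho y)%:C)) =
      boxint (L / 2) (fun y => p (h y) * rho y).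
    rewrite pI -(integralRd_boxint (a := L / 2)); last by move=> y /rho0 ->; rewrite mulr0.
    by congr integralRd; apply/funext => y; rewrite pM.
  have := congr1 p (Hf _ trho rhoL); rewrite (Hg _ trho rhoL) !box => E.
  have -> : (fun y => (p (f y) - p (g y)) * rho y) =
      (fun y => p (f y) * rho y - p (g y) * rho y).
    by apply/funext => y; rewrite mulrBl.
  by rewrite boxintB ?E ?subrr//; apply: bl_mul.
have Er : complex.Re (f x) = complex.Re (g x).
  by apply: key => // [[a b] c]; rewrite /= mulr0 subr0.
have Ei : complex.Im (f x) = complex.Im (g x).
  by apply: key => // [[a b] c]; rewrite /= mulr0 add0r.
by apply/eqP; rewrite eq_complex Er Ei !eqxx.
Qed.

Variables (dn : nat -> R -> Rd -> R[i]) (Lb : nat -> R).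
Hypothesis Lb1 : forall p, 1 <= Lb p.
Hypothesis dnP : forall p L, Lb p <= L -> blC (dn p L) /\ density_on L (dn p L).

Lemma dn_agree p q L L' x : Lb p <= L -> Lb q <= L' -> Omega x ->
  inbox (L / 8) x -> inbox (L' / 8) x -> dn p L x = dn q L' x.
Proof.
move=> pL qL Ox xL xL'; have [b1 d1] := dnP pL; have [b2 d2] := dnP qL.
pose M := Num.min L L'.
have M0 : 0 < M.
  rewrite lt_min (lt_le_trans (lt_le_trans ltr01 (Lb1 p)) pL).
  exact: (lt_le_trans (lt_le_trans ltr01 (Lb1 q)) qL).
apply: (@density_unique M) => //.
- by apply: density_onW d1; rewrite ge_min lexx.
- by apply: density_onW d2; rewrite ge_min lexx orbT.
- by move=> i; rewrite /M; case: (leP L L').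
Qed.

(** The value at x is taken from the order 0 and a box large enough to contain x;
by [glueE] any other order and box give the same value. *)
Definition glue (x : Rd) : R[i] := dn 0 (Lb 0 + 8 * \sum_i `|x 0 i|) x.

Lemma glueE p L x : Lb p <= L -> Omega x -> inbox (L / 8) x -> glue x = dn p L x.
Proof.
move=> pL Ox xL; apply: dn_agree => //.
  by rewrite lerDl mulr_ge0// sumr_ge0.
move=> i; have := Lb1 0; rewrite (bigD1 i)//=.
have : 0 <= \sum_(j < d | j != i) `|x 0 j| by exact: sumr_ge0.
by lra.
Qed.

End Gluing.

Lemma compact_inbox (R : realType) d (K : set 'rV[R]_d) : compact K ->
  exists2 C : R, 0 <= C & forall x, K x -> inbox C x.
Proof.
move=> cK.
have /choice[C HC] : forall i : 'I_d, exists C : R,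
    0 <= C /\ forall x, K x -> `|x 0 i| <= C.
  move=> i; have [C C0 HC] := compact_bound cK (Cn_continuous (@Cn_coord R d 0 i)).
  by exists C.
exists (\sum_i C i); first by apply: sumr_ge0 => i _; exact: (HC i).1.
move=> x Kx i; apply: (le_trans ((HC i).2 x Kx)).
by rewrite (bigD1 i)//= lerDl sumr_ge0// => j _; exact: (HC j).1.
Qed.

Lemma inbox_nbhs (R : realType) d (L : R) (x : 'rV[R]_d) : 0 < L -> inbox (L / 16) x ->
  nbhs x [set y : 'rV[R]_d | inbox (L / 8) y].
Proof.
move=> L0 xL; have r0 : 0 < L / 16 by rewrite divr_gt0.
apply: filterS (nbhs_cball x r0) => y /= yx i.
have -> : y 0 i = (y 0 i - x 0 i) + x 0 i by rewrite subrK.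
by apply: (le_trans (ler_normD _ _)); have := yx i; have := xL i; lra.
Qed.

Theorem proposition3p1 (R : realType) (d : nat) (U Omega : set 'rV[R]_d)
    (u : ('rV[R]_d -> R[i]) -> R[i]) (uN : nat -> ('rV[R]_d -> R[i]) -> R[i])
    (tau sigma A h : R) :
  open U -> schwartz_distribution U u -> 0 < tau -> 1 < sigma ->
  open Omega -> Omega `<=` U -> closure Omega `<=` U ->
  strongly_bounded U (range uN) ->
  (forall N : nat, dist_eq_on Omega (uN N) u) ->
  0 < A -> 0 < h ->
  (forall (N : nat) (xi : 'rV[R]_d), xi != 0 ->
     Normc.normc (fourier U (uN N) xi) <=
       A * (h ^+ N * (N`!)%:R `^ (tau / sigma)
              / euclid xi ^ Num.floor (N%:R `^ sigma^-1))) ->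
  dist_ext_gevrey tau sigma Omega u.
Proof.
move=> oU _ tau0 sigma1 oOm OmU _ sb uNu A0 h0 HF.
have [M M0 HM] := small_freq_bound sb.
(* of the orders of decay added to p, 2d are summed over the lattice and the
   others keep the derivatives of order p Lipschitz *)
have [Nf [k [k0 HNf growth]]] := gevrey_growth (2 + (d + d)) tau0 sigma1 h0.
pose T p := uN (Nf p).
pose D p := A * (h ^+ Nf p * (Nf p)`!%:R `^ (tau / sigma)).
have D0 p : 0 <= D p.
  by rewrite mulr_ge0 ?(ltW A0)// mulr_ge0 ?powR_ge0// exprn_ge0// ltW.
have dec p : decay (p + 2) (M + D p) (fourier_re U (T p)) /\
             decay (p + 2) (M + D p) (fourier_im U (T p)).
  apply: (fourier_decay (sigma := sigma) (N := Nf p) M0 (D0 p)).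
  - by move=> xi; exact: HM.
  - by move=> xi xi0; rewrite /D -[leRHS]mulrA; exact: HF.
  - by rewrite -addnA; exact: HNf.
have cT p : compact_distribution U (T p) by apply: sb.1; exists (Nf p).
have /choice[chi Hchi] p := pairing_cutoff oU (cT p).
have /choice[Lb HLb] : forall p, exists L : R, 1 <= L /\
    forall L', L <= L' -> forall x, fsupp (chi p) x -> inbox (L' / 4) x.
  move=> p; have [[[_ cchi _] _] _] := Hchi p.
  have [C C0 HC] := compact_inbox cchi; exists (1 + 4 * C); split; first by lra.
  by move=> L' CL x /HC xC i; apply: (le_trans (xC i)); lra.
have Lb1 p : 1 <= Lb p := (HLb p).1.
pose dn p L := box_density U (T p) L.
have dnP p L : Lb p <= L -> blC (dn p L) /\ density_on Omega u L (dn p L).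
  move=> pL; have L1 : 1 <= L := le_trans (Lb1 p) pL.
  have [d1 d2] := dec p; have [chiT pairT] := Hchi p.
  have r1 : decay 1 (M + D p) (fourier_re U (T p)) by apply: decayW d1; rewrite addn2.
  have i1 : decay 1 (M + D p) (fourier_im U (T p)) by apply: decayW d2; rewrite addn2.
  split; first split; [apply: (fourier_series_bl L1 r1); exact: decay_opp|exact: (fourier_series_bl L1 i1)|].
  move=> psi tpsi psiL; rewrite -(uNu (Nf p)) => //.
  apply: (dist_box_density (chi := chi p) (B := M + D p) (cT p).1) => //.
    by move=> x; exact: (HLb p).2.
  exact: test_funW tpsi.
pose phi := glue dn Lb.
have phiE p L x : Lb p <= L -> Omega x -> inbox (L / 8) x -> phi x = dn p L x.
  exact: (glueE oOm Lb1 dnP).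
(* the box of half-side L/16 has a neighbourhood in that of half-side L/8, where
   the densities agree *)
have loc p L x : Lb p <= L -> Omega x -> inbox (L / 16) x ->
    exists V, [/\ open V, V x & forall y, V y -> phi y = dn p L y].
  move=> pL Ox xL; have L0 : 0 < L := lt_le_trans (lt_le_trans ltr01 (Lb1 p)) pL.
  exists (Omega `&` [set y : 'rV[R]_d | inbox (L / 8) y]°); split.
  - by apply: openI => //; exact: open_interior.
  - by split=> //; exact: inbox_nbhs.
  - by move=> y [Oy /interior_subset yL]; exact: phiE.
have pick_L p (x : 'rV[R]_d) : exists2 L, Lb p <= L & inbox (L / 16) x.
  exists (Lb p + 16 * \sum_i `|x 0 i|); first by rewrite lerDl mulr_ge0// sumr_ge0.
  move=> i; have := Lb1 p; rewrite (bigD1 i)//=.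
  have : 0 <= \sum_(j < d | j != i) `|x 0 j| by exact: sumr_ge0.
  by lra.
exists phi; split; last first.
  move=> psi tpsi; have [_ cpsi psiO] := tpsi.
  have [C C0 HC] := compact_inbox cpsi.
  have L0b : Lb 0 <= Lb 0 + 8 * C by lra.
  have [_ dd] := dnP 0 _ L0b; rewrite dd//; last first.
    by move=> x /HC xC i; apply: (le_trans (xC i)); have := Lb1 0; lra.
  congr integralC; apply/funext => x.
  have [sx|nsx] := pselect (fsupp psi x); last by rewrite (fsuppP nsx) !mulr0.
  rewrite (phiE 0 _ x L0b)//; first exact: psiO.
  by move=> i; apply: (le_trans (HC _ sx i)); have := Lb1 0; lra.
split.
  split; apply: real_smooth_local => n x Ox; have [L pL xL] := pick_L n x;
    have [V [oV Vx VE]] := loc n L x pL Ox xL;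
    have L1 : 1 <= L := le_trans (Lb1 n) pL; have [d1 d2] := dec n.
    exists V, (fourier_series L (fourier_re U (T n)) (fun xi => - fourier_im U (T n) xi)); split.
    - exact: oV.
    - exact: Vx.
    - apply: (fourier_series_Cn L1 (B := M + D n)); first by apply: decayW d1; rewrite addn2.
      by apply: decay_opp; apply: decayW d2; rewrite addn2.
    - by move=> y /VE yE; exact: (congr1 (@complex.Re R) yE).
  exists V, (fourier_series L (fourier_im U (T n)) (fourier_re U (T n))); split.
  - exact: oV.
  - exact: Vx.
  - by apply: (fourier_series_Cn L1 (B := M + D n)); [apply: decayW d2|apply: decayW d1]; rewrite addn2.
  - by move=> y /VE yE; exact: (congr1 (@complex.Im R) yE).
move=> K cK KO.
have der (alpha : mindex d) x : K x -> Normc.normc (mderive alpha phi x) <=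
    4 * 12 ^+ d * ((2 * pi) ^+ mlen alpha * (M + D (mlen alpha))).
  move=> Kx; have Ox := KO x Kx; set p := mlen alpha.
  have [L pL xL] := pick_L p x; have [V [oV Vx VE]] := loc p L x pL Ox xL.
  have L1 : 1 <= L := le_trans (Lb1 p) pL; have [d1 d2] := dec p.
  have sz : ((size (mdirs alpha)).+1 <= p + 2)%N by rewrite size_mdirs addn2.
  have eR : partials (mdirs alpha) (fun y => complex.Re (phi y)) x =
      partials (mdirs alpha) (fourier_series L (fourier_re U (T p)) (fun xi => - fourier_im U (T p) xi)) x.
    by apply: (partials_eq_on oV) Vx => y /VE yE; exact: (congr1 (@complex.Re R) yE).
  have eI : partials (mdirs alpha) (fun y => complex.Im (phi y)) x =
      partials (mdirs alpha) (fourier_series L (fourier_im U (T p)) (fourier_re U (T p))) x.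
    by apply: (partials_eq_on oV) Vx => y /VE yE; exact: (congr1 (@complex.Im R) yE).
  apply: (le_trans (normc_le _)); rewrite /mderive /= eR eI.
  have b1 := fourier_series_partials L1 x (decayW sz d1) (decay_opp (decayW sz d2)).
  have b2 := fourier_series_partials L1 x (decayW sz d2) (decayW sz d1).
  apply: (le_trans (lerD b1 b2)); rewrite size_mdirs -/p.
  by rewrite le_eqVlt; apply/orP; left; apply/eqP; ring.
(* exp(2 pi p^sigma) absorbs the factor (2 pi)^p *)
pose H := expR (k + 2 * pi); pose Q := 4 * 12 ^+ d : R.
have Q0 : 0 < Q by rewrite mulr_gt0// exprn_gt0.
have p0 : 0 < 2 * pi :> R by rewrite mulr_gt0// pi_gt0.
exists H, (Q * (M + A) + Q * (M + D 0%N) + 1); split; first exact: expR_gt0.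
  by rewrite ltr_wpDl// addr_ge0// mulr_ge0 ?(ltW Q0)// addr_ge0// ltW.
move=> alpha x Kx; apply: (le_trans (der alpha x Kx)); rewrite -/Q.
have QA : 0 <= Q * (M + A) by rewrite mulr_ge0 ?(ltW Q0)// addr_ge0// ltW.
have QD : 0 <= Q * (M + D 0%N) by rewrite mulr_ge0 ?(ltW Q0)// addr_ge0.
have [->|pp] := posnP (mlen alpha).
  rewrite expr0 mul1r powR0 ?gt_eqF ?(lt_trans ltr01)// powRr0 mulr0 powRr0 !mulr1.
  by lra.
set p := mlen alpha in pp *; set P := p%:R `^ sigma.
have p1 : 1 <= p%:R :> R by rewrite ler1n.
have pP : p%:R <= P by rewrite /P le1r_powR// ltW.
have P0 : 0 <= P by rewrite powR_ge0.
have G := growth p pp; rewrite -/P in G.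
set E := expR (k * P) * p%:R `^ (tau * P) in G.
have E1 : 1 <= E.
  rewrite -[1]mulr1; apply: ler_pM => //.
    by rewrite (le_trans _ (expR_ge1Dx _))// lerDl mulr_ge0.
  apply: le_trans (_ : p%:R `^ 0 <= _); first by rewrite powRr0.
  by apply: ler_powR => //; rewrite mulr_ge0// ltW.
have MD : M + D p <= (M + A) * E.
  by rewrite mulrDl lerD ?ler_peMr// /D ler_wpM2l// ltW.
have pi_p : (2 * pi) ^+ p <= expR (2 * pi * P) :> R.
  rewrite -powR_mulrn ?(ltW p0)// powR_exp// ler_expR mulrC.
  by apply: ler_pM => //; rewrite ?ln_ge0//; [have := @pi_ge2 R; lra|rewrite ltW// ln_sublinear].
have HP : H `^ P * p%:R `^ (tau * P) = expR (2 * pi * P) * E.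
  by rewrite /H /E -expRM mulrA -expRD; congr (expR _ * _); ring.
rewrite -mulrA HP.
apply: le_trans (_ : Q * (expR (2 * pi * P) * ((M + A) * E)) <= _).
  rewrite ler_wpM2l ?(ltW Q0)//; apply: ler_pM => //; first by rewrite exprn_ge0 ?(ltW p0).
  by rewrite addr_ge0.
have -> : Q * (expR (2 * pi * P) * ((M + A) * E)) = Q * (M + A) * (expR (2 * pi * P) * E).
  by ring.
rewrite ler_wpM2r//; first by rewrite mulr_ge0 ?expR_ge0// (le_trans ler01 E1).
by lra.
Qed.
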